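(* Let $m, n$ be positive integers with $m \geq 2$ and $n \geq 3$, and let $K$ be a field containing a primitive $m$-th root of unity $q$. Let $\sharp_{n,m}^{q}$ be the number of types (isomorphism classes) of Hopf algebras over $K$ which factorize through the Taft algebra $T_{m^2}(q)$ and the group Hopf algebra $K[D_{2n}]$ of the dihedral group $D_{2n}$ of order $2n$. Then $$\sharp_{n,m}^{q} = \begin{cases} 2, & \text{if } m \text{ and } n \text{ are both odd},\\ 3, & \text{if } m \text{ is odd and } n \text{ is even},\\ 1, & \text{if } m \text{ and } n \text{ are both even, or } m \text{ is even and } n \text{ is odd}. \end{cases}$$
   Context: All algebras, coalgebras, Hopf algebras and tensor products are over $K$. $U_m(K)$ is the group of $m$-th roots of unity in $K$; a primitive $m$-th root of unity is a generator of $U_m(K)$ when $|U_m(K)| = m$. Taft algebra: $T_{m^2}(q)$ is the Hopf algebra generated as an algebra by $h$ and $x$ subject to $h^m = 1$, $x^m = 0$, $xh = q\,hx$, with $\Delta(h) = h \otimes h$, $\Delta(x) = x \otimes h + 1 \otimes x$, $\varepsilon(h) = 1$, $\varepsilon(x) = 0$. The elements $h^i x^j$, $0 \leq i, j \leq m-1$, form a $K$-basis. $D_{2n} = \langle c, d \mid c^2 = d^n = 1,\ cd = d^{n-1} c\rangle$ is the dihedral group, and $K[D_{2n}]$ its group Hopf algebra. Factorization: a Hopf algebra $E$ factorizes through Hopf algebras $A$ and $H$ if there exist injective Hopf algebra maps $i : A \to E$ and $j : H \to E$ such that the map $A \otimes H \to E$, $a \otimes y \mapsto i(a) j(y)$,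 is bijective. Types are counted up to Hopf algebra isomorphism.
   Formalization: For m odd it is additionally assumed that K does not have characteristic 2; in characteristic 2 with m odd (e.g. K = F_4, m = n = 3) the dihedral group has only the trivial character in K, so the true number of types is 1 rather than the claimed 2 or 3. *)

(* Defs.v *)
From HB Require Import structures.
From mathcomp Require Import all_boot all_order all_algebra all_fingroup.
From mathcomp Require Import all_solvable boolp generic_quotient.

Set Implicit Arguments.
Unset Strict Implicit.
Unset Printing Implicit Defensive.

Import GRing.Theory.
Local Open Scope ring_scope.
Local Open Scope quotient_scope.

Section Tensor.
Variables (K : fieldType) (V W : lmodType K).

(* A sequence of pairs stands for the formal sum of the v (x) w.  The tensor
   product is the quotient of formal sums by the congruence below; scalars
   need no separate generator, k (v (x) w) being (k v) (x) w. *)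
Inductive tens_eqv : seq (V * W) -> seq (V * W) -> Prop :=
| tens_eqv_refl s : tens_eqv s s
| tens_eqv_sym s t : tens_eqv s t -> tens_eqv t s
| tens_eqv_trans s t u : tens_eqv s t -> tens_eqv t u -> tens_eqv s u
| tens_eqv_cat s s' t t' :
    tens_eqv s s' -> tens_eqv t t' -> tens_eqv (s ++ t) (s' ++ t')
| tens_eqv_catC s t : tens_eqv (s ++ t) (t ++ s)
| tens_eqv_Dl v v' w : tens_eqv [:: (v + v', w)] [:: (v, w); (v', w)]
| tens_eqv_Dr v w w' : tens_eqv [:: (v, w + w')] [:: (v, w); (v, w')]
| tens_eqv_Z k v w : tens_eqv [:: (k *: v, w)] [:: (v, k *: w)]
| tens_eqv_0 w : tens_eqv [:: (0, w)] [::].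

Definition tens_rel : rel (seq (V * W)) := fun s t => `[< tens_eqv s t >].

Fact tens_rel_refl : reflexive tens_rel.
Proof. by move=> s; apply/asboolP/tens_eqv_refl. Qed.
Fact tens_rel_sym : symmetric tens_rel.
Proof. by move=> s t; apply/asboolP/asboolP; apply: tens_eqv_sym. Qed.
Fact tens_rel_trans : transitive tens_rel.
Proof.
by move=> t s u /asboolP st /asboolP tu; apply/asboolP/(tens_eqv_trans st tu).
Qed.

Canonical tens_equiv := EquivRel tens_rel tens_rel_refl tens_rel_sym
  tens_rel_trans.

Definition tensor := {eq_quot tens_equiv}.
HB.instance Definition _ := Choice.on tensor.
HB.instance Definition _ := EqQuotient.on tensor.

Implicit Types (s t : seq (V * W)).

Lemma tensor_eqP s t : \pi_tensor s = \pi_tensor t <-> tens_eqv s t.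
Proof.
split=> [/eqP|st]; first by rewrite piE => /asboolP.
by apply/eqP; rewrite piE; apply/asboolP.
Qed.

Lemma tensor_reprP s : tens_eqv (repr (\pi_tensor s)) s.
Proof. by apply/tensor_eqP; rewrite reprK. Qed.

Definition tens_scale0 k s := [seq (k *: p.1, p.2) | p <- s].

Lemma tens_scale0_eqv k s t :
  tens_eqv s t -> tens_eqv (tens_scale0 k s) (tens_scale0 k t).
Proof.
rewrite /tens_scale0; elim=> {s t} /=.
- by move=> *; apply: tens_eqv_refl.
- by move=> *; apply: tens_eqv_sym.
- by move=> *; apply: tens_eqv_trans; eassumption.
- by move=> *; rewrite !map_cat; apply: tens_eqv_cat.
- by move=> *; rewrite !map_cat; apply: tens_eqv_catC.
- by move=> v v' w; rewrite scalerDr; apply: tens_eqv_Dl.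
- by move=> v w w'; apply: tens_eqv_Dr.
- by move=> l v w; rewrite scalerA mulrC -scalerA; apply: tens_eqv_Z.
- by move=> w; rewrite scaler0; apply: tens_eqv_0.
Qed.

Definition tens_add (x y : tensor) : tensor := \pi_tensor (repr x ++ repr y).
Definition tens_scale k (x : tensor) : tensor := \pi_tensor (tens_scale0 k (repr x)).

Lemma tens_add_pi s t : tens_add (\pi_tensor s) (\pi_tensor t) = \pi_tensor (s ++ t).
Proof. by apply/tensor_eqP/tens_eqv_cat; apply: tensor_reprP. Qed.

Lemma tens_scale_pi k s : tens_scale k (\pi_tensor s) = \pi_tensor (tens_scale0 k s).
Proof. by apply/tensor_eqP/tens_scale0_eqv/tensor_reprP. Qed.

Fact tens_addA : associative tens_add.
Proof.
elim/quotW=> s; elim/quotW=> t; elim/quotW=> u.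
by rewrite (tens_add_pi t u) (tens_add_pi s t) !tens_add_pi catA.
Qed.
Fact tens_addC : commutative tens_add.
Proof.
elim/quotW=> s; elim/quotW=> t; rewrite !tens_add_pi.
exact/tensor_eqP/tens_eqv_catC.
Qed.
Fact tens_add0 : left_id (\pi_tensor [::]) tens_add.
Proof. by elim/quotW=> s; rewrite tens_add_pi. Qed.
Fact tens_addN : left_inverse (\pi_tensor [::]) (tens_scale (-1)) tens_add.
Proof.
elim/quotW=> s; rewrite tens_scale_pi tens_add_pi; apply/tensor_eqP.
elim: s => [|[v w] s IHs] /=; first exact: tens_eqv_refl.
set S := tens_scale0 _ _ in IHs *.
apply: (tens_eqv_trans (t := [:: (-1 *: v, w); (v, w)] ++ (S ++ s))).
  apply: (@tens_eqv_cat [:: _] [:: _]); first exact: tens_eqv_refl.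
  rewrite -[(v, w) :: s]cat1s catA.
  apply: (@tens_eqv_cat _ ([:: (v, w)] ++ S)); last exact: tens_eqv_refl.
  exact: tens_eqv_catC.
rewrite -[[::]](cat0s [::]); apply: tens_eqv_cat => //.
apply: tens_eqv_trans (tens_eqv_sym (tens_eqv_Dl _ _ _)) _.
by rewrite scaleN1r addNr; apply: tens_eqv_0.
Qed.

HB.instance Definition _ :=
  GRing.isZmodule.Build tensor tens_addA tens_addC tens_add0 tens_addN.

Lemma tensorD_pi s t : \pi_tensor s + \pi_tensor t = \pi_tensor (s ++ t) :> tensor.
Proof. exact: tens_add_pi. Qed.

Definition tens (v : V) (w : W) : tensor := \pi_tensor [:: (v, w)].

Lemma tensDl v v' w : tens (v + v') w = tens v w + tens v' w.
Proof. by rewrite tensorD_pi; apply/tensor_eqP/tens_eqv_Dl. Qed.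

Lemma tensDr v w w' : tens v (w + w') = tens v w + tens v w'.
Proof. by rewrite tensorD_pi; apply/tensor_eqP/tens_eqv_Dr. Qed.

Lemma tensor_pi s : \pi_tensor s = \sum_(p <- s) tens p.1 p.2.
Proof.
elim: s => [|[v w] s IHs]; first by rewrite big_nil.
by rewrite big_cons -IHs tensorD_pi.
Qed.

Lemma tens_scale_tens k v w : tens_scale k (tens v w) = tens (k *: v) w.
Proof. by rewrite tens_scale_pi. Qed.

Lemma tens_scaleDr k : {morph tens_scale k : x y / x + y}.
Proof.
elim/quotW=> s; elim/quotW=> t; rewrite tensorD_pi !tens_scale_pi tensorD_pi.
by rewrite /tens_scale0 map_cat.
Qed.

Lemma tensor_ind (P : tensor -> Prop) :
    P 0 -> (forall v w, P (tens v w)) ->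
  (forall x y, P x -> P y -> P (x + y)) -> forall x, P x.
Proof.
move=> P0 P1 PD; elim/quotW=> s; rewrite tensor_pi.
by elim/big_ind: _ => // p _.
Qed.

Lemma tens_scale_0 k : tens_scale k 0 = 0.
Proof. exact: tens_scale_pi. Qed.

Fact tens_scaleA a b x : tens_scale a (tens_scale b x) = tens_scale (a * b) x.
Proof.
elim/tensor_ind: x => [|v w|x y IHx IHy]; first by rewrite !tens_scale_0.
  by rewrite !tens_scale_tens scalerA.
by rewrite !tens_scaleDr IHx IHy.
Qed.
Fact tens_scale1 : left_id 1 tens_scale.
Proof.
elim/tensor_ind=> [|v w|x y IHx IHy]; first by rewrite !tens_scale_0.
  by rewrite !tens_scale_tens scale1r.
by rewrite !tens_scaleDr IHx IHy.
Qed.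
Fact tens_scaleDl x : {morph tens_scale^~ x : a b / a + b}.
Proof.
move=> a b; elim/tensor_ind: x => [|v w|x y IHx IHy].
- by rewrite !tens_scale_0 addr0.
- by rewrite !tens_scale_tens scalerDl tensDl.
- by rewrite !tens_scaleDr IHx IHy addrACA.
Qed.

HB.instance Definition _ := GRing.Zmodule_isLmodule.Build K tensor
  tens_scaleA tens_scale1 tens_scaleDr tens_scaleDl.

Lemma tensZl k v w : tens (k *: v) w = k *: tens v w.
Proof. by rewrite -tens_scale_tens. Qed.

Lemma tensZr k v w : tens v (k *: w) = k *: tens v w.
Proof. by rewrite -tensZl; apply/tensor_eqP/tens_eqv_sym/tens_eqv_Z. Qed.

Definition bilinear_map (U : lmodType K) (f : V -> W -> U) :=
  (forall w, linear (f^~ w)) /\ (forall v, linear (f v)).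

(* The linear map out of the tensor product induced by f; this is only
   meaningful for bilinear f. *)
Definition tens_lift (U : lmodType K) (f : V -> W -> U) (x : tensor) : U :=
  \sum_(p <- repr x) f p.1 p.2.

Section Lift.
Variables (U : lmodType K) (f : V -> W -> U).
Hypothesis bil_f : bilinear_map f.

Lemma bilDl v v' w : f (v + v') w = f v w + f v' w.
Proof. by have := bil_f.1 w 1 v v'; rewrite !scale1r. Qed.
Lemma bilDr v w w' : f v (w + w') = f v w + f v w'.
Proof. by have := bil_f.2 v 1 w w'; rewrite !scale1r. Qed.
Lemma bil0l w : f 0 w = 0.
Proof. by apply: (@addrI _ (f 0 w)); rewrite -bilDl !addr0. Qed.
Lemma bil0r v : f v 0 = 0.
Proof. by apply: (@addrI _ (f v 0)); rewrite -bilDr !addr0. Qed.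
Lemma bilZl k v w : f (k *: v) w = k *: f v w.
Proof. by have := bil_f.1 w k v 0; rewrite !addr0 bil0l addr0. Qed.
Lemma bilZr k v w : f v (k *: w) = k *: f v w.
Proof. by have := bil_f.2 v k w 0; rewrite !addr0 bil0r addr0. Qed.

Lemma tens_lift_pi s : tens_lift f (\pi_tensor s) = \sum_(p <- s) f p.1 p.2.
Proof.
rewrite /tens_lift; move: (repr _) (tensor_reprP s) => r; elim=> {r s} //.
- by move=> s t u _ -> _ ->.
- by move=> s s' t t' _ es _ et; rewrite !big_cat /= es et.
- by move=> s t; rewrite !big_cat /= addrC.
- by move=> v v' w; rewrite !big_cons !big_nil !addr0 /= bilDl.
- by move=> v w w'; rewrite !big_cons !big_nil !addr0 /= bilDr.
- by move=> k v w; rewrite !big_cons !big_nil !addr0 /= bilZl bilZr.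
- by move=> w; rewrite !big_cons !big_nil !addr0 /= bil0l.
Qed.

Lemma tens_lift_tens v w : tens_lift f (tens v w) = f v w.
Proof. by rewrite tens_lift_pi big_seq1. Qed.

Lemma tens_lift_linear : linear (tens_lift f).
Proof.
move=> k x y.
suff [fZ fD] : (forall x, tens_lift f (k *: x) = k *: tens_lift f x)
    /\ {morph tens_lift f : x y / x + y} by rewrite fD fZ.
have fD : {morph tens_lift f : x y / x + y}.
  elim/quotW=> s; elim/quotW=> t; rewrite tensorD_pi.
  by rewrite !tens_lift_pi big_cat.
split=> // {x y}; elim/tensor_ind=> [|v w|x y IHx IHy].
- by rewrite scaler0 [tens_lift f 0]tens_lift_pi big_nil scaler0.
- by rewrite -tensZl !tens_lift_tens bilZl.
- by rewrite scalerDr !fD scalerDr IHx IHy.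
Qed.

Lemma tens_liftD : {morph tens_lift f : x y / x + y}.
Proof. by move=> x y; have := tens_lift_linear 1 x y; rewrite !scale1r. Qed.
Lemma tens_lift0 : tens_lift f 0 = 0.
Proof. by rewrite [LHS]tens_lift_pi big_nil. Qed.
Lemma tens_liftZ k x : tens_lift f (k *: x) = k *: tens_lift f x.
Proof. by have := tens_lift_linear k x 0; rewrite !addr0 tens_lift0 addr0. Qed.

End Lift.
End Tensor.

Section TensorMaps.
Variable K : fieldType.
Implicit Types U V W : lmodType K.

Lemma bilinear_mapI V W U (f : V -> W -> U) :
    (forall v v' w, f (v + v') w = f v w + f v' w) ->
    (forall v w w', f v (w + w') = f v w + f v w') ->
    (forall k v w, f (k *: v) w = k *: f v w) ->
    (forall k v w, f v (k *: w) = k *: f v w) ->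
  bilinear_map f.
Proof. by move=> Dl Dr Zl Zr; split=> u k v w; rewrite ?(Dl, Dr) ?(Zl, Zr). Qed.

Lemma tens_lift_eq V W U (f g : V -> W -> U) x :
  (forall v w, f v w = g v w) -> tens_lift f x = tens_lift g x.
Proof. by move=> fg; apply: eq_bigr => p _. Qed.

Lemma tens_lift_addf V W U (f g h : V -> W -> U) x :
    (forall v w, h v w = f v w + g v w) ->
  tens_lift h x = tens_lift f x + tens_lift g x.
Proof. by move=> hE; rewrite -big_split /=; apply: eq_bigr => p _. Qed.

Lemma tens_lift_scalef V W U k (f h : V -> W -> U) x :
  (forall v w, h v w = k *: f v w) -> tens_lift h x = k *: tens_lift f x.
Proof. by move=> hE; rewrite scaler_sumr; apply: eq_bigr => p _. Qed.

Lemma bilinear_tens V W : bilinear_map (@tens K V W).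
Proof.
by apply: bilinear_mapI; [exact: tensDl|exact: tensDr|exact: tensZl|exact: tensZr].
Qed.

Definition tens_map V W V' W' (f : V -> V') (g : W -> W') :
    tensor V W -> tensor V' W' :=
  tens_lift (fun v w => tens (f v) (g w)).

Definition tens_assoc U V W : tensor (tensor U V) W -> tensor U (tensor V W) :=
  tens_lift (fun x w => tens_lift (fun u v => tens u (tens v w)) x).

Section Map.
Variables (V W V' W' : lmodType K) (f : {linear V -> V'}) (g : {linear W -> W'}).

Lemma bilinear_tens_map : bilinear_map (fun v w => tens (f v) (g w)).
Proof.
by apply: bilinear_mapI => *; rewrite ?linearD ?linearZ ?(tensDl, tensDr) //=
  ?(tensZl, tensZr).
Qed.

Lemma tens_mapE v w : tens_map f g (tens v w) = tens (f v) (g w).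
Proof. exact/tens_lift_tens/bilinear_tens_map. Qed.
Lemma tens_mapD : {morph tens_map f g : x y / x + y}.
Proof. exact/tens_liftD/bilinear_tens_map. Qed.
Lemma tens_map0 : tens_map f g 0 = 0.
Proof. exact/tens_lift0/bilinear_tens_map. Qed.
Lemma tens_mapZ k x : tens_map f g (k *: x) = k *: tens_map f g x.
Proof. exact/tens_liftZ/bilinear_tens_map. Qed.
End Map.

Section Assoc.
Variables U V W : lmodType K.

Lemma bilinear_tens_assoc1 w : bilinear_map (fun (u : U) (v : V) => tens u (tens v w : tensor V W)).
Proof.
by apply: bilinear_mapI => *; rewrite ?(tensDl, tensDr) ?(tensZl, tensZr).
Qed.

Lemma bilinear_tens_assoc : bilinear_map (fun (x : tensor U V) (w : W) =>
  tens_lift (fun u v => tens u (tens v w)) x).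
Proof.
apply: bilinear_mapI => *.
- exact/tens_liftD/bilinear_tens_assoc1.
- by apply: tens_lift_addf => *; rewrite !tensDr.
- exact/tens_liftZ/bilinear_tens_assoc1.
- by apply: tens_lift_scalef => *; rewrite !tensZr.
Qed.

Lemma tens_assocE (u : U) (v : V) (w : W) :
  tens_assoc (tens (tens u v) w) = tens u (tens v w).
Proof.
rewrite [LHS](tens_lift_tens bilinear_tens_assoc).
exact/tens_lift_tens/bilinear_tens_assoc1.
Qed.
Lemma tens_assocD : {morph @tens_assoc U V W : x y / x + y}.
Proof. exact/tens_liftD/bilinear_tens_assoc. Qed.
Lemma tens_assoc0 : @tens_assoc U V W 0 = 0.
Proof. exact/tens_lift0/bilinear_tens_assoc. Qed.
Lemma tens_assocZ k x : @tens_assoc U V W (k *: x) = k *: tens_assoc x.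
Proof. exact/tens_liftZ/bilinear_tens_assoc. Qed.
End Assoc.

Definition tens_mul V W (mV : V -> V -> V) (mW : W -> W -> W)
    (x y : tensor V W) : tensor V W :=
  tens_lift (fun v w =>
    tens_lift (fun v' w' => tens (mV v v') (mW w w')) y) x.

Section Mul.
Variables (V W : lmodType K) (mV : V -> V -> V) (mW : W -> W -> W).
Hypotheses (bV : bilinear_map mV) (bW : bilinear_map mW).
Local Notation mul := (tens_mul mV mW).

Lemma bilinear_tens_mul1 v w :
  bilinear_map (fun v' w' => tens (mV v v') (mW w w')).
Proof.
apply: bilinear_mapI => *;
 by rewrite ?(bilDr bV) ?(bilDr bW) ?(bilZr bV) ?(bilZr bW) ?(tensDl, tensDr)
  ?(tensZl, tensZr).
Qed.

Lemma bilinear_tens_mul2 y : bilinear_map (fun v w =>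
    tens_lift (fun v' w' => tens (mV v v') (mW w w')) y).
Proof.
apply: bilinear_mapI => *.
- by apply: tens_lift_addf => *; rewrite (bilDl bV) tensDl.
- by apply: tens_lift_addf => *; rewrite (bilDl bW) tensDr.
- by apply: tens_lift_scalef => *; rewrite (bilZl bV) tensZl.
- by apply: tens_lift_scalef => *; rewrite (bilZl bW) tensZr.
Qed.

Lemma tens_mulE v w v' w' :
  mul (tens v w) (tens v' w') = tens (mV v v') (mW w w').
Proof.
rewrite [LHS](tens_lift_tens (bilinear_tens_mul2 _)).
exact/tens_lift_tens/bilinear_tens_mul1.
Qed.

Lemma bilinear_tens_mul : bilinear_map mul.
Proof.
apply: bilinear_mapI => *.
- exact/tens_liftD/bilinear_tens_mul2.
- by apply: tens_lift_addf => *; apply/tens_liftD/bilinear_tens_mul1.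
- exact/tens_liftZ/bilinear_tens_mul2.
- by apply: tens_lift_scalef => *; apply/tens_liftZ/bilinear_tens_mul1.
Qed.

End Mul.

Lemma tens_map_mul V W V' W' (mV : V -> V -> V) (mW : W -> W -> W)
    (mV' : V' -> V' -> V') (mW' : W' -> W' -> W')
    (f : {linear V -> V'}) (g : {linear W -> W'}) :
    bilinear_map mV -> bilinear_map mW ->
    bilinear_map mV' -> bilinear_map mW' ->
    {morph f : x y / mV x y >-> mV' x y} ->
    {morph g : x y / mW x y >-> mW' x y} ->
  {morph tens_map f g : x y / tens_mul mV mW x y >-> tens_mul mV' mW' x y}.
Proof.
move=> bV bW bV' bW' fM gM x y.
have bm := bilinear_tens_mul bV bW; have bm' := bilinear_tens_mul bV' bW'.
elim/tensor_ind: x => [|v w|x x' IHx IHx'].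
- by rewrite (bil0l bm) tens_map0 (bil0l bm').
- elim/tensor_ind: y => [|v' w'|y y' IHy IHy'].
  + by rewrite (bil0r bm) tens_map0 (bil0r bm').
  + by rewrite !(tens_mulE, tens_mapE) // fM gM.
  + by rewrite (bilDr bm) !tens_mapD (bilDr bm') IHy IHy'.
- by rewrite (bilDl bm) !tens_mapD (bilDl bm') IHx IHx'.
Qed.

Lemma tens_assoc_mul U V W (mU : U -> U -> U) (mV : V -> V -> V)
    (mW : W -> W -> W) :
    bilinear_map mU -> bilinear_map mV -> bilinear_map mW ->
  {morph @tens_assoc U V W : x y / tens_mul (tens_mul mU mV) mW x y
     >-> tens_mul mU (tens_mul mV mW) x y}.
Proof.
move=> bU bV bW x y.
have bUV := bilinear_tens_mul bU bV; have bVW := bilinear_tens_mul bV bW.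
have bm := bilinear_tens_mul bUV bW; have bm' := bilinear_tens_mul bU bVW.
elim/tensor_ind: x => [|z w|x x' IHx IHx'].
- by rewrite (bil0l bm) tens_assoc0 (bil0l bm').
- elim/tensor_ind: z => [|u v|z z' IHz IHz'].
  + by rewrite (bil0l (bilinear_tens _ _)) tens_assoc0 (bil0l bm) (bil0l bm')
      tens_assoc0.
  + elim/tensor_ind: y => [|z' w'|y y' IHy IHy'].
    * by rewrite (bil0r bm) tens_assoc0 (bil0r bm').
    * elim/tensor_ind: z' => [|u' v'|z z' IHz IHz'].
      - by rewrite (bil0l (bilinear_tens _ _)) tens_assoc0 (bil0r bm)
          (bil0r bm') tens_assoc0.
      - by rewrite !(tens_mulE, tens_assocE).
      - by rewrite tensDl (bilDr bm) !tens_assocD IHz IHz' (bilDr bm').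
    * by rewrite (bilDr bm) !tens_assocD IHy IHy' (bilDr bm').
  + by rewrite tensDl (bilDl bm) !tens_assocD IHz IHz' (bilDl bm').
- by rewrite (bilDl bm) !tens_assocD (bilDl bm') IHx IHx'.
Qed.

Lemma bilinear_mul (A : algType K) : bilinear_map ( *%R : A -> A -> A).
Proof.
apply: bilinear_mapI => *; first exact: mulrDl; first exact: mulrDr.
  by rewrite scalerAl.
by rewrite scalerAr.
Qed.

Section Ring.
Variables A B : algType K.
Implicit Types x y z : tensor A B.
Local Notation mul := (@tens_mul A B *%R *%R).
Let bm := bilinear_tens_mul (@bilinear_mul A) (@bilinear_mul B).
Let mulE := tens_mulE (@bilinear_mul A) (@bilinear_mul B).

Fact tens_mulA : associative mul.
Proof.
move=> x y z; elim/tensor_ind: x => [|a b|x x' IHx IHx'].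
- by rewrite !(bil0l bm).
- elim/tensor_ind: y => [|a' b'|y y' IHy IHy'].
  + by rewrite !(bil0r bm, bil0l bm).
  + elim/tensor_ind: z => [|a'' b''|z z' IHz IHz'].
    * by rewrite !(bil0r bm).
    * by rewrite !mulE !mulrA.
    * by rewrite !(bilDr bm) IHz IHz'.
  + by rewrite (bilDl bm) !(bilDr bm) (bilDl bm) IHy IHy'.
- by rewrite !(bilDl bm) IHx IHx'.
Qed.
Fact tens_mul1 : left_id (tens 1 1) mul.
Proof.
elim/tensor_ind=> [|a b|x y IHx IHy].
- by rewrite (bil0r bm).
- by rewrite mulE !mul1r.
- by rewrite (bilDr bm) IHx IHy.
Qed.
Fact tens_mulr1 : right_id (tens 1 1) mul.
Proof.
elim/tensor_ind=> [|a b|x y IHx IHy].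
- by rewrite (bil0l bm).
- by rewrite mulE !mulr1.
- by rewrite (bilDl bm) IHx IHy.
Qed.
Fact tens_mulDl : left_distributive mul +%R.
Proof. by move=> x y z; rewrite (bilDl bm). Qed.
Fact tens_mulDr : right_distributive mul +%R.
Proof. by move=> x y z; rewrite (bilDr bm). Qed.

HB.instance Definition _ := GRing.Zmodule_isPzRing.Build (tensor A B)
  tens_mulA tens_mul1 tens_mulr1 tens_mulDl tens_mulDr.

Lemma tensM (a a' : A) (b b' : B) : tens a b * tens a' b' = tens (a * a') (b * b').
Proof. exact: mulE. Qed.
Lemma tens11 : tens 1 1 = 1 :> tensor A B. Proof. by []. Qed.
Lemma tensorMZl k x y : (k *: x) * y = k *: (x * y).
Proof. exact: bilZl bm k x y. Qed.
Lemma tensorMZr k x y : x * (k *: y) = k *: (x * y).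
Proof. exact: bilZr bm k x y. Qed.
Lemma tensX (a : A) (b : B) n : tens a b ^+ n = tens (a ^+ n) (b ^+ n).
Proof. by elim: n => // n IHn; rewrite !exprS IHn tensM. Qed.

End Ring.
End TensorMaps.

Section HopfClosure.
Variables (K : fieldType) (A : algType K).
Variables (D : {linear A -> tensor A A}) (e : {linear A -> K^o}).
Variable S : {linear A -> A}.
Hypotheses (DM : {morph D : a b / a * b}) (eM : {morph e : a b / a * b}).
Hypothesis SM : forall a b, S (a * b) = S b * S a.

Lemma coassocM a b :
    tens_assoc (tens_map D idfun (D a)) = tens_map idfun D (D a) ->
    tens_assoc (tens_map D idfun (D b)) = tens_map idfun D (D b) ->
  tens_assoc (tens_map D idfun (D (a * b))) = tens_map idfun D (D (a * b)).
Proof.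
have bA := @bilinear_mul K A; have bAA := bilinear_tens_mul bA bA.
move=> Ea Eb; rewrite DM.
have E1 := @tens_map_mul K A A _ A _ _ _ _ D idfun bA bA bAA bA DM
  (fun x y => erefl).
have E2 := @tens_map_mul K A A A _ _ _ _ _ idfun D bA bA bA bAA
  (fun x y => erefl) DM.
by rewrite [tens_map D _ _]E1 (tens_assoc_mul bA bA bA) Ea Eb [RHS]E2.
Qed.

Lemma bilinear_counitl : bilinear_map (fun x y : A => e x *: y).
Proof.
apply: bilinear_mapI => [x x' y|x y y'|k x y|k x y].
- by rewrite linearD scalerDl.
- by rewrite scalerDr.
- by rewrite [e _]linearZ scalerA.
- by rewrite !scalerA mulrC.
Qed.
Lemma bilinear_counitr : bilinear_map (fun x y : A => e y *: x).
Proof.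
apply: bilinear_mapI => [x x' y|x y y'|k x y|k x y].
- by rewrite scalerDr.
- by rewrite linearD scalerDl.
- by rewrite !scalerA mulrC.
- by rewrite [e _]linearZ scalerA.
Qed.
Lemma bilinear_antipodel : bilinear_map (fun x y => S x * y).
Proof.
apply: bilinear_mapI => [x x' y|x y y'|k x y|k x y].
- by rewrite ?[S (_ + _)]linearD mulrDl.
- by rewrite ?[S (_ + _)]linearD mulrDr.
- by rewrite ?[S (k *: _)]linearZ -scalerAl.
- by rewrite ?[S (k *: _)]linearZ -scalerAr.
Qed.
Lemma bilinear_antipoder : bilinear_map (fun x y => x * S y).
Proof.
apply: bilinear_mapI => [x x' y|x y y'|k x y|k x y].
- by rewrite ?[S (_ + _)]linearD mulrDl.
- by rewrite ?[S (_ + _)]linearD mulrDr.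
- by rewrite ?[S (k *: _)]linearZ -scalerAl.
- by rewrite ?[S (k *: _)]linearZ -scalerAr.
Qed.

Lemma tens_lift_mul (f : A -> A -> A) : bilinear_map f ->
    (forall x y x' y', f (x * x') (y * y') = f x y * f x' y') ->
  {morph tens_lift f : s t / s * t}.
Proof.
move=> bf fM s t; elim/tensor_ind: s => [|x y|s s' IHs IHs'].
- by rewrite mul0r tens_lift0 // mul0r.
- elim/tensor_ind: t => [|x' y'|t t' IHt IHt'].
  + by rewrite mulr0 tens_lift0 // mulr0.
  + by rewrite tensM !tens_lift_tens.
  + by rewrite mulrDr !tens_liftD // IHt IHt' mulrDr.
- by rewrite mulrDl !tens_liftD // IHs IHs' mulrDl.
Qed.

Lemma counitlM : {morph (fun a => tens_lift (fun x y : A => e x *: y) (D a)) :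
  a b / a * b}.
Proof.
move=> a b; rewrite DM; apply: tens_lift_mul; first exact: bilinear_counitl.
by move=> x y x' y'; rewrite eM -scalerAl -scalerAr scalerA.
Qed.
Lemma counitrM : {morph (fun a => tens_lift (fun x y : A => e y *: x) (D a)) :
  a b / a * b}.
Proof.
move=> a b; rewrite DM; apply: tens_lift_mul; first exact: bilinear_counitr.
by move=> x y x' y'; rewrite eM -scalerAl -scalerAr scalerA.
Qed.

Lemma antipodelM a b :
    tens_lift (fun x y => S x * y) (D a) = e a *: 1 ->
    tens_lift (fun x y => S x * y) (D b) = e b *: 1 ->
  tens_lift (fun x y => S x * y) (D (a * b)) = e (a * b) *: 1.
Proof.
have bf := bilinear_antipodel; move=> Ea Eb.
suff E (s t : tensor A A) k : tens_lift (fun x y => S x * y) s = k *: 1 ->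
    tens_lift (fun x y => S x * y) (s * t) =
    k *: tens_lift (fun x y => S x * y) t.
  by rewrite DM (E _ _ _ Ea) Eb eM scalerA.
move=> Es; elim/tensor_ind: t => [|x' y'|t t' IHt IHt'].
- by rewrite mulr0 tens_lift0 // scaler0.
- rewrite tens_lift_tens //.
  have -> : tens_lift (fun x y => S x * y) (s * tens x' y') =
      S x' * tens_lift (fun x y => S x * y) s * y'.
    elim/tensor_ind: {Es} s => [|x y|s s' IHs IHs'].
    + by rewrite mul0r tens_lift0 // mulr0 mul0r.
    + by rewrite tensM !tens_lift_tens // SM !mulrA.
    + by rewrite mulrDl !tens_liftD // IHs IHs' mulrDr mulrDl.
  by rewrite Es -scalerAr mulr1 -scalerAl.
- by rewrite mulrDr !tens_liftD // IHt IHt' scalerDr.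
Qed.

Lemma antipoderM a b :
    tens_lift (fun x y => x * S y) (D a) = e a *: 1 ->
    tens_lift (fun x y => x * S y) (D b) = e b *: 1 ->
  tens_lift (fun x y => x * S y) (D (a * b)) = e (a * b) *: 1.
Proof.
have bf := bilinear_antipoder; move=> Ea Eb.
suff E (s t : tensor A A) k : tens_lift (fun x y => x * S y) t = k *: 1 ->
    tens_lift (fun x y => x * S y) (s * t) =
    k *: tens_lift (fun x y => x * S y) s.
  by rewrite DM (E _ _ _ Eb) Ea eM scalerA mulrC.
move=> Et; elim/tensor_ind: s => [|x y|s s' IHs IHs'].
- by rewrite mul0r tens_lift0 // scaler0.
- rewrite tens_lift_tens //.
  have -> : tens_lift (fun x y => x * S y) (tens x y * t) =
      x * tens_lift (fun x y => x * S y) t * S y.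
    elim/tensor_ind: {Et} t => [|x' y'|t t' IHt IHt'].
    + by rewrite mulr0 tens_lift0 // mulr0 mul0r.
    + by rewrite tensM !tens_lift_tens // SM !mulrA.
    + by rewrite mulrDr !tens_liftD // IHt IHt' mulrDr mulrDl.
  by rewrite Et -scalerAr mulr1 -scalerAl.
- by rewrite mulrDl !tens_liftD // IHs IHs' scalerDr.
Qed.

End HopfClosure.

Record hopfAlg (K : fieldType) := HopfAlg {
  hopf_alg :> algType K;
  comul : {linear hopf_alg -> tensor hopf_alg hopf_alg};
  counit : {linear hopf_alg -> K^o};
  antipode : {linear hopf_alg -> hopf_alg};
  comulA : forall a,
    tens_assoc (tens_map comul idfun (comul a)) = tens_map idfun comul (comul a);
  counitl : forall a, tens_lift (fun x y => counit x *: y) (comul a) = a;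
  counitr : forall a, tens_lift (fun x y => counit y *: x) (comul a) = a;
  comul1 : comul 1 = 1;
  comulM : {morph comul : x y / x * y};
  counit1 : counit 1 = 1;
  counitM : {morph counit : x y / x * y};
  antipodel : forall a,
    tens_lift (fun x y => antipode x * y) (comul a) = counit a *: 1;
  antipoder : forall a,
    tens_lift (fun x y => x * antipode y) (comul a) = counit a *: 1
}.

Section Presented.
Variables (K : fieldType) (X : Type).

Inductive pterm :=
| PVar of X
| PCst of K
| PAdd of pterm & pterm
| PMul of pterm & pterm.

Definition pexp (t : pterm) n := iter n (PMul t) (PCst 1).

HB.instance Definition _ := gen_eqMixin pterm.
HB.instance Definition _ := gen_choiceMixin pterm.

Variable R : pterm -> pterm -> Prop.

(* The congruence generated by the axioms of associative unital K-algebras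
   and by R; the quotient is the algebra with generators X and relations R. *)
Inductive pres_eqv : pterm -> pterm -> Prop :=
| pres_refl s : pres_eqv s s
| pres_sym s t : pres_eqv s t -> pres_eqv t s
| pres_trans s t u : pres_eqv s t -> pres_eqv t u -> pres_eqv s u
| pres_congD s s' t t' :
    pres_eqv s s' -> pres_eqv t t' -> pres_eqv (PAdd s t) (PAdd s' t')
| pres_congM s s' t t' :
    pres_eqv s s' -> pres_eqv t t' -> pres_eqv (PMul s t) (PMul s' t')
| pres_addA s t u : pres_eqv (PAdd s (PAdd t u)) (PAdd (PAdd s t) u)
| pres_addC s t : pres_eqv (PAdd s t) (PAdd t s)
| pres_add0 t : pres_eqv (PAdd (PCst 0) t) t
| pres_addN t : pres_eqv (PAdd (PMul (PCst (-1)) t) t) (PCst 0)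
| pres_mulA s t u : pres_eqv (PMul s (PMul t u)) (PMul (PMul s t) u)
| pres_mul1 t : pres_eqv (PMul (PCst 1) t) t
| pres_mulDl s t u :
    pres_eqv (PMul (PAdd s t) u) (PAdd (PMul s u) (PMul t u))
| pres_mulDr s t u :
    pres_eqv (PMul s (PAdd t u)) (PAdd (PMul s t) (PMul s u))
| pres_cstD a b : pres_eqv (PCst (a + b)) (PAdd (PCst a) (PCst b))
| pres_cstM a b : pres_eqv (PCst (a * b)) (PMul (PCst a) (PCst b))
| pres_cstC a t : pres_eqv (PMul (PCst a) t) (PMul t (PCst a))
| pres_rel s t : R s t -> pres_eqv s t.

Definition pres_eqb : rel pterm := fun s t => `[< pres_eqv s t >].

Fact pres_eqb_refl : reflexive pres_eqb.
Proof. by move=> s; apply/asboolP/pres_refl. Qed.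
Fact pres_eqb_sym : symmetric pres_eqb.
Proof. by move=> s t; apply/asboolP/asboolP; apply: pres_sym. Qed.
Fact pres_eqb_trans : transitive pres_eqb.
Proof.
by move=> t s u /asboolP st /asboolP tu; apply/asboolP/(pres_trans st tu).
Qed.

Canonical pres_equiv := EquivRel pres_eqb pres_eqb_refl pres_eqb_sym
  pres_eqb_trans.

Definition presented := {eq_quot pres_equiv}.
HB.instance Definition _ := Choice.on presented.
HB.instance Definition _ := EqQuotient.on presented.

Definition pclass (t : pterm) : presented := \pi_presented t.

Lemma pclassP s t : pclass s = pclass t <-> pres_eqv s t.
Proof.
rewrite /pclass; split=> [/eqP|st]; first by rewrite piE => /asboolP.
by apply/eqP; rewrite piE; apply/asboolP.
Qed.

Lemma pclassW (P : presented -> Prop) : (forall t, P (pclass t)) -> forall x, P x.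
Proof. by move=> Pt; elim/quotW. Qed.

Lemma pclass_repr x : pclass (repr x) = x.
Proof. exact: reprK. Qed.

Lemma pres_reprP t : pres_eqv (repr (pclass t)) t.
Proof. by apply/pclassP; rewrite pclass_repr. Qed.

Definition pres_add (x y : presented) := pclass (PAdd (repr x) (repr y)).
Definition pres_mul (x y : presented) := pclass (PMul (repr x) (repr y)).
Definition pres_opp (x : presented) := pclass (PMul (PCst (-1)) (repr x)).
Definition pres_scale (a : K) (x : presented) := pclass (PMul (PCst a) (repr x)).

Lemma pres_addE s t : pres_add (pclass s) (pclass t) = pclass (PAdd s t).
Proof. by apply/pclassP/pres_congD; apply: pres_reprP. Qed.
Lemma pres_mulE s t : pres_mul (pclass s) (pclass t) = pclass (PMul s t).
Proof. by apply/pclassP/pres_congM; apply: pres_reprP. Qed.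
Lemma pres_oppE t : pres_opp (pclass t) = pclass (PMul (PCst (-1)) t).
Proof.
by apply/pclassP/pres_congM; [apply: pres_refl|apply: pres_reprP].
Qed.
Lemma pres_scaleE a t : pres_scale a (pclass t) = pclass (PMul (PCst a) t).
Proof.
by apply/pclassP/pres_congM; [apply: pres_refl|apply: pres_reprP].
Qed.

Fact pres_ring_addA : associative pres_add.
Proof.
elim/pclassW=> s; elim/pclassW=> t; elim/pclassW=> u.
rewrite (pres_addE t) (pres_addE s t) !pres_addE.
exact/pclassP/pres_addA.
Qed.
Fact pres_ring_addC : commutative pres_add.
Proof.
elim/pclassW=> s; elim/pclassW=> t; rewrite !pres_addE.
exact/pclassP/pres_addC.
Qed.
Fact pres_ring_add0 : left_id (pclass (PCst 0)) pres_add.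
Proof. by elim/pclassW=> t; rewrite pres_addE; apply/pclassP/pres_add0. Qed.
Fact pres_ring_addN : left_inverse (pclass (PCst 0)) pres_opp pres_add.
Proof.
elim/pclassW=> t; rewrite pres_oppE pres_addE.
exact/pclassP/pres_addN.
Qed.

HB.instance Definition _ := GRing.isZmodule.Build presented
  pres_ring_addA pres_ring_addC pres_ring_add0 pres_ring_addN.

Lemma pclassD s t : pclass (PAdd s t) = pclass s + pclass t.
Proof. by symmetry; apply: pres_addE. Qed.

Fact pres_ring_mulA : associative pres_mul.
Proof.
elim/pclassW=> s; elim/pclassW=> t; elim/pclassW=> u.
rewrite (pres_mulE t) (pres_mulE s t) !pres_mulE.
exact/pclassP/pres_mulA.
Qed.
Fact pres_ring_mul1 : left_id (pclass (PCst 1)) pres_mul.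
Proof. by elim/pclassW=> t; rewrite pres_mulE; apply/pclassP/pres_mul1. Qed.
Fact pres_ring_mulr1 : right_id (pclass (PCst 1)) pres_mul.
Proof.
elim/pclassW=> t; rewrite pres_mulE; apply/pclassP.
exact: pres_trans (pres_sym (pres_cstC _ _)) (pres_mul1 _).
Qed.
Fact pres_ring_mulDl : left_distributive pres_mul +%R.
Proof.
elim/pclassW=> s; elim/pclassW=> t; elim/pclassW=> u.
rewrite -pclassD (pres_mulE s) (pres_mulE t) pres_mulE -pclassD.
exact/pclassP/pres_mulDl.
Qed.
Fact pres_ring_mulDr : right_distributive pres_mul +%R.
Proof.
elim/pclassW=> s; elim/pclassW=> t; elim/pclassW=> u.
rewrite -pclassD (pres_mulE s t) (pres_mulE s u) pres_mulE -pclassD.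
exact/pclassP/pres_mulDr.
Qed.

HB.instance Definition _ := GRing.Zmodule_isPzRing.Build presented
  pres_ring_mulA pres_ring_mul1 pres_ring_mulr1 pres_ring_mulDl pres_ring_mulDr.

Lemma pclassM s t : pclass (PMul s t) = pclass s * pclass t.
Proof. by symmetry; apply: pres_mulE. Qed.
Lemma pclass1 : pclass (PCst 1) = 1. Proof. by []. Qed.
Lemma pclass0 : pclass (PCst 0) = 0. Proof. by []. Qed.
Lemma pclass_cstD a b : pclass (PCst (a + b)) = pclass (PCst a) + pclass (PCst b).
Proof. by rewrite -pclassD; apply/pclassP/pres_cstD. Qed.
Lemma pclass_cstM a b : pclass (PCst (a * b)) = pclass (PCst a) * pclass (PCst b).
Proof. by rewrite -pclassM; apply/pclassP/pres_cstM. Qed.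
Lemma pclass_cstC a x : pclass (PCst a) * x = x * pclass (PCst a).
Proof.
by elim/pclassW: x => t; rewrite -!pclassM; apply/pclassP/pres_cstC.
Qed.
Lemma pclassX t n : pclass (pexp t n) = pclass t ^+ n.
Proof. by elim: n => // n IHn; rewrite exprS -IHn -pclassM. Qed.

Lemma pres_scale_mul a x : pres_scale a x = pclass (PCst a) * x.
Proof. by elim/pclassW: x => t; rewrite pres_scaleE pclassM. Qed.

Fact pres_scaleA a b x : pres_scale a (pres_scale b x) = pres_scale (a * b) x.
Proof. by rewrite !pres_scale_mul pclass_cstM mulrA. Qed.
Fact pres_scale1 : left_id 1 pres_scale.
Proof. by move=> x; rewrite pres_scale_mul mul1r. Qed.
Fact pres_scaleDr : right_distributive pres_scale +%R.
Proof. by move=> a x y; rewrite !pres_scale_mul mulrDr. Qed.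
Fact pres_scaleDl x : {morph pres_scale^~ x : a b / a + b}.
Proof. by move=> a b; rewrite !pres_scale_mul pclass_cstD mulrDl. Qed.

HB.instance Definition _ := GRing.Zmodule_isLmodule.Build K presented
  pres_scaleA pres_scale1 pres_scaleDr pres_scaleDl.

Lemma presZ a (x : presented) : a *: x = pclass (PCst a) * x.
Proof. exact: pres_scale_mul. Qed.

Definition pgen i : presented := pclass (PVar i).

Lemma presented_ind (P : presented -> Prop) :
    (forall i, P (pgen i)) -> (forall a : K, P (a *: (1 : presented))) ->
    (forall x y, P x -> P y -> P (x + y)) ->
    (forall x y, P x -> P y -> P (x * y)) ->
  forall x, P x.
Proof.
move=> Pg Pc PD PM; elim/pclassW; elim=> [i|a|s Ps t Pt|s Ps t Pt].
- exact: Pg.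
- by have := Pc a; rewrite presZ mulr1.
- by rewrite pclassD; apply: PD.
- by rewrite pclassM; apply: PM.
Qed.

Section Eval.
Variables (B : pzRingType) (c : K -> B) (g : X -> B).

Fixpoint peval (t : pterm) : B :=
  match t with
  | PVar i => g i
  | PCst a => c a
  | PAdd s t => peval s + peval t
  | PMul s t => peval s * peval t
  end.

Definition plift (x : presented) : B := peval (repr x).

Hypotheses (cD : {morph c : a b / a + b}) (cM : {morph c : a b / a * b}).
Hypotheses (c1 : c 1 = 1) (cC : forall a b, c a * b = b * c a).
Hypothesis gR : forall s t, R s t -> peval s = peval t.

Lemma peval_eqv s t : pres_eqv s t -> peval s = peval t.
Proof.
have c0 : c 0 = 0 by apply: (@addrI _ (c 0)); rewrite -cD !addr0.
elim=> //= {s t}.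
- by move=> s t u _ -> _ ->.
- by move=> s s' t t' _ -> _ ->.
- by move=> s s' t t' _ -> _ ->.
- by move=> *; rewrite addrA.
- by move=> *; rewrite addrC.
- by move=> *; rewrite c0 add0r.
- by move=> t; rewrite -[X in _ + X]mul1r -c1 -mulrDl -cD addNr c0 mul0r.
- by move=> *; rewrite mulrA.
- by move=> *; rewrite c1 mul1r.
- by move=> *; rewrite mulrDl.
- by move=> *; rewrite mulrDr.
Qed.

Lemma plift_class t : plift (pclass t) = peval t.
Proof. exact/peval_eqv/pres_reprP. Qed.
Lemma plift_gen i : plift (pgen i) = g i.
Proof. exact: plift_class. Qed.
Lemma pliftD : {morph plift : x y / x + y}.
Proof.
by elim/pclassW=> s; elim/pclassW=> t; rewrite -pclassD !plift_class.
Qed.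
Lemma pliftM : {morph plift : x y / x * y}.
Proof.
by elim/pclassW=> s; elim/pclassW=> t; rewrite -pclassM !plift_class.
Qed.
Lemma plift1 : plift 1 = 1.
Proof. by rewrite -pclass1 plift_class. Qed.
Lemma pliftZ a x : plift (a *: x) = c a * plift x.
Proof. by rewrite presZ pliftM plift_class. Qed.

End Eval.
End Presented.

Section QBinomial.
Variables (K : fieldType) (q : K).

Fixpoint qbin (n k : nat) : K :=
  match n, k with
  | _, 0 => 1
  | 0, _.+1 => 0
  | n.+1, k'.+1 => qbin n k' + q ^+ k'.+1 * qbin n k'.+1
  end.

Lemma qbin0 n : qbin n 0 = 1. Proof. by case: n. Qed.

Lemma qbin_gt n k : (n < k)%N -> qbin n k = 0.
Proof.
elim: n k => [|n IHn] [|k] //=; rewrite ltnS => lt_nk.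
by rewrite !IHn ?mulr0 ?addr0 // ltnW.
Qed.

Lemma qbin_absorb n k : (k <= n)%N ->
  (1 - q ^+ k.+1) * qbin n k.+1 = (1 - q ^+ (n - k)) * qbin n k.
Proof.
elim: n k => [|n IHn] k le_kn.
  by case: k le_kn => //= _; rewrite expr0 subrr mulr0 mul0r.
have step j : (j <= n)%N ->
    (1 - q ^+ j.+1) * qbin n.+1 j.+1 = (1 - q ^+ n.+1) * qbin n j.
  move=> le_jn; rewrite /= mulrDr mulrCA IHn // mulrA -mulrDl; congr (_ * _).
  rewrite mulrBr mulr1 -exprD addSn subnKC // addrA subrK //.
case: k le_kn => [|k] le_kn; first by rewrite step // subn0 !qbin0.
have [le_kn'|lt_nk] := leqP k.+1 n; last first.
  have -> : k.+1 = n.+1 by apply/eqP; rewrite eqn_leq le_kn lt_nk.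
  by rewrite subnn expr0 subrr mul0r qbin_gt ?mulr0.
rewrite step // subSS [qbin n.+1 _]/= mulrDr -IHn //.
rewrite mulrA -mulrDl; congr (_ * _).
by rewrite mulrBl mul1r -exprD addnS subnK ?(ltnW le_kn') // addrA subrK.
Qed.

Lemma qbin_prim m k : m.-primitive_root q -> (0 < k < m)%N -> qbin m k = 0.
Proof.
case: k => // k hq /andP[_ lt_km]; case: m hq lt_km => // m hq lt_km.
have le_km : (k <= m)%N by rewrite ltnW // -ltnS.
have E := qbin_absorb le_km.
have q1 : 1 - q ^+ k.+1 != 0.
  rewrite subr_eq0 eq_sym -(prim_order_dvd hq); apply/negP => /dvdn_leq.
  by move/(_ isT); rewrite leqNgt lt_km.
apply: (mulfI q1); rewrite mulr0 /= mulrDr mulrCA E.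
rewrite mulrA -mulrDl mulrBr mulr1 -exprD addSn subnKC // addrA subrK.
by rewrite (prim_expr_order hq) subrr mul0r.
Qed.

Variables (R : pzRingType) (c : K -> R).
Hypotheses (cD : {morph c : a b / a + b}) (cM : {morph c : a b / a * b}).
Hypotheses (c1 : c 1 = 1) (cC : forall a b, c a * b = b * c a).
Variables a b : R.
Hypothesis ba : b * a = c q * (a * b).

Lemma qcomm_exp k : b * a ^+ k = c (q ^+ k) * (a ^+ k * b).
Proof.
elim: k => [|k IHk]; first by rewrite !expr0 mulr1 c1 !mul1r.
rewrite [a ^+ k.+1]exprS mulrA ba -!mulrA IHk (mulrA a) -cC -(mulrA (c _)).
by rewrite mulrA -cM -exprS.
Qed.

Lemma qbinomial n :
  (a + b) ^+ n = \sum_(k < n.+1) c (qbin n k) * (a ^+ k * b ^+ (n - k)).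
Proof.
have c0 : c 0 = 0 by apply: (@addrI _ (c 0)); rewrite -cD !addr0.
elim: n => [|n IHn].
  by rewrite big_ord_recl big_ord0 addr0 /= c1 !mulr1.
rewrite exprS IHn mulrDl !mulr_sumr [RHS]big_ord_recl /= c1.
under eq_bigr => k _.
  rewrite mulrA -(cC _ a) -!mulrA [a * (_ * _)]mulrA -exprS.
  over.
under [X in _ + X]eq_bigr => k _.
  rewrite mulrA -(cC _ b) -mulrA [b * _]mulrA qcomm_exp -!mulrA -exprS -subSn
    ?[(_ <= _)%N]leq_ord //.
  rewrite mulrA -cM mulrC.
  over.
rewrite [X in _ + X]big_ord_recl /= qbin0 !mulr1 c1 addrCA; congr (_ + _).
rewrite [X in _ + X](_ : _ = \sum_(i < n.+1) c (q ^+ i.+1 * qbin n i.+1) *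
    (a ^+ i.+1 * b ^+ (n - i))); last first.
  rewrite [RHS]big_ord_recr /= [in X in _ = _ + X]qbin_gt // mulr0 c0 mul0r addr0.
  by apply: eq_bigr => i _; rewrite /bump /= add1n subSS.
rewrite -big_split; apply: eq_bigr => i _ /=.
by rewrite /bump /= add1n subSS cD mulrDl.
Qed.

Lemma qbinomial_prim m : m.-primitive_root q ->
  (a + b) ^+ m = a ^+ m + b ^+ m.
Proof.
have c0 : c 0 = 0 by apply: (@addrI _ (c 0)); rewrite -cD !addr0.
move=> hq; rewrite qbinomial; have m_gt0 := prim_order_gt0 hq.
case: m m_gt0 hq => // m _ hq; rewrite big_ord_recl big_ord_recr /=.
rewrite big1 => [|i _]; last first.
  rewrite [c _](_ : _ = 0) ?mul0r // -[RHS]c0; congr c.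
  by apply: (@qbin_prim m.+1 (bump 0 i) hq); rewrite /bump /= add1n ltnS ltn_ord.
have qnn n : qbin n n = 1.
  elim: n => //= n IHn; rewrite IHn qbin_gt // mulr0.
  by rewrite addr0.
rewrite !add0n qnn qbin_gt // mulr0 addr0 add0r /bump /= add1n subnn c1.
by rewrite !mul1r mulr1 addrC.
Qed.
End QBinomial.

Inductive taft_gen := Taft_h | Taft_x.

Inductive taft_rel (K : fieldType) (m : nat) (q : K) :
    pterm K taft_gen -> pterm K taft_gen -> Prop :=
| Taft_hm : taft_rel m q (pexp (PVar K Taft_h) m) (PCst taft_gen 1)
| Taft_xm : taft_rel m q (pexp (PVar K Taft_x) m) (PCst taft_gen 0)
| Taft_xh : taft_rel m q (PMul (PVar K Taft_x) (PVar K Taft_h))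
    (PMul (PCst taft_gen q) (PMul (PVar K Taft_h) (PVar K Taft_x))).

(* The primitivity of q enters the type because the algebra structure
   requires 0 < m for 1 to be nonzero. *)
Definition taft_alg (K : fieldType) (m : nat) (q : K)
  of m.-primitive_root q : Type := presented (taft_rel m q).

Section Taft.
Variables (K : fieldType) (m : nat) (q : K) (hq : m.-primitive_root q).
Local Notation T := (taft_alg hq).

HB.instance Definition _ := GRing.PzRing.on T.
HB.instance Definition _ := GRing.Lmodule.on T.

Let m_gt0 : (0 < m)%N := prim_order_gt0 hq.

Lemma taft_eval (B : pzRingType) (c : K -> B) (g : taft_gen -> B) :
    {morph c : a b / a + b} -> c 1 = 1 ->
    g Taft_h ^+ m = 1 -> g Taft_x ^+ m = 0 ->
    g Taft_x * g Taft_h = c q * (g Taft_h * g Taft_x) ->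
  forall s t, taft_rel m q s t -> peval c g s = peval c g t.
Proof.
move=> cD c1 gh gx gxh s t.
have pevalX u n : peval c g (pexp u n) = peval c g u ^+ n.
  by elim: n => [|n IHn] //=; rewrite IHn exprS.
have c0 : c 0 = 0 by apply: (@addrI _ (c 0)); rewrite -cD !addr0.
by case=> //=; rewrite pevalX /= ?gh ?gx ?c1 ?c0.
Qed.

Definition taft_eps : T -> K :=
  @plift K _ _ K id (fun i => if i is Taft_h then 1 else 0).

Fact taft_eps_rel s t : taft_rel m q s t ->
  peval (id : K -> K) (fun i => if i is Taft_h then 1 else 0) s =
  peval (id : K -> K) (fun i => if i is Taft_h then 1 else 0) t.
Proof.
apply: taft_eval => //=; rewrite ?expr1n ?expr0n //.
  by case: m m_gt0.
by rewrite mul0r mul1r mulr0.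
Qed.

Lemma taft_eps1 : taft_eps 1 = 1.
Proof. exact: (plift1 _ _ _ (@mulrC K) taft_eps_rel). Qed.
Lemma taft_epsD : {morph taft_eps : x y / x + y}.
Proof. exact: (pliftD _ _ _ (@mulrC K) taft_eps_rel). Qed.
Lemma taft_epsM : {morph taft_eps : x y / x * y}.
Proof. exact: (pliftM _ _ _ (@mulrC K) taft_eps_rel). Qed.
Lemma taft_epsZ a x : taft_eps (a *: x) = a * taft_eps x.
Proof. exact: (pliftZ _ _ _ (@mulrC K) taft_eps_rel). Qed.

Fact taft_nonzero : 1 != 0 :> T.
Proof.
apply/eqP => /(congr1 taft_eps).
have -> : taft_eps 0 = 0 by rewrite -[0 in LHS](scale0r 0) taft_epsZ mul0r.
by rewrite taft_eps1; apply/eqP; apply: oner_neq0.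
Qed.

HB.instance Definition _ := GRing.PzSemiRing_isNonZero.Build T taft_nonzero.

Fact taft_scaleAl (a : K) (x y : T) : a *: (x * y) = (a *: x) * y.
Proof.
by rewrite [LHS]presZ mulrA; congr (_ * y); symmetry; apply: presZ.
Qed.

HB.instance Definition _ := GRing.Lmodule_isLalgebra.Build K T taft_scaleAl.

Fact taft_scaleAr (a : K) (x y : T) : a *: (x * y) = x * (a *: y).
Proof.
rewrite [LHS]presZ mulrA pclass_cstC -mulrA; congr (x * _).
by symmetry; apply: presZ.
Qed.

HB.instance Definition _ := GRing.Lalgebra_isAlgebra.Build K T taft_scaleAr.

Definition taft_h : T := pgen (taft_rel m q) Taft_h.
Definition taft_x : T := pgen (taft_rel m q) Taft_x.
Local Notation h := taft_h.
Local Notation x := taft_x.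

Lemma taft_hmE : h ^+ m = 1.
Proof. by rewrite -[LHS]pclassX; apply/pclassP/pres_rel/Taft_hm. Qed.
Lemma taft_xmE : x ^+ m = 0.
Proof. by rewrite -[LHS]pclassX; apply/pclassP/pres_rel/Taft_xm. Qed.
Lemma taft_xhE : x * h = q *: (h * x).
Proof.
have/pclassP := pres_rel (Taft_xh m q); rewrite !pclassM => E.
by rewrite [RHS]presZ; apply: E.
Qed.

Lemma taft_ind (P : T -> Prop) :
    P h -> P x -> (forall a : K, P (a *: 1)) ->
    (forall y z, P y -> P z -> P (y + z)) ->
    (forall y z, P y -> P z -> P (y * z)) ->
  forall y, P y.
Proof. by move=> Ph Px P1 PD PM; apply: presented_ind => // -[]. Qed.

Local Notation TT := (tensor T T).

Definition taft_scal (B : lmodType K) (u : B) (a : K) : B := a *: u.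

Definition taft_comul_gen (i : taft_gen) : TT :=
  if i is Taft_h then tens h h else tens x h + tens 1 x.

Definition taft_comul : T -> TT :=
  plift (taft_scal (1 : TT)) taft_comul_gen.

Fact taft_TTD : {morph taft_scal (1 : TT) : a b / a + b}.
Proof. by move=> a b; rewrite /taft_scal scalerDl. Qed.
Fact taft_TTM : {morph taft_scal (1 : TT) : a b / a * b}.
Proof. by move=> a b; rewrite /taft_scal tensorMZl mul1r scalerA. Qed.
Fact taft_TT1 : taft_scal (1 : TT) 1 = 1.
Proof. exact: scale1r. Qed.
Fact taft_TTC a (y : TT) : taft_scal (1 : TT) a * y = y * taft_scal (1 : TT) a.
Proof. by rewrite /taft_scal tensorMZl tensorMZr mulr1 mul1r. Qed.

Fact taft_comul_rel s t : taft_rel m q s t ->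
  peval (taft_scal (1 : TT)) taft_comul_gen s =
  peval (taft_scal (1 : TT)) taft_comul_gen t.
Proof.
apply: taft_eval; [exact: taft_TTD|exact: taft_TT1| | |] => /=.
- by rewrite tensX taft_hmE.
- have ba : tens 1 x * tens x h = taft_scal (1 : TT) q * (tens x h * tens 1 x).
    rewrite /taft_scal tensorMZl mul1r !tensM mul1r mulr1 taft_xhE.
    exact: tensZr.
  rewrite (qbinomial_prim taft_TTD taft_TTM taft_TT1 taft_TTC ba hq).
  rewrite !tensX taft_xmE (bil0l (bilinear_tens _ _)).
  by rewrite (bil0r (bilinear_tens _ _)) addr0.
- rewrite /taft_scal tensorMZl mul1r mulrDl mulrDr !tensM mul1r mulr1.
  by rewrite taft_xhE tensZl tensZr scalerDr.
Qed.

Lemma taft_comulh : taft_comul h = tens h h.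
Proof.
exact: (plift_gen taft_TTD taft_TTM taft_TT1 taft_TTC taft_comul_rel Taft_h).
Qed.
Lemma taft_comulx : taft_comul x = tens x h + tens 1 x.
Proof.
exact: (plift_gen taft_TTD taft_TTM taft_TT1 taft_TTC taft_comul_rel Taft_x).
Qed.
Lemma taft_comul1 : taft_comul 1 = 1.
Proof. exact: (plift1 taft_TTD taft_TTM taft_TT1 taft_TTC taft_comul_rel). Qed.
Lemma taft_comulM : {morph taft_comul : y z / y * z}.
Proof. exact: (pliftM taft_TTD taft_TTM taft_TT1 taft_TTC taft_comul_rel). Qed.
Fact taft_comul_linear : linear taft_comul.
Proof.
move=> a y z.
rewrite /taft_comul (pliftD taft_TTD taft_TTM taft_TT1 taft_TTC taft_comul_rel).
congr (_ + _).
rewrite [LHS](pliftZ taft_TTD taft_TTM taft_TT1 taft_TTC taft_comul_rel).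
by rewrite /taft_scal tensorMZl mul1r.
Qed.

HB.instance Definition _ :=
  GRing.isLinear.Build K T TT *:%R taft_comul taft_comul_linear.

Definition taft_counit : T -> K^o := taft_eps.
Fact taft_counit_linear : linear taft_counit.
Proof. by move=> a y z; rewrite /taft_counit taft_epsD taft_epsZ. Qed.

HB.instance Definition _ :=
  GRing.isLinear.Build K T K^o *:%R taft_counit taft_counit_linear.

Lemma taft_counith : taft_counit h = 1.
Proof.
exact: (@plift_gen _ _ _ K id _ _ _ _ (@mulrC K) taft_eps_rel Taft_h).
Qed.
Lemma taft_counitx : taft_counit x = 0.
Proof.
exact: (@plift_gen _ _ _ K id _ _ _ _ (@mulrC K) taft_eps_rel Taft_x).
Qed.

Let h' : T := h ^+ m.-1.

Lemma taft_hh' : h * h' = 1.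
Proof. by rewrite -exprS prednK // taft_hmE. Qed.
Lemma taft_h'h : h' * h = 1.
Proof. by rewrite -exprSr prednK // taft_hmE. Qed.
Lemma taft_h'x : h' * x = q *: (x * h').
Proof.
have -> : h' * x = h' * (x * h) * h' by rewrite -!mulrA taft_hh' mulr1.
by rewrite taft_xhE -scalerAr -scalerAl mulrA taft_h'h mul1r.
Qed.

Definition taft_antipode_gen (i : taft_gen) : T^c :=
  if i is Taft_h then h' else - (x * h').

Definition taft_antipode : T -> T :=
  plift (taft_scal (1 : T) : K -> T^c) taft_antipode_gen.

Fact taft_TD : {morph (taft_scal (1 : T) : K -> T^c) : a b / a + b}.
Proof. by move=> a b; rewrite /taft_scal scalerDl. Qed.
Fact taft_TM : {morph (taft_scal (1 : T) : K -> T^c) : a b / a * b}.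
Proof.
move=> a b; rewrite /taft_scal /=.
by rewrite [RHS](_ : _ = (b *: 1 : T) * (a *: 1 : T)) // -scalerAl mul1r
  scalerA mulrC.
Qed.
Fact taft_T1 : (taft_scal (1 : T) : K -> T^c) 1 = 1.
Proof. exact: scale1r. Qed.
Fact taft_TC a (y : T^c) : (taft_scal (1 : T) a : T^c) * y = y * taft_scal (1 : T) a.
Proof.
rewrite /taft_scal.
rewrite [LHS](_ : _ = (y : T) * (a *: 1 : T)) //.
rewrite [RHS](_ : _ = (a *: 1 : T) * (y : T)) //.
by rewrite -scalerAl -scalerAr mul1r mulr1.
Qed.

Lemma taft_convX (y : T) n : (y : T^c) ^+ n = (y ^+ n : T).
Proof.
by elim: n => // n IHn; rewrite exprS IHn exprSr.
Qed.

Fact taft_antipode_rel s t : taft_rel m q s t ->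
  peval (taft_scal (1 : T) : K -> T^c) taft_antipode_gen s =
  peval (taft_scal (1 : T) : K -> T^c) taft_antipode_gen t.
Proof.
apply: taft_eval; [exact: taft_TD|exact: taft_T1| | |] => /=.
- by rewrite taft_convX /h' -exprM mulnC exprM taft_hmE expr1n.
- rewrite taft_convX exprNn.
  suff xh'X n : exists s, (x * h') ^+ n = s *: (x ^+ n * h' ^+ n).
    have [a ->] := xh'X m; rewrite taft_xmE mul0r scaler0 mulr0 //.
  elim: n => [|n [a IHn]]; first by exists 1; rewrite !expr0 mulr1 scale1r.
  suff h'xn : exists b, h' * x ^+ n = b *: (x ^+ n * h').
    have [b E] := h'xn; exists (a * b); rewrite exprS IHn -scalerAr.
    rewrite -mulrA [h' * _]mulrA E -!scalerAl -scalerAr scalerA !mulrA -exprS.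
    by rewrite -mulrA -exprS.
  elim: {IHn a} n => [|n [b IHn]].
    by exists 1; rewrite expr0 mulr1 mul1r scale1r.
  exists (q * b); rewrite exprS mulrA taft_h'x -scalerAl -!mulrA IHn.
  by rewrite -scalerAr scalerA.
- suff E : h' * - (x * h') = (- (x * h') * h') * (q *: 1) :> T by exact: E.
  rewrite -[RHS]scalerAr mulr1 mulrN mulNr scalerN; congr (- _).
  by rewrite mulrA taft_h'x -scalerAl.
Qed.

Lemma taft_antipodeh : taft_antipode h = h'.
Proof.
exact: (plift_gen taft_TD taft_TM taft_T1 taft_TC taft_antipode_rel Taft_h).
Qed.
Lemma taft_antipodex : taft_antipode x = - (x * h').
Proof.
exact: (plift_gen taft_TD taft_TM taft_T1 taft_TC taft_antipode_rel Taft_x).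
Qed.
Lemma taft_antipode1 : taft_antipode 1 = 1.
Proof. exact: (plift1 taft_TD taft_TM taft_T1 taft_TC taft_antipode_rel). Qed.
Lemma taft_antipodeM y z :
  taft_antipode (y * z) = taft_antipode z * taft_antipode y.
Proof. exact: (pliftM taft_TD taft_TM taft_T1 taft_TC taft_antipode_rel). Qed.
Fact taft_antipode_linear : linear taft_antipode.
Proof.
move=> a y z; rewrite /taft_antipode.
rewrite (pliftD taft_TD taft_TM taft_T1 taft_TC taft_antipode_rel).
congr (_ + _).
rewrite [LHS](pliftZ taft_TD taft_TM taft_T1 taft_TC taft_antipode_rel).
suff E : taft_antipode y * (a *: 1) = a *: taft_antipode y :> T by exact: E.
by rewrite -scalerAr mulr1.
Qed.

HB.instance Definition _ :=
  GRing.isLinear.Build K T T *:%R taft_antipode taft_antipode_linear.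

Local Notation D := taft_comul.
Local Notation e := taft_counit.
Local Notation S := taft_antipode.

Lemma taft_comul_scal a : D (a *: 1) = a *: tens 1 1.
Proof. by rewrite linearZ /= taft_comul1. Qed.

Fact taft_comulA y :
  tens_assoc (tens_map D idfun (D y)) = tens_map idfun D (D y).
Proof.
elim/taft_ind: y => [||a|y z IHy IHz|y z IHy IHz].
- by rewrite taft_comulh !tens_mapE /= taft_comulh tens_assocE.
- rewrite taft_comulx !tens_mapD !tens_mapE /= taft_comulx taft_comulh.
  by rewrite taft_comul1 tensDl tensDr !tens_assocD !tens_assocE addrA.
- rewrite taft_comul_scal !tens_mapZ !tens_mapE /= taft_comul1 tens_assocZ.
  by rewrite tens_assocE.
- by rewrite linearD !tens_mapD tens_assocD IHy IHz.
- exact: (coassocM taft_comulM IHy IHz).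
Qed.

Fact taft_counitM : {morph e : y z / y * z}.
Proof. exact: taft_epsM. Qed.

Fact taft_counitl y : tens_lift (fun u v => e u *: v) (D y) = y.
Proof.
have b := bilinear_counitl e.
elim/taft_ind: y => [||a|y z IHy IHz|y z IHy IHz].
- by rewrite taft_comulh tens_lift_tens // taft_counith scale1r.
- rewrite taft_comulx tens_liftD // !tens_lift_tens // taft_counitx.
  by rewrite /taft_counit taft_eps1 scale0r add0r scale1r.
- rewrite taft_comul_scal tens_liftZ // tens_lift_tens //.
  by rewrite /taft_counit taft_eps1 scale1r.
- by rewrite linearD tens_liftD // IHy IHz.
- by rewrite (counitlM taft_comulM taft_counitM) IHy IHz.
Qed.

Fact taft_counitr y : tens_lift (fun u v => e v *: u) (D y) = y.
Proof.
have b := bilinear_counitr e.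
elim/taft_ind: y => [||a|y z IHy IHz|y z IHy IHz].
- by rewrite taft_comulh tens_lift_tens // taft_counith scale1r.
- rewrite taft_comulx tens_liftD // !tens_lift_tens // taft_counitx.
  by rewrite taft_counith scale0r addr0 scale1r.
- rewrite taft_comul_scal tens_liftZ // tens_lift_tens //.
  by rewrite /taft_counit taft_eps1 scale1r.
- by rewrite linearD tens_liftD // IHy IHz.
- by rewrite (counitrM taft_comulM taft_counitM) IHy IHz.
Qed.

Fact taft_antipodel y : tens_lift (fun u v => S u * v) (D y) = e y *: 1.
Proof.
have b := bilinear_antipodel S.
elim/taft_ind: y => [||a|y z IHy IHz|y z IHy IHz].
- rewrite taft_comulh tens_lift_tens // taft_antipodeh taft_h'h taft_counith.
  by rewrite scale1r.
- rewrite taft_comulx tens_liftD // !tens_lift_tens // taft_counitx.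
  rewrite taft_antipodex taft_antipode1 mul1r mulNr -mulrA taft_h'h mulr1.
  by rewrite addNr scale0r.
- rewrite taft_comul_scal tens_liftZ // tens_lift_tens // taft_antipode1.
  by rewrite mulr1 [e _]linearZ /= /taft_counit taft_eps1 [a *: 1 in RHS]mulr1.
- by rewrite linearD tens_liftD // IHy IHz [e (_ + _)]linearD scalerDl.
- exact: (antipodelM taft_comulM taft_counitM taft_antipodeM IHy IHz).
Qed.

Fact taft_antipoder y : tens_lift (fun u v => u * S v) (D y) = e y *: 1.
Proof.
have b := bilinear_antipoder S.
elim/taft_ind: y => [||a|y z IHy IHz|y z IHy IHz].
- rewrite taft_comulh tens_lift_tens // taft_antipodeh taft_hh' taft_counith.
  by rewrite scale1r.
- rewrite taft_comulx tens_liftD // !tens_lift_tens // taft_counitx.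
  by rewrite taft_antipodex taft_antipodeh mul1r addrN scale0r.
- rewrite taft_comul_scal tens_liftZ // tens_lift_tens // taft_antipode1.
  by rewrite mulr1 [e _]linearZ /= /taft_counit taft_eps1 [a *: 1 in RHS]mulr1.
- by rewrite linearD tens_liftD // IHy IHz [e (_ + _)]linearD scalerDl.
- exact: (antipoderM taft_comulM taft_counitM taft_antipodeM IHy IHz).
Qed.

Definition taft : hopfAlg K :=
  @HopfAlg K T taft_comul taft_counit taft_antipode taft_comulA taft_counitl
    taft_counitr taft_comul1 taft_comulM taft_eps1 taft_counitM taft_antipodel
    taft_antipoder.

End Taft.

Definition group_alg (K : fieldType) (gT : finGroupType) : Type :=
  {ffun gT -> K^o}.

Section GroupAlgebra.
Variables (K : fieldType) (gT : finGroupType).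
Local Notation A := (group_alg K gT).

HB.instance Definition _ := GRing.Lmodule.on A.

Definition gelt (g : gT) : A := [ffun x => (x == g)%:R].

Lemma group_algE (f : A) : f = \sum_g f g *: gelt g.
Proof.
apply/ffunP => x; rewrite sum_ffunE (bigD1 x) //= !ffunE eqxx big1.
  by rewrite addr0 [RHS]mulr1.
by move=> g /negPf ng; rewrite !ffunE eq_sym ng [LHS]mulr0.
Qed.

Lemma group_alg_ind (P : A -> Prop) :
    P 0 -> (forall g, P (gelt g)) ->
    (forall x y, P x -> P y -> P (x + y)) ->
    (forall k x, P x -> P (k *: x)) ->
  forall x, P x.
Proof.
move=> P0 Pg PD PZ x; rewrite [x]group_algE.
by elim/big_ind: _ => // g _; apply: PZ.
Qed.

Definition group_alg_mul (f1 f2 : A) : A :=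
  [ffun x => \sum_g f1 g * f2 (g^-1 * x)%g].

Lemma bilinear_group_alg_mul : bilinear_map group_alg_mul.
Proof.
apply: bilinear_mapI => [x x' y|x y y'|k x y|k x y]; apply/ffunP => u;
  rewrite !ffunE.
- by rewrite -big_split; apply: eq_bigr => g _; rewrite !ffunE mulrDl.
- by rewrite -big_split; apply: eq_bigr => g _; rewrite !ffunE mulrDr.
- by rewrite scaler_sumr; apply: eq_bigr => g _; rewrite !ffunE [RHS]mulrA.
- by rewrite scaler_sumr; apply: eq_bigr => g _; rewrite !ffunE [RHS]mulrCA.
Qed.

Let bm := bilinear_group_alg_mul.

Lemma group_alg_mulE g1 g2 :
  group_alg_mul (gelt g1) (gelt g2) = gelt (g1 * g2).
Proof.
apply/ffunP => x; rewrite !ffunE (bigD1 g1) //= !ffunE eqxx mul1r.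
rewrite big1 => [|g /negPf ng]; last by rewrite ffunE ng mul0r.
by rewrite addr0 -(inj_eq (mulgI g1)) mulKVg.
Qed.

Fact group_alg_mulA : associative group_alg_mul.
Proof.
move=> x y z; elim/group_alg_ind: x => [|g|x x' IHx IHx'|k x IHx].
- by rewrite !(bil0l bm).
- elim/group_alg_ind: y => [|g'|y y' IHy IHy'|k y IHy].
  + by rewrite !(bil0l bm, bil0r bm).
  + elim/group_alg_ind: z => [|g''|z z' IHz IHz'|k z IHz].
    * by rewrite !(bil0l bm, bil0r bm).
    * by rewrite !group_alg_mulE mulgA.
    * by rewrite !(bilDr bm) IHz IHz'.
    * by rewrite !(bilZr bm) IHz.
  + by rewrite (bilDl bm) !(bilDr bm) (bilDl bm) IHy IHy'.
  + by rewrite (bilZl bm) !(bilZr bm) (bilZl bm) IHy.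
- by rewrite !(bilDl bm) IHx IHx'.
- by rewrite !(bilZl bm) IHx.
Qed.
Fact group_alg_mul1 : left_id (gelt 1) group_alg_mul.
Proof.
elim/group_alg_ind=> [|g|x y IHx IHy|k x IHx].
- by rewrite (bil0r bm).
- by rewrite group_alg_mulE mul1g.
- by rewrite (bilDr bm) IHx IHy.
- by rewrite (bilZr bm) IHx.
Qed.
Fact group_alg_mulr1 : right_id (gelt 1) group_alg_mul.
Proof.
elim/group_alg_ind=> [|g|x y IHx IHy|k x IHx].
- by rewrite (bil0l bm).
- by rewrite group_alg_mulE mulg1.
- by rewrite (bilDl bm) IHx IHy.
- by rewrite (bilZl bm) IHx.
Qed.
Fact group_alg_mulDl : left_distributive group_alg_mul +%R.
Proof. by move=> x y z; rewrite (bilDl bm). Qed.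
Fact group_alg_mulDr : right_distributive group_alg_mul +%R.
Proof. by move=> x y z; rewrite (bilDr bm). Qed.
Fact group_alg_nonzero : gelt 1 != 0.
Proof.
apply/eqP => /ffunP/(_ 1%g); rewrite !ffunE eqxx.
by apply/eqP; apply: oner_neq0.
Qed.

HB.instance Definition _ := GRing.Zmodule_isNzRing.Build A group_alg_mulA
  group_alg_mul1 group_alg_mulr1 group_alg_mulDl group_alg_mulDr
  group_alg_nonzero.

Fact group_alg_scaleAl (k : K) (x y : A) : k *: (x * y) = (k *: x) * y.
Proof. by symmetry; apply: bilZl bm k x y. Qed.
HB.instance Definition _ :=
  GRing.Lmodule_isLalgebra.Build K A group_alg_scaleAl.
Fact group_alg_scaleAr (k : K) (x y : A) : k *: (x * y) = x * (k *: y).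
Proof. by symmetry; apply: bilZr bm k x y. Qed.
HB.instance Definition _ :=
  GRing.Lalgebra_isAlgebra.Build K A group_alg_scaleAr.

Lemma geltM g1 g2 : gelt (g1 * g2) = gelt g1 * gelt g2.
Proof. by symmetry; apply: group_alg_mulE. Qed.
Lemma gelt1 : gelt 1 = 1. Proof. by []. Qed.

Section Extend.
Variables (U : lmodType K) (u : gT -> U).
Definition gext (f : A) : U := \sum_g f g *: u g.

Lemma gext_linear : linear gext.
Proof.
move=> k x y; rewrite scaler_sumr -big_split; apply: eq_bigr => g _ /=.
by rewrite !ffunE scalerDl scalerA.
Qed.
Lemma gextE g : gext (gelt g) = u g.
Proof.
rewrite /gext (bigD1 g) //= ffunE eqxx scale1r big1 ?addr0 // => g' /negPf ng.
by rewrite ffunE ng scale0r.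
Qed.
HB.instance Definition _ := GRing.isLinear.Build K A U *:%R gext gext_linear.
End Extend.

Definition group_comul : {linear A -> tensor A A} :=
  gext (fun g => tens (gelt g) (gelt g)).
Definition group_counit : {linear A -> K^o} := gext (fun _ => 1 : K^o).
Definition group_antipode : {linear A -> A} := gext (fun g => gelt g^-1).

Local Notation D := group_comul.
Local Notation e := group_counit.
Local Notation S := group_antipode.

Lemma group_comulE g : D (gelt g) = tens (gelt g) (gelt g).
Proof. exact: gextE. Qed.
Lemma group_counitE g : e (gelt g) = 1.
Proof. exact: gextE. Qed.
Lemma group_antipodeE g : S (gelt g) = gelt g^-1.
Proof. exact: gextE. Qed.

Fact group_comulA y :
  tens_assoc (tens_map D idfun (D y)) = tens_map idfun D (D y).
Proof.
elim/group_alg_ind: y => [|g|y z IHy IHz|k y IHy].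
- by rewrite linear0 !tens_map0 tens_assoc0.
- by rewrite !(group_comulE, tens_mapE, tens_assocE).
- by rewrite linearD !tens_mapD tens_assocD IHy IHz.
- by rewrite linearZ /= !tens_mapZ tens_assocZ IHy.
Qed.
Fact group_counitl y : tens_lift (fun u v => e u *: v) (D y) = y.
Proof.
have b := bilinear_counitl e.
elim/group_alg_ind: y => [|g|y z IHy IHz|k y IHy].
- by rewrite linear0 tens_lift0.
- by rewrite group_comulE tens_lift_tens // group_counitE scale1r.
- by rewrite linearD tens_liftD // IHy IHz.
- by rewrite linearZ /= tens_liftZ // IHy.
Qed.
Fact group_counitr y : tens_lift (fun u v => e v *: u) (D y) = y.
Proof.
have b := bilinear_counitr e.
elim/group_alg_ind: y => [|g|y z IHy IHz|k y IHy].
- by rewrite linear0 tens_lift0.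
- by rewrite group_comulE tens_lift_tens // group_counitE scale1r.
- by rewrite linearD tens_liftD // IHy IHz.
- by rewrite linearZ /= tens_liftZ // IHy.
Qed.
Fact group_comul1 : D 1 = 1.
Proof. by rewrite -gelt1 group_comulE. Qed.
Fact group_comulM : {morph D : x y / x * y}.
Proof.
move=> x y; elim/group_alg_ind: x => [|g|x x' IHx IHx'|k x IHx].
- by rewrite mul0r linear0 mul0r.
- elim/group_alg_ind: y => [|g'|y y' IHy IHy'|k y IHy].
  + by rewrite mulr0 linear0 mulr0.
  + by rewrite -geltM !group_comulE tensM geltM.
  + by rewrite mulrDr !linearD /= mulrDr IHy IHy'.
  + by rewrite -scalerAr !linearZ /= tensorMZr IHy.
- by rewrite mulrDl !linearD /= mulrDl IHx IHx'.
- by rewrite -scalerAl !linearZ /= tensorMZl IHx.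
Qed.
Fact group_counit1 : e 1 = 1.
Proof. by rewrite -gelt1 group_counitE. Qed.
Fact group_counitM : {morph e : x y / x * y}.
Proof.
move=> x y; elim/group_alg_ind: x => [|g|x x' IHx IHx'|k x IHx].
- by rewrite mul0r linear0 mul0r.
- elim/group_alg_ind: y => [|g'|y y' IHy IHy'|k y IHy].
  + by rewrite mulr0 linear0 mulr0.
  + by rewrite -geltM !group_counitE mulr1.
  + by rewrite mulrDr !linearD /= mulrDr IHy IHy'.
  + by rewrite -scalerAr !linearZ /= IHy scalerAr.
- by rewrite mulrDl !linearD /= mulrDl IHx IHx'.
- by rewrite -scalerAl !linearZ /= IHx scalerAl.
Qed.
Fact group_antipodel y : tens_lift (fun u v => S u * v) (D y) = e y *: 1.
Proof.
have b := bilinear_antipodel S.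
elim/group_alg_ind: y => [|g|y z IHy IHz|k y IHy].
- by rewrite !linear0 tens_lift0 // scale0r.
- rewrite group_comulE tens_lift_tens // group_antipodeE group_counitE.
  by rewrite scale1r -geltM mulVg.
- by rewrite !linearD tens_liftD // IHy IHz scalerDl.
- by rewrite !linearZ /= tens_liftZ // IHy scalerA.
Qed.
Fact group_antipoder y : tens_lift (fun u v => u * S v) (D y) = e y *: 1.
Proof.
have b := bilinear_antipoder S.
elim/group_alg_ind: y => [|g|y z IHy IHz|k y IHy].
- by rewrite !linear0 tens_lift0 // scale0r.
- rewrite group_comulE tens_lift_tens // group_antipodeE group_counitE.
  by rewrite scale1r -geltM mulgV.
- by rewrite !linearD tens_liftD // IHy IHz scalerDl.
- by rewrite !linearZ /= tens_liftZ // IHy scalerA.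
Qed.

Definition group_hopf : hopfAlg K :=
  @HopfAlg K A group_comul group_counit group_antipode group_comulA
    group_counitl group_counitr group_comul1 group_comulM group_counit1
    group_counitM group_antipodel group_antipoder.

End GroupAlgebra.

Section HopfMaps.
Variable K : fieldType.

(* A Hopf algebra map is an algebra map that is also a coalgebra map; it then
   commutes with the antipodes. *)
Definition coalg_map (A B : hopfAlg K) (f : A -> B) : Prop :=
  (forall a, comul B (f a) = tens_map f f (comul A a)) /\
  (forall a, counit B (f a) = counit A a).

Definition hopf_iso (A B : hopfAlg K) : Prop :=
  exists f : {lrmorphism A -> B}, coalg_map f /\ bijective f.

Definition factorizes (E A H : hopfAlg K) : Prop :=
  exists (i : {lrmorphism A -> E}) (j : {lrmorphism H -> E}),
    [/\ coalg_map i, coalg_map j, injective i, injective j &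
        bijective (tens_lift (fun a y => i a * j y))].

Definition num_types (P : hopfAlg K -> Prop) (N : nat) : Prop :=
  exists E : 'I_N -> hopfAlg K,
    [/\ forall k, P (E k),
        forall k l, hopf_iso (E k) (E l) -> k = l &
        forall H, P H -> exists k, hopf_iso H (E k)].

End HopfMaps.

(* Main.v *)
(* Let E factorize through T = T_{m^2}(q) and K[G], with G = D_{2n}.  The products
   h^a x^b g form a basis of E on which the coproduct is explicit, so the
   grouplikes of E are the h^a g, and a nontrivial (u, 1)-primitive exists only
   for u = h, where it is a multiple of x modulo 1 - h.  Conjugating h and x by
   g in G therefore fixes h and scales x by a character s(g) of G; the
   characters of the dihedral group have values in {1, -1}.  Conversely every
   character occurs, in the skew group Hopf algebra T * G.  Two characters s, s'
   give isomorphic Hopf algebras exactly when s'(phi g) = s(g) q^e(g) for some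
   automorphism phi of G and some homomorphism e : G -> Z/m.  For m even, e
   realizes every sign, which leaves one class; for m odd, e vanishes, and the
   classes are the orbits of Aut(G) on the characters. *)
Require Import Defs.
From HB Require Import structures.
From mathcomp Require Import all_boot all_algebra all_fingroup all_solvable.

Set Implicit Arguments.
Unset Strict Implicit.
Unset Printing Implicit Defensive.

Import GRing.Theory.
Local Open Scope ring_scope.

(** * The monomial basis of the Taft algebra *)

(** The Taft algebra is given by generators and relations, so the independence of its monomials
    needs a model: a representation by matrices over the group algebra of Z/m. In [E], coproduct
    identities are tested on products of two coordinate functionals; the resulting scalar equations
    can be solved because the q-integers strictly between 0 and [m] do not vanish. The summand in
    [1 - h] of a conjugate of [x] is killed by [x h = q h x] and [q <> 1]. The factor [q^e(g)]
    arises because another copy of [G] in [E] may consist of the grouplikes [h^e(g) phi(g)], and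
    moving [x] past [h^e(g)] costs that power of [q]. For odd [m], an odd [n] forces the value 1 on
    the rotation [d] and leaves two signs on the reflection [c]; an even [n] allows four characters,
    and the two with value -1 on [d] are exchanged by the automorphism fixing [d] and sending [c] to
    [d c], which leaves three orbits. These counts rest on [-1 <> 1]: in characteristic 2 every
    character is trivial, whence the assumption on [K] for odd [m]. *)

Section TaftBasis.
Variables (K : fieldType) (p : nat) (q : K).
Local Notation m := p.+1.
Hypothesis hq : m.-primitive_root q.
Local Notation T := (taft_alg hq).
Local Notation h := (taft_h hq).
Local Notation x := (taft_x hq).

Definition taft_mon (a : 'I_m * 'I_m) : T := h ^+ a.1 * x ^+ a.2.

Lemma taft_h_mod k : h ^+ (k %% m) = h ^+ k.
Proof.
by rewrite [in RHS](divn_eq k m) exprD mulnC exprM taft_hmE expr1n mul1r.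
Qed.

Lemma taft_xhX k : x * h ^+ k = q ^+ k *: (h ^+ k * x).
Proof.
elim: k => [|k IHk]; first by rewrite !expr0 mulr1 scale1r mul1r.
rewrite !(exprSr, mulrA) IHk -scalerAl -(mulrA _ x) taft_xhE -scalerAr scalerA.
by rewrite mulrA.
Qed.

Section Representation.
Local Notation R := (group_alg K 'I_m).
Local Notation B := 'M[R]_m.

(* The first row of [taft_rep y] lists the coordinates of [y] in the basis
   [h ^+ i * x ^+ j]: the column is [j], and the entry, an element of the group
   algebra of Z/m, records [i]. *)
Definition taft_rep_cst (a : K) : B := (a *: (1 : R))%:M.
Definition taft_rep_h : B :=
  diag_mx (\row_k (q ^+ k *: gelt K (inZp 1 : 'I_m))).
Definition taft_rep_x : B := \matrix_(k, l) (l == k.+1 :> nat)%:R.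

Lemma taft_rep_cstD : {morph taft_rep_cst : a b / a + b}.
Proof. by move=> a b; rewrite /taft_rep_cst scalerDl raddfD. Qed.
Lemma taft_rep_cstM : {morph taft_rep_cst : a b / a * b}.
Proof.
move=> a b; rewrite /taft_rep_cst -[RHS]/(_%:M *m _%:M) -scalar_mxM.
by rewrite -scalerAl mul1r scalerA.
Qed.
Lemma taft_rep_cst1 : taft_rep_cst 1 = 1.
Proof. by rewrite /taft_rep_cst scale1r. Qed.
Lemma taft_rep_cstC a (M : B) : taft_rep_cst a * M = M * taft_rep_cst a.
Proof.
apply/matrixP => i j; rewrite !mxE (bigD1 i) //= [RHS](bigD1 j) //= !mxE !eqxx.
rewrite big1 => [|k /negPf nk]; last by rewrite mxE eq_sym nk mul0r.
rewrite big1 => [|k /negPf nk]; last by rewrite mxE nk mulr0.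
by rewrite !addr0 !mulr1n -scalerAl -scalerAr mulr1 mul1r.
Qed.

Lemma taft_rep_hX k : taft_rep_h ^+ k =
  diag_mx (\row_l (q ^+ (l * k) *: gelt K (inZp k : 'I_m))).
Proof.
elim: k => [|k IHk].
  rewrite expr0; apply/matrixP => i j; rewrite !mxE muln0 expr0 scale1r.
  congr (_ *+ _); rewrite -gelt1; congr gelt; exact: val_inj.
rewrite exprS IHk; apply/matrixP => i j; rewrite [LHS]mxE (bigD1 i) //= !mxE.
rewrite eqxx mulr1n big1 => [|l /negPf nl]; last by rewrite mxE eq_sym nl mul0r.
rewrite addr0; case: (i == j); last by rewrite mulr0.
rewrite !mulr1n -scalerAl -scalerAr scalerA -geltM -exprD addnC -mulnSr.
congr (_ *: gelt K _); apply: val_inj => /=.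
by rewrite modnDml modnDmr add1n.
Qed.

Lemma taft_rep_xX k (i : 'I_m) j : (taft_rep_x ^+ k) i j = (j == i + k :> nat)%N%:R.
Proof.
elim: k i j => [|k IHk] i j; first by rewrite expr0 mxE addn0 eq_sym.
rewrite exprSr [LHS]mxE.
have [ltk|gek] := ltnP (i + k) m; last first.
  rewrite big1 => [|l _]; last first.
    by rewrite IHk ltn_eqF ?mul0r // (leq_trans (ltn_ord l)).
  by rewrite ltn_eqF // addnS (leq_trans (ltn_ord j)) // leqW.
rewrite (bigD1 (Ordinal ltk)) //= IHk /= eqxx mul1r mxE /= addnS.
rewrite big1 ?addr0 // => l; rewrite -val_eqE /= => /negPf nl.
by rewrite IHk nl mul0r.
Qed.

Definition taft_rep_gen i : B := if i is Taft_h then taft_rep_h else taft_rep_x.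

(** The diagonal entries of [taft_rep_h] gain a factor [q] from one column to the next, which is the
    relation [x h = q h x]; the shift [taft_rep_x] leaves the matrix after [m] steps. *)
Lemma taft_rep_rel s t : taft_rel m q s t ->
  peval taft_rep_cst taft_rep_gen s = peval taft_rep_cst taft_rep_gen t.
Proof.
apply: taft_eval; [exact: taft_rep_cstD|exact: taft_rep_cst1| | |] => /=.
- rewrite taft_rep_hX; apply/matrixP => i j; rewrite !mxE.
  rewrite mulnC exprM (prim_expr_order hq) expr1n scale1r.
  congr (_ *+ _); rewrite -gelt1; congr gelt; apply: val_inj.
  by rewrite /= modnn.
- apply/matrixP => i j; rewrite taft_rep_xX mxE ltn_eqF //.
  by rewrite (leq_trans (ltn_ord j)) // leq_addl.
- apply/matrixP => i j; rewrite /taft_rep_cst -[_ * (_ * _)]/(_%:M *m (_ *m _)).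
  rewrite mul_scalar_mx -[_ * _]/(_ *m _) mul_diag_mx mul_mx_diag !mxE.
  have [->|_] := eqVneq (j : nat) i.+1; last by rewrite mul0r !mulr0.
  by rewrite mul1r mulr1 -scalerAl mul1r scalerA exprS.
Qed.

Definition taft_rep : T -> B := plift taft_rep_cst taft_rep_gen.

End Representation.

Definition taft_coef (a : 'I_m * 'I_m) (y : T) : K^o := taft_rep y 0 a.2 a.1.

Fact taft_coef_linear a : linear (taft_coef a).
Proof.
move=> k y z; rewrite /taft_coef /taft_rep.
rewrite (pliftD taft_rep_cstD taft_rep_cstM taft_rep_cst1 taft_rep_cstC
  taft_rep_rel).
rewrite (pliftZ taft_rep_cstD taft_rep_cstM taft_rep_cst1 taft_rep_cstC
  taft_rep_rel).
rewrite /taft_rep_cst -[_ * _]/(_%:M *m _) mul_scalar_mx.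
by rewrite !mxE -scalerAl mul1r !ffunE.
Qed.
HB.instance Definition _ a :=
  GRing.isLinear.Build K T K^o *:%R (taft_coef a) (taft_coef_linear a).

(** Independence of the monomials: row 0 of [taft_rep_h] carries no power of [q], and [taft_rep_x]
    moves it to the right, so distinct monomials have distinct unit vectors as first rows. *)
Lemma taft_coef_mon a b : taft_coef a (taft_mon b) = (a == b)%:R.
Proof.
have repM := pliftM taft_rep_cstD taft_rep_cstM taft_rep_cst1 taft_rep_cstC
  taft_rep_rel.
have rep1 := plift1 taft_rep_cstD taft_rep_cstM taft_rep_cst1 taft_rep_cstC
  taft_rep_rel.
have repg := plift_gen taft_rep_cstD taft_rep_cstM taft_rep_cst1 taft_rep_cstC
  taft_rep_rel.
have repX y k : taft_rep (y ^+ k) = taft_rep y ^+ k.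
  elim: k => [|k IHk]; first exact: rep1.
  by rewrite !exprS [LHS]repM -IHk.
rewrite /taft_coef /taft_mon [taft_rep _]repM [plift _ _ _]repX.
rewrite [plift _ _ (x ^+ _)]repX [taft_rep _](repg Taft_h).
rewrite [taft_rep _](repg Taft_x) /= taft_rep_hX -[_ * _]/(_ *m _) mul_diag_mx.
rewrite !mxE taft_rep_xX /= mul0n expr0 scale1r add0n.
rewrite -[a.2 == _ :> nat]/(a.2 == b.2) valZpK; case: a b => [a1 a2] [b1 b2] /=.
rewrite xpair_eqE; case: (a2 == b2); last by rewrite mulr0 andbF ffunE.
by rewrite andbT mulr1 ffunE.
Qed.

(** The span [P] of the monomials contains 1 and is stable under left multiplication by [h] and by
    [x], since [x] passes [h ^+ k] at the cost of a scalar. *)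
Lemma taft_monE y : y = \sum_a (taft_coef a y : K) *: taft_mon a.
Proof.
pose P y := exists c, y = \sum_a (c a : K) *: taft_mon a.
suff [c ->]: P y.
  apply: eq_bigr => a _; congr (_ *: _); rewrite linear_sum (bigD1 a) //=.
  rewrite linearZ /= taft_coef_mon eqxx [_ *: _]mulr1 big1 ?addr0 // => b nb.
  by rewrite linearZ /= taft_coef_mon eq_sym (negPf nb) [LHS]mulr0.
have PD u v : P u -> P v -> P (u + v).
  move=> [c ->] [d ->]; exists (fun a => c a + d a); rewrite -big_split.
  by apply: eq_bigr => a _; rewrite scalerDl.
have PZ k u : P u -> P (k *: u).
  move=> [c ->]; exists (fun a => k * c a); rewrite scaler_sumr.
  by apply: eq_bigr => a _; rewrite scalerA.
have Pmon k l : P (h ^+ k * x ^+ l).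
  have [ltl|gel] := ltnP l m; last first.
    exists (fun _ => 0); rewrite big1 => [|a _]; last by rewrite scale0r.
    by rewrite -(subnKC gel) exprD taft_xmE mul0r mulr0.
  exists (fun a => (a == (inZp k, Ordinal ltl))%:R).
  rewrite (bigD1 (inZp k, Ordinal ltl)) //= eqxx scale1r big1.
    by rewrite addr0 /taft_mon /= taft_h_mod.
  by move=> a /negPf ->; rewrite scale0r.
suff: forall z, P z -> P (y * z).
  by move/(_ 1); rewrite mulr1; apply; have := Pmon 0%N 0%N; rewrite mulr1.
have Psum (c : 'I_m * 'I_m -> K) u :
    (forall a, P (u * taft_mon a)) -> P (u * \sum_a c a *: taft_mon a).
  move=> Pu; rewrite mulr_sumr; elim/big_ind: _ => // [|a _].
    by have := PZ 0 _ (Pmon 0%N 0%N); rewrite scale0r.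
  by rewrite -scalerAr; apply: PZ.
elim/taft_ind: y => [z [c ->]|z [c ->]|k z|u v IHu IHv z|u v IHu IHv z].
- by apply: Psum => a; rewrite mulrA -exprS; apply: Pmon.
- apply: Psum => a; rewrite mulrA taft_xhX -scalerAl -mulrA -exprS.
  exact/PZ/Pmon.
- by rewrite -scalerAl mul1r; apply: PZ.
- by move=> Pz; rewrite mulrDl; apply: PD; [apply: IHu|apply: IHv].
- by move=> Pz; rewrite -mulrA; apply/IHu/IHv.
Qed.

(** [tens 1 x] and [tens x h] commute up to [q], so the q-binomial theorem expands the powers of
    their sum. *)
Lemma taft_comul_mon a : taft_comul (taft_mon a) =
  \sum_(k < a.2.+1)
    qbin q a.2 k *: tens (h ^+ a.1 * x ^+ k) (h ^+ (a.1 + k) * x ^+ (a.2 - k)).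
Proof.
have cX u k : taft_comul (u ^+ k : T) = taft_comul u ^+ k.
  by elim: k => [|k IHk]; rewrite ?taft_comul1 // !exprS taft_comulM IHk.
have ba : tens 1 x * tens x h =
    taft_scal (1 : tensor T T) q * (tens x h * tens 1 x).
  rewrite /taft_scal tensorMZl mul1r !tensM mul1r mulr1 taft_xhE.
  exact: tensZr.
rewrite /taft_mon taft_comulM !cX taft_comulh taft_comulx tensX.
rewrite (qbinomial (@taft_TTD _ _ _ hq) (@taft_TTM _ _ _ hq) (@taft_TT1 _ _ _ hq)
  (@taft_TTC _ _ _ hq) ba).
rewrite mulr_sumr; apply: eq_bigr => k _.
rewrite /taft_scal tensorMZl mul1r tensorMZr !tensX !tensM expr1n mulr1 exprD.
by rewrite mulrA.
Qed.

End TaftBasis.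

(** * Grouplike and skew primitive elements of a factorization *)

Definition factor_mul (K : fieldType) (E A B : hopfAlg K) (i : A -> E)
  (j : B -> E) : tensor A B -> E := tens_lift (fun a y => i a * j y).

Lemma bilinear_factor_mul (K : fieldType) (E A B : hopfAlg K)
  (i : {lrmorphism A -> E}) (j : {lrmorphism B -> E}) :
  bilinear_map (fun a y => i a * j y).
Proof.
apply: bilinear_mapI => [a a' y|a y y'|k a y|k a y].
- by rewrite raddfD mulrDl.
- by rewrite raddfD mulrDr.
- by rewrite linearZ -scalerAl.
- by rewrite linearZ -scalerAr.
Qed.

Section Factorization.
Variables (K : fieldType) (p : nat) (q : K).
Local Notation m := p.+1.
Variables (hq : m.-primitive_root q) (gT : finGroupType) (E : hopfAlg K).
Variables (i : {lrmorphism taft hq -> E}) (j : {lrmorphism group_hopf K gT -> E}).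
Hypotheses (ci : coalg_map i) (cj : coalg_map j).

Local Notation h := (taft_h hq).
Local Notation x := (taft_x hq).
Local Notation H := (i (taft_h hq)).
Local Notation X := (i (taft_x hq)).
Local Notation U g := (j (gelt K g)).

Lemma factor_U1 : U 1%g = 1. Proof. exact: rmorph1. Qed.
Lemma factor_UM g g' : U (g * g')%g = U g * U g'.
Proof. by rewrite /= geltM rmorphM. Qed.
Lemma factor_UV g : U g * U g^-1%g = 1.
Proof. by rewrite -factor_UM mulgV factor_U1. Qed.
Lemma factor_VU g : U g^-1%g * U g = 1.
Proof. by rewrite -factor_UM mulVg factor_U1. Qed.

Lemma factor_comulU g : comul E (U g) = tens (U g) (U g).
Proof. by rewrite cj.1 [comul _ _]group_comulE tens_mapE. Qed.
Lemma factor_counitU g : counit E (U g) = 1.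
Proof. by rewrite cj.2 [counit _ _]group_counitE. Qed.
Lemma factor_comulH : comul E H = tens H H.
Proof. by rewrite ci.1 [comul _ _]taft_comulh tens_mapE. Qed.
Lemma factor_counitH : counit E H = 1.
Proof. by rewrite ci.2 [counit _ _]taft_counith. Qed.
Lemma factor_comulX : comul E X = tens X H + tens 1 X.
Proof.
by rewrite ci.1 [comul _ _]taft_comulx tens_mapD !tens_mapE rmorph1.
Qed.
Lemma factor_XH : X * H = q *: (H * X).
Proof. by rewrite -!rmorphM -linearZ; congr (i _); apply: taft_xhE. Qed.
Lemma factor_Hmod k : H ^+ (k %% m) = H ^+ k.
Proof. by rewrite -!rmorphXn; congr (i _); apply: taft_h_mod. Qed.

Local Notation idx := ('I_m * 'I_m * gT)%type.

Definition factor_mon (a : idx) : E := i (taft_mon hq a.1) * U a.2.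

(** The inverse is fixed as data: [bijective] only asserts that it exists, whereas the coordinates
    on [E] have to be functions. *)
Variable Psi : E -> tensor (taft hq) (group_hopf K gT).
Hypotheses (PhiK : cancel (factor_mul i j) Psi).
Hypotheses (PsiK : cancel Psi (factor_mul i j)).

Definition factor_coef_fun (a : idx) (t : taft hq) (f : group_hopf K gT) : K^o :=
  (taft_coef a.1 t : K) *: (f : {ffun gT -> K^o}) a.2.

Lemma bilinear_factor_coef a : bilinear_map (factor_coef_fun a).
Proof.
apply: bilinear_mapI => [t t' f|t f f'|k t f|k t f]; rewrite /factor_coef_fun.
- by rewrite raddfD scalerDl.
- by rewrite ffunE scalerDr.
- by rewrite linearZ scalerA.
- by rewrite ffunE !scalerA mulrC.
Qed.

Definition factor_coef (a : idx) (y : E) : K^o :=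
  tens_lift (factor_coef_fun a) (Psi y).
Local Notation coef := factor_coef.

Lemma factor_Psi_linear : linear Psi.
Proof.
move=> k y z; apply: (can_inj PhiK).
by rewrite PsiK [RHS](tens_lift_linear (bilinear_factor_mul i j))
  -[tens_lift _ _]/(factor_mul i j _) -[tens_lift _ (Psi z)]/(factor_mul i j _)
  !PsiK.
Qed.

Fact factor_coef_linear a : linear (coef a).
Proof.
move=> k y z; rewrite /coef factor_Psi_linear.
exact: (tens_lift_linear (bilinear_factor_coef a)).
Qed.
HB.instance Definition _ a :=
  GRing.isLinear.Build K E K^o *:%R (coef a) (factor_coef_linear a).

Lemma factor_coef_mul a t g :
  coef a (i t * U g) = taft_coef a.1 t * (a.2 == g)%:R.
Proof.
have -> : i t * U g = factor_mul i j (tens t (gelt K g)).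
  by rewrite /factor_mul tens_lift_tens //; apply: bilinear_factor_mul.
rewrite /coef PhiK tens_lift_tens; last exact: bilinear_factor_coef.
by rewrite /factor_coef_fun ffunE.
Qed.

Lemma factor_coef_mon a b : coef a (factor_mon b) = (a == b)%:R.
Proof.
by rewrite factor_coef_mul taft_coef_mon -natrM mulnb.
Qed.

Lemma factor_monE y : y = \sum_a (coef a y : K) *: factor_mon a.
Proof.
suff [c ->] : exists c, y = \sum_a (c a : K) *: factor_mon a.
  apply: eq_bigr => a _; congr (_ *: _); rewrite linear_sum (bigD1 a) //=.
  rewrite linearZ /= factor_coef_mon eqxx [_ *: _]mulr1 big1 ?addr0 // => b nb.
  by rewrite linearZ /= factor_coef_mon eq_sym (negPf nb) [LHS]mulr0.
rewrite -(PsiK y); elim/tensor_ind: (Psi y) => [|t f|u v [c Ec] [d Ed]].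
- exists (fun=> 0); rewrite big1 => [|a _]; last by rewrite scale0r.
  exact: (tens_lift0 (bilinear_factor_mul i j)).
- exists (fun a => taft_coef a.1 t * (f : {ffun gT -> K^o}) a.2).
  rewrite /factor_mul tens_lift_tens; last exact: bilinear_factor_mul.
  rewrite {1}(taft_monE t) {1}(group_algE f) !raddf_sum mulr_suml.
  rewrite -(pair_bigA _ (fun a g => (taft_coef a t * (f : {ffun gT -> K^o}) g)
    *: factor_mon (a, g))) /=.
  apply: eq_bigr => a _; rewrite mulr_sumr; apply: eq_bigr => g _.
  by rewrite !linearZ -scalerAl -scalerAr scalerA.
- exists (fun a => c a + d a).
  rewrite /factor_mul (tens_liftD (bilinear_factor_mul i j)).
  rewrite -!/(factor_mul _ _ _) Ec Ed -big_split.
  by apply: eq_bigr => a _; rewrite scalerDl.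
Qed.

Lemma factor_coef_inj y z : (forall a, coef a y = coef a z) -> y = z.
Proof.
by move=> yz; rewrite [y]factor_monE [z]factor_monE; apply: eq_bigr => a _;
  rewrite yz.
Qed.

Lemma factor_mon_hx (r s : nat) g (lts : (s < m)%N) :
  i (h ^+ r * x ^+ s : taft_alg hq) * U g = factor_mon (inZp r, Ordinal lts, g).
Proof. by rewrite /factor_mon /taft_mon /= taft_h_mod. Qed.

Lemma factor_comul_mon a : comul E (factor_mon a) =
  \sum_(k < a.1.2.+1) qbin q a.1.2 k *:
    tens (i (h ^+ a.1.1 * x ^+ k : taft_alg hq) * U a.2)
      (i (h ^+ (a.1.1 + k) * x ^+ (a.1.2 - k) : taft_alg hq) * U a.2).
Proof.
rewrite comulM factor_comulU ci.1 [comul _ _]taft_comul_mon.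
set F := fun k : 'I_ _ => _.
have tmD : {morph tens_map i i : y z / y + z} := tens_mapD i i.
rewrite (big_morph _ tmD (tens_map0 i i)) mulr_suml; apply: eq_bigr => k _.
by rewrite /F tens_mapZ tens_mapE tensorMZl tensM.
Qed.

Definition factor_coef2 (a b : idx) : tensor E E -> K^o :=
  tens_lift (fun y z => coef a y * coef b z).
Local Notation coef2 := factor_coef2.

Lemma bilinear_factor_coef2 a b :
  bilinear_map (fun y z => coef a y * coef b z : K^o).
Proof.
apply: bilinear_mapI => [y y' z|y z z'|k y z|k y z].
- by rewrite linearD mulrDl.
- by rewrite linearD mulrDr.
- by rewrite linearZ -scalerAl.
- by rewrite linearZ -scalerAr.
Qed.
Let bil2 := bilinear_factor_coef2.

Lemma factor_coef2_tens a b y z : coef2 a b (tens y z) = coef a y * coef b z.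
Proof. exact: (tens_lift_tens (bil2 a b)). Qed.

(** A pair of indices occurs in the coproduct of at most one monomial, namely [h^r x^(s+s') g].
    Exponents of [h] add modulo [m], but [s + s'] is a sum of natural numbers, since [x^m = 0] and
    exponents of [x] do not wrap around. *)
Lemma factor_coef2_comul (r s : 'I_m) g (r' s' : 'I_m) g' y :
  coef2 (r, s, g) (r', s', g') (comul E y) =
  if [&& g == g', r' == r + s & (s + s' < m)%N]
  then qbin q (s + s') s * coef (r, inZp (s + s'), g) y else 0.
Proof.
set a := (r, s, g); set b := (r', s', g').
have -> : coef2 a b (comul E y) =
    \sum_c coef c y * coef2 a b (comul E (factor_mon c)).
  rewrite {1}[y]factor_monE linear_sum /coef2.
  rewrite (big_morph _ (tens_liftD (bil2 a b)) (tens_lift0 (bil2 a b))).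
  by apply: eq_bigr => c _; rewrite linearZ (tens_liftZ (bil2 a b)).
have EZp (k l : 'I_m) : k + l = inZp (k + l) by apply: val_inj.
set C := [&& _, _ & _]; pose c0 : idx := (r, inZp (s + s'), g).
suff E1 c : coef2 a b (comul E (factor_mon c)) =
    (C && (c == c0))%:R * qbin q (s + s') s.
  under eq_bigr => c _ do rewrite E1.
  rewrite (bigD1 c0) //= big1 => [|c /negPf nc]; last first.
    by rewrite nc andbF mul0r mulr0.
  rewrite eqxx andbT addr0; case: (C); last by rewrite mul0r mulr0.
  by rewrite mul1r mulrC.
case: c => [[ci0 cj0] cg]; rewrite factor_comul_mon /coef2.
rewrite (big_morph _ (tens_liftD (bil2 a b)) (tens_lift0 (bil2 a b))) /=.
have coef_hx d (k l : nat) g1 : (l < m)%N ->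
    coef d (i (h ^+ k * x ^+ l : taft_alg hq) * U g1) =
    [&& d.1.1 == inZp k, d.1.2 == l :> nat & d.2 == g1]%:R.
  move=> ltl; rewrite (factor_mon_hx _ _ ltl) factor_coef_mon.
  by case: d => [[d1 d2] d3] /=; rewrite !xpair_eqE -andbA.
have E2 k : (k < cj0.+1)%N -> forall c,
  tens_lift (fun y z => coef a y * coef b z)
   (c *: tens (i (h ^+ ci0 * x ^+ k : taft_alg hq) * U cg)
      (i (h ^+ (ci0 + k) * x ^+ (cj0 - k) : taft_alg hq) * U cg)) =
  c * ([&& r == ci0, s == k :> nat & g == cg] &&
    [&& r' == inZp (ci0 + k), s' == (cj0 - k)%N :> nat & g' == cg])%:R.
  rewrite ltnS => lek c; have ltj := ltn_ord cj0.
  rewrite (tens_liftZ (bil2 a b)) (tens_lift_tens (bil2 a b)) !coef_hx.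
  - by rewrite -natrM mulnb /= valZpK.
  - exact: leq_ltn_trans (leq_subr _ _) ltj.
  - exact: leq_ltn_trans lek ltj.
under eq_bigr => k _ do rewrite E2 //.
have [lesj|ltjs] := leqP s cj0; last first.
  rewrite big1 => [|k _]; last first.
    by rewrite (gtn_eqF (leq_trans (ltn_ord k) ltjs)) andbF mulr0.
  rewrite [C && _](_ : _ = false) ?mul0r //; apply/negbTE/negP.
  case/andP=> /and3P[_ _ lt_m]; rewrite !xpair_eqE => /andP[/andP[_ /eqP ec] _].
  by move: ltjs; rewrite ec /= modn_small // ltnNge leq_addr.
rewrite -ltnS in lesj; rewrite (bigD1 (Ordinal lesj)) //= big1 => [|k]; last first.
  by rewrite -val_eqE eq_sym /= => /negPf ->; rewrite andbF mulr0.
rewrite addr0 eqxx /= mulrC -[X in (_ && X)]/[&& _, _ & _].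
rewrite ltnS in lesj.
have [|nC] := boolP (_ && _); last first.
  rewrite mul0r [C && _](_ : _ = false) ?mul0r //; apply: contraNF nC.
  rewrite /C /c0 !xpair_eqE.
  case/andP=> /and3P[/eqP<- /eqP-> lt_m] /andP[/andP[/eqP-> /eqP->] /eqP->].
  by rewrite /= modn_small // addKn !eqxx -EZp !eqxx.
case/andP=> /andP[/eqP er /eqP eg] /and3P[/eqP er' /eqP es' /eqP eg'].
have ecj : (s + s')%N = cj0 by rewrite es' subnKC.
rewrite /C /c0 ecj eg eg' er er' !eqxx ltn_ord /= valZpK !xpair_eqE !eqxx /=.
by rewrite -EZp !eqxx.
Qed.

Lemma factor_mon_HU r g : factor_mon (inZp r, 0, g) = H ^+ r * U g.
Proof.
rewrite /factor_mon /taft_mon /= expr0 mulr1 -rmorphXn; congr (i _ * _).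
exact: taft_h_mod.
Qed.
Lemma factor_mon1 : factor_mon (0, 0, 1%g) = 1.
Proof. by rewrite /factor_mon /taft_mon /= mulr1 rmorph1 mul1r factor_U1. Qed.
Lemma factor_monH : factor_mon (inZp 1, 0, 1%g) = H.
Proof. by rewrite factor_mon_HU factor_U1 mulr1. Qed.

Lemma factor_HU_inj r g s g' :
  H ^+ r * U g = H ^+ s * U g' -> inZp r = inZp s :> 'I_m /\ g = g'.
Proof.
rewrite -!factor_mon_HU => /(congr1 (coef (inZp r, 0, g))).
rewrite !factor_coef_mon eqxx; case: eqP => [[Er ->] _|_ /eqP].
  by split=> //; apply: val_inj.
by rewrite oner_eq0.
Qed.

(** The coordinates of [u] satisfy [coef a u * coef b u = 0] for distinct [a], [b] without [x], and
    [coef a u] is idempotent. One of them is nonzero since the counit of [u] is 1; it is then 1 and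
    the only one. *)
Lemma factor_grouplike u : comul E u = tens u u -> counit E u = 1 ->
  exists (r : 'I_m) g, u = H ^+ r * U g.
Proof.
move=> Du eu; have cc a b : coef2 a b (comul E u) = coef a u * coef b u.
  by rewrite Du factor_coef2_tens.
(* The diagonal pair [(a, a)] would require [r = r + s], so the square of the coordinate
   vanishes. *)
have cs r (s : 'I_m) g : s != 0 -> coef (r, s, g) u = 0.
  move=> s0; apply/eqP; rewrite -[_ == 0]orbb -mulf_eq0 -cc.
  rewrite factor_coef2_comul (_ : (r == r + s) = false) ?andbF //.
  by rewrite -{1}[r]addr0 (inj_eq (addrI r)) eq_sym (negPf s0).
have [a ua] : exists a, coef a u != 0.
  apply/existsP; apply: contraPT eu => /existsPn u0.
  suff -> : u = 0 by rewrite linear0 => /eqP; rewrite eq_sym oner_eq0.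
  by apply: factor_coef_inj => a; rewrite linear0; apply/eqP; rewrite -[_ == _]negbK.
case: a ua => [[r s] g] ua; have s0 : s = 0.
  by apply/eqP; apply: contraNT ua => s0; rewrite cs.
exists r, g; subst s; rewrite -factor_mon_HU valZpK.
apply: factor_coef_inj => -[[r' s'] g']; rewrite factor_coef_mon !xpair_eqE.
have [->|s'0] := eqVneq s' 0; last by rewrite cs // andbF.
rewrite andbT; apply: (mulfI ua); rewrite -cc factor_coef2_comul addr0 /=.
rewrite (_ : inZp (0 + 0) = 0); last exact: val_inj.
rewrite andbT (eq_sym g) [(g' == g) && _]andbC.
by case: (_ && _); rewrite ?mul1r ?mulr1 ?mulr0.
Qed.

(** This is the q-integer of [J]: multiplied by [1 - q] it becomes [1 - q ^+ J], nonzero because [q]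
    has order [m]. *)
Lemma qbin1_neq0 J : (0 < J < m)%N -> qbin q J 1 != 0.
Proof.
case/andP=> J0 ltJ; have := @qbin_absorb K q J 0 (leq0n _).
rewrite qbin0 subn0 mulr1 => EJ; apply: contraTneq (isT) => qJ.
move: EJ; rewrite qJ mulr0 => /esym/eqP; rewrite subr_eq0 eq_sym.
by rewrite -(prim_order_dvd hq) gtnNdvd.
Qed.

Hypothesis p_gt0 : (0 < p)%N.
Let one : 'I_m := inZp 1.
Let oneE : (one : nat) = 1%N. Proof. by rewrite /= modn_small. Qed.
Let one_neq0 : one != 0. Proof. by rewrite -val_eqE [val one]oneE. Qed.

Lemma factor_monX : factor_mon (0, one, 1%g) = X.
Proof.
rewrite /factor_mon /taft_mon [nat_of_ord (0, one, 1%g).1.2]oneE.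
by rewrite mul1r factor_U1 mulr1.
Qed.

(** Since [u] is itself a monomial, the equation for [comul E y] can be read coordinate by
    coordinate, sorted by the degree in [x]. *)
Lemma factor_skew_primitive u y : comul E u = tens u u -> counit E u = 1 ->
    comul E y = tens y u + tens 1 y ->
  exists a b, y = a *: X + b *: (1 - u) /\ (a != 0 -> u = H).
Proof.
move=> Du eu Dy; have EX := factor_monX.
have EH : factor_mon (one, 0, 1%g) = H := factor_monH.
move: (one) oneE one_neq0 EX EH => e1 e1E e1_neq0 EX EH.
have [s [g0 Eu]] := factor_grouplike Du eu.
have {Du eu} Eu : u = factor_mon (s, 0, g0) by rewrite -[s]valZpK factor_mon_HU.
pose b0 : idx := (s, 0, g0); pose a0 : idx := (0, 0, 1%g).
pose x0 : idx := (0, e1, 1%g).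
have cc a b : coef2 a b (comul E y) =
    coef a y * (b == b0)%:R + (a == a0)%:R * coef b y.
  rewrite Dy /coef2 (tens_liftD (bil2 a b)) !(tens_lift_tens (bil2 a b)).
  by rewrite Eu -{1}factor_mon1 !factor_coef_mon.
(* Splitting off one [x] gives a pair of indices both of positive degree in [x]. Such a pair is
   absent from the right-hand side, and on the left it carries the q-integer of [t]. *)
have c2 r (t : 'I_m) g : (1 < t)%N -> coef (r, t, g) y = 0.
  move=> t1; have lt_m : (t.-1 < m)%N := leq_ltn_trans (leq_pred _) (ltn_ord t).
  have := cc (r, e1, g) (r + e1, Ordinal lt_m, g).
  rewrite factor_coef2_comul !eqxx !xpair_eqE /= e1E add1n prednK ?(ltnW t1) //.
  rewrite ltn_ord (negPf e1_neq0) !(andbF, andFb) mul0r addr0 valZpK.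
  rewrite -[Ordinal _ == 0]val_eqE /= eqn0Ngt -ltnS prednK ?(ltnW t1) // t1.
  rewrite andbF mulr0 => /eqP; rewrite mulf_eq0 => /orP[|/eqP //].
  by rewrite (negPf (qbin1_neq0 _)) // ltn_ord (ltnW t1).
(* The pair of [h^r g] and [h^r x g] meets the right-hand side only through [tens 1 y], hence only
   for [r = 0] and [g = 1]. *)
have c1 r g : (r, g) != (0, 1%g) -> coef (r, e1, g) y = 0.
  move=> rg; have := cc (r, 0, g) (r, e1, g).
  rewrite factor_coef2_comul !eqxx addr0 eqxx /= add0n ltn_ord valZpK !xpair_eqE.
  rewrite qbin0 mul1r (negPf e1_neq0) !(andbF, andbT, andFb) mulr0 add0r => ->.
  by rewrite -xpair_eqE (negPf rg) mul0r.
(* The pair of [x] and [h] meets only [tens y u], so a nonzero coordinate along [x] forces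
   [u = h]. *)
have cx : coef x0 y != 0 -> b0 = (e1, 0, 1%g).
  move=> x0y; have := cc x0 (e1, 0, 1%g).
  rewrite factor_coef2_comul !eqxx add0r eqxx /= addn0 ltn_ord valZpK.
  rewrite e1E /= mulr0 addr0 mul1r [x0 == a0]xpair_eqE [(0, e1) == _]xpair_eqE.
  rewrite (negPf e1_neq0) andbF mul0r addr0 => /esym/eqP.
  rewrite -subr_eq0 -{2}[coef _ y]mulr1 -mulrBr mulf_eq0 (negPf x0y) /=.
  case: ((e1, 0, 1%g) =P b0) => [-> //|_].
  by rewrite sub0r oppr_eq0 oner_eq0.
have c0 r g r' g' : (if (g == g') && (r' == r) then coef (r, 0, g) y else 0) =
    coef (r, 0, g) y * ((r', 0, g') == b0)%:R +
    ((r, 0, g) == a0)%:R * coef (r', 0, g') y.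
  rewrite -cc factor_coef2_comul addr0 andbT qbin0 mul1r.
  by rewrite (_ : inZp (0 + 0) = 0) //; apply: val_inj.
exists (coef x0 y), (coef a0 y); split; last first.
  by move/cx=> Eb; rewrite Eu -EH -Eb.
apply: factor_coef_inj => -[[r t] g]; rewrite -EX -factor_mon1 Eu.
rewrite linearD !linearZ linearB /= !factor_coef_mon -/x0 -/a0 -/b0.
have [->|t0] := eqVneq t 0; last first.
  rewrite ![(_, t, _) == _]xpair_eqE ![(_, t) == _]xpair_eqE (negPf t0).
  rewrite !andbF subrr scaler0 addr0 /=.
  have [->|t1] := eqVneq t e1; last first.
    rewrite andbF scaler0 c2 //; move: t0 t1; rewrite -!val_eqE /= e1E.
    by case: (nat_of_ord t) => [|[]].
  rewrite andbT -xpair_eqE; have [[-> ->]|/c1->] := eqVneq (r, g) (0, 1%g).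
    by rewrite [_ *: _]mulr1.
  by rewrite scaler0.
rewrite [(_, 0, _) == x0]xpair_eqE [(_, 0) == (0, e1)]xpair_eqE.
rewrite [0 == e1]eq_sym (negPf e1_neq0) andbF scaler0 add0r.
have [Ea|na] := eqVneq (r, 0, g) a0.
  have [Eb|nb] := eqVneq (r, 0, g) b0; last by rewrite subr0 Ea [_ *: _]mulr1.
  (* Here [u = 1], so [1 - u] vanishes, and the equation at this index reads [c = c + c]. *)
  rewrite subrr scaler0; move/eqP: Ea => Ea; move/eqP: Eb => Eb.
  have := c0 r g r g; rewrite !eqxx Ea Eb mulr1 mul1r -{1}[coef _ _]addr0.
  by move/addrI.
have [Eb|nb] := eqVneq (r, 0, g) b0; last first.
  rewrite subrr scaler0; have := c0 r g r g; rewrite !eqxx (negPf na) (negPf nb).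
  by rewrite mulr0 mul0r addr0.
(* The pair of [1] and [u] has no term on the left, so the coordinates of [y] along them are
   opposite. *)
rewrite sub0r scalerN [_ *: _]mulr1; have := c0 0 1%g r g; rewrite -/a0 Eb !eqxx.
rewrite mulr1 mul1r.
case: ifP => [/andP[/eqP eg /eqP er]|_ /esym/eqP].
  by case/eqP: na; rewrite -eg er.
by rewrite addr_eq0 => /eqP->; rewrite opprK.
Qed.

(** With [y = a X + b (1 - H)], the relation [y u = q u y] gives [b = q b] on the coordinate of [H],
    hence [b = 0]. This serves twice: for the conjugates of [H] and [X] by [U g], and for the
    generators coming from a second factorization. *)
Lemma factor_rigid u y : comul E u = tens u u -> counit E u = 1 ->
    comul E y = tens y u + tens 1 y -> y * u = q *: (u * y) ->
    (forall b, y <> b *: (1 - u)) ->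
  u = H /\ exists2 a, a != 0 & y = a *: X.
Proof.
move=> Du eu Dy yu ny; have [a [b [Ey uH]]] := factor_skew_primitive Du eu Dy.
have a0 : a != 0.
  by apply/eqP => a0; apply: (ny b); rewrite {1}Ey a0 scale0r add0r.
have {}uH := uH a0; subst u; split=> //; exists a => //.
suff b0 : b = 0 by rewrite Ey b0 scale0r addr0.
move: yu; rewrite Ey mulrDl mulrDr -!scalerAl -!scalerAr factor_XH scalerDr.
rewrite !scalerA (mulrC q a) => /addrI.
rewrite mulrBl mul1r mulrBr mulr1 -expr2 => /(congr1 (coef (one, 0, 1%g))).
have cH : coef (one, 0, 1%g) H = 1.
  by rewrite -factor_monH factor_coef_mon eqxx.
(* The coordinate along [H] vanishes also when [m = 2], where [H ^+ 2] is 1. *)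
have cH2 : coef (one, 0, 1%g) (H ^+ 2) = 0.
  rewrite -[H ^+ 2]mulr1 -factor_U1 -factor_mon_HU factor_coef_mon.
  rewrite [_ == _](_ : _ = false) // !xpair_eqE (_ : inZp 2 = one + one).
    by rewrite -{1}[one]addr0 (inj_eq (addrI one)) eq_sym (negPf one_neq0).
  by apply: val_inj; rewrite /= modnDml modnDmr.
rewrite !linearZ linearB /= cH cH2 subr0 ![_ *: 1]mulr1 => /esym/eqP.
rewrite -{2}[b]mul1r -subr_eq0 -mulrBl mulf_eq0 subr_eq0 => /orP[|/eqP //].
by rewrite -[q]expr1 -(prim_order_dvd hq) gtnNdvd.
Qed.

Lemma factor_X_neq b : X <> b *: (1 - H).
Proof.
move/(congr1 (coef (0, one, 1%g))); rewrite -factor_monX -factor_mon1 -factor_monH.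
rewrite linearZ linearB /= !factor_coef_mon eqxx !xpair_eqE (negPf one_neq0).
by rewrite !andbF subrr scaler0 => /eqP; rewrite oner_eq0.
Qed.

(** Conjugation by an invertible grouplike is an algebra automorphism compatible with [comul E], so
    it sends [H] and [X] to a pair covered by [factor_rigid]. *)
Lemma factor_action g : U g * H = H * U g /\ exists a, U g * X = a *: (X * U g).
Proof.
pose cg y := U g * y * U g^-1%g.
have cgM y z : cg (y * z) = cg y * cg z.
  by rewrite /cg -!mulrA (mulrA (U g^-1%g)) factor_VU mul1r.
have cgD y z : cg (y + z) = cg y + cg z by rewrite /cg mulrDr mulrDl.
have cgZ k y : cg (k *: y) = k *: cg y by rewrite /cg -scalerAr -scalerAl.
have cgK y : U g^-1%g * cg y * U g = y.
  by rewrite /cg -!mulrA factor_VU mulr1 mulrA factor_VU mul1r.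
have cg1 : cg 1 = 1 by rewrite /cg mulr1 factor_UV.
have Dcg y : comul E (cg y) = tens (U g) (U g) * comul E y * tens (U g^-1%g) (U g^-1%g).
  by rewrite !comulM !factor_comulU.
have Tcg y z : tens (U g) (U g) * tens y z * tens (U g^-1%g) (U g^-1%g) =
  tens (cg y) (cg z) by rewrite !tensM.
have [] := @factor_rigid (cg H) (cg X).
- by rewrite Dcg factor_comulH Tcg.
- by rewrite !counitM factor_counitH !factor_counitU !mulr1.
- by rewrite Dcg factor_comulX mulrDr mulrDl !Tcg cg1.
- by rewrite -!cgM factor_XH cgZ.
- move=> b Eb; apply: (@factor_X_neq b).
  have Ecg : cg (b *: (1 - H)) = b *: (1 - cg H).
    by rewrite cgZ cgD cg1 -scaleN1r cgZ scaleN1r.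
  by rewrite -[LHS]cgK Eb -Ecg cgK.
have cgU y : cg y * U g = U g * y by rewrite /cg -mulrA factor_VU mulr1.
move=> EH [a _ EX]; split; first by rewrite -cgU EH.
by exists a; rewrite -cgU EX -scalerAl.
Qed.

End Factorization.

(** * Rescaling the skew primitive generator of the Taft algebra *)

Section TaftScale.
Variables (K : fieldType) (m : nat) (q : K) (hq : m.-primitive_root q).
Local Notation T := (taft_alg hq).
Local Notation h := (taft_h hq).
Local Notation x := (taft_x hq).

Definition taft_scale_gen (a : K) (i : taft_gen) : T :=
  if i is Taft_h then h else a *: x.

Definition taft_scale (a : K) : T -> T :=
  plift (taft_scal (1 : T)) (taft_scale_gen a).

Fact taft_scalD : {morph taft_scal (1 : T) : a b / a + b}.
Proof. by move=> a b; rewrite /taft_scal scalerDl. Qed.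
Fact taft_scalM : {morph taft_scal (1 : T) : a b / a * b}.
Proof. by move=> a b; rewrite /taft_scal -scalerAl mul1r scalerA. Qed.
Fact taft_scal1 : taft_scal (1 : T) 1 = 1.
Proof. exact: scale1r. Qed.
Fact taft_scalC a (y : T) : taft_scal (1 : T) a * y = y * taft_scal (1 : T) a.
Proof. by rewrite /taft_scal -scalerAl -scalerAr mulr1 mul1r. Qed.

Variable a : K.

Fact taft_scale_rel s t : taft_rel m q s t ->
  peval (taft_scal (1 : T)) (taft_scale_gen a) s =
  peval (taft_scal (1 : T)) (taft_scale_gen a) t.
Proof.
apply: taft_eval; [exact: taft_scalD|exact: taft_scal1| | |] => /=.
- exact: taft_hmE.
- by rewrite exprZn taft_xmE scaler0.
- rewrite /taft_scal -!scalerAl mul1r -scalerAr taft_xhE !scalerA.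
  by rewrite mulrC.
Qed.

Lemma taft_scaleh : taft_scale a h = h.
Proof.
exact: (plift_gen taft_scalD taft_scalM taft_scal1 taft_scalC taft_scale_rel
  Taft_h).
Qed.
Lemma taft_scalex : taft_scale a x = a *: x.
Proof.
exact: (plift_gen taft_scalD taft_scalM taft_scal1 taft_scalC taft_scale_rel
  Taft_x).
Qed.
Fact taft_scale_linear : linear (taft_scale a).
Proof.
move=> k y z; rewrite /taft_scale.
rewrite (pliftD taft_scalD taft_scalM taft_scal1 taft_scalC taft_scale_rel).
rewrite (pliftZ taft_scalD taft_scalM taft_scal1 taft_scalC taft_scale_rel).
by rewrite /taft_scal -scalerAl mul1r.
Qed.
Fact taft_scale_monoid_morphism : monoid_morphism (taft_scale a).
Proof.
split; first exact: (plift1 taft_scalD taft_scalM taft_scal1 taft_scalC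
  taft_scale_rel).
exact: (pliftM taft_scalD taft_scalM taft_scal1 taft_scalC taft_scale_rel).
Qed.
HB.instance Definition _ :=
  GRing.isLinear.Build K T T *:%R (taft_scale a) taft_scale_linear.
HB.instance Definition _ :=
  GRing.isMonoidMorphism.Build T T (taft_scale a) taft_scale_monoid_morphism.

Lemma taft_scale_comul y :
  taft_comul (taft_scale a y) = tens_map (taft_scale a) (taft_scale a) (taft_comul y).
Proof.
have bm := @bilinear_mul K T.
have mapM := @tens_map_mul K T T T T _ _ _ _ (taft_scale a) (taft_scale a)
  bm bm bm bm (rmorphM _) (rmorphM _).
elim/taft_ind: y => [||k|y z IHy IHz|y z IHy IHz].
- by rewrite taft_scaleh taft_comulh tens_mapE /= taft_scaleh.
- rewrite taft_scalex linearZ /= taft_comulx tens_mapD !tens_mapE /= taft_scaleh.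
  by rewrite taft_scalex rmorph1 scalerDr tensZl tensZr.
- by rewrite linearZ rmorph1 taft_comul_scal tens_mapZ tens_mapE rmorph1.
- by rewrite !linearD /= tens_mapD IHy IHz.
- by rewrite rmorphM !taft_comulM IHy IHz [RHS]mapM.
Qed.

Lemma taft_scale_counit y : taft_counit (taft_scale a y) = taft_counit y.
Proof.
elim/taft_ind: y => [||k|y z IHy IHz|y z IHy IHz].
- by rewrite taft_scaleh.
- by rewrite taft_scalex linearZ /= taft_counitx scaler0.
- by rewrite linearZ rmorph1.
- by rewrite !linearD /= IHy IHz.
- by rewrite rmorphM !taft_counitM IHy IHz.
Qed.
End TaftScale.

Lemma taft_scale_1 (K : fieldType) m (q : K) (hq : m.-primitive_root q) y :
  taft_scale (hq := hq) 1 y = y.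
Proof.
elim/taft_ind: y => [||k|y z IHy IHz|y z IHy IHz].
- by rewrite taft_scaleh.
- by rewrite taft_scalex scale1r.
- by rewrite linearZ rmorph1.
- by rewrite linearD /= IHy IHz.
- by rewrite rmorphM /= IHy IHz.
Qed.

Lemma taft_scale_comp (K : fieldType) m (q : K) (hq : m.-primitive_root q) a b y :
  taft_scale (hq := hq) a (taft_scale b y) = taft_scale (a * b) y.
Proof.
elim/taft_ind: y => [||k|y z IHy IHz|y z IHy IHz].
- by rewrite !taft_scaleh.
- by rewrite !taft_scalex linearZ /= taft_scalex scalerA mulrC.
- by rewrite !linearZ /= !rmorph1.
- by rewrite !linearD /= IHy IHz.
- by rewrite !rmorphM /= IHy IHz.
Qed.

Section LRMorphism.
Variables (K : fieldType) (A B : algType K) (f : A -> B).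
Hypotheses (f_lin : linear f) (f_mul : monoid_morphism f).
Definition lrmorphism_of : {lrmorphism A -> B} :=
  HB.pack f (GRing.isLinear.Build K A B *:%R f f_lin)
    (GRing.isMonoidMorphism.Build A B f f_mul).
End LRMorphism.

(** * Factorizations and characters *)

(** A factorization together with the scalars by which the group acts on [x]. That [s] is a
    character is a consequence, see [smash_char1] and [smash_charM]. *)
Definition smash_factorization (K : fieldType) (m : nat) (q : K)
    (hq : m.-primitive_root q) (gT : finGroupType) (E : hopfAlg K)
    (i : {lrmorphism taft hq -> E}) (j : {lrmorphism group_hopf K gT -> E})
    (s : gT -> K) : Prop :=
  [/\ coalg_map i, coalg_map j, bijective (factor_mul i j),
      forall g, j (gelt K g) * i (taft_h hq) = i (taft_h hq) * j (gelt K g) &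
      forall g, j (gelt K g) * i (taft_x hq) =
        s g *: (i (taft_x hq) * j (gelt K g))].

Lemma coalg_map_comp (K : fieldType) (A B C : hopfAlg K)
    (f : {lrmorphism A -> B}) (g : {lrmorphism B -> C}) :
  coalg_map f -> coalg_map g -> coalg_map (g \o f).
Proof.
move=> cf cg; split=> a /=; last by rewrite cg.2 cf.2.
rewrite cg.1 cf.1; elim/tensor_ind: (comul A a) => [|y z|y z IHy IHz].
- by rewrite !tens_map0.
- by rewrite !tens_mapE.
- by rewrite !tens_mapD IHy IHz.
Qed.

Section SmashFactorization.
Variables (K : fieldType) (p : nat) (q : K).
Local Notation m := p.+1.
Variables (hq : m.-primitive_root q) (gT : finGroupType).
Hypothesis p_gt0 : (0 < p)%N.
Implicit Types (E : hopfAlg K) (s : gT -> K).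
Local Notation T := (taft hq).
Local Notation KG := (group_hopf K gT).
Local Notation smash := (@smash_factorization K m q hq gT).

Lemma factorizes_smash E : factorizes E T KG ->
  exists (i : {lrmorphism T -> E}) (j : {lrmorphism KG -> E}) s, smash i j s.
Proof.
case=> i [j [ci cj _ _ bij]]; have [Psi PhiK PsiK] := bij.
have act g := @factor_action K p q hq gT E i j ci cj Psi PhiK PsiK p_gt0 g.
have [s Es] := fin_all_exists (fun g => (act g).2).
by exists i, j, s; split=> // g; case: (act g).
Qed.

Section One.
Variables (E : hopfAlg K) (i : {lrmorphism T -> E}) (j : {lrmorphism KG -> E}).
Variable s : gT -> K.
Hypothesis smE : smash i j s.
Local Notation U g := (j (gelt K g)).
Local Notation H := (i (taft_h hq)).
Local Notation X := (i (taft_x hq)).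

Lemma smash_X_neq0 : X <> 0.
Proof.
case: smE => ci cj [Psi PhiK PsiK] _ _.
have := @factor_X_neq K p q hq gT E i j Psi PhiK PsiK p_gt0 0.
by rewrite scale0r.
Qed.

(** [X] is nonzero and [U g] is invertible, so a scalar can be read off from a multiple of
    [X * U g]; identities between characters are obtained in this way. *)
Lemma smash_XU_inj g a b : a *: (X * U g) = b *: (X * U g) -> a = b.
Proof.
move/(congr1 (fun y => y * U g^-1%g)); rewrite -!scalerAl -!mulrA factor_UV mulr1.
move/eqP; rewrite -subr_eq0 -scalerBl => /eqP E0; apply/eqP; rewrite -subr_eq0.
apply/eqP; apply: contraPeq E0 => nab.
move/(congr1 ( *:%R (a - b)^-1)); rewrite scaler0 scalerA mulVf // scale1r.
exact: smash_X_neq0.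
Qed.

Lemma smash_char1 : s 1%g = 1.
Proof.
case: smE => _ _ _ _ /(_ 1%g) UX; apply: (@smash_XU_inj 1%g).
by rewrite -UX factor_U1 scale1r mul1r mulr1.
Qed.

Lemma smash_charM g g' : s (g * g')%g = s g * s g'.
Proof.
case: smE => _ _ _ _ UX; apply: (@smash_XU_inj (g * g')%g).
rewrite -UX factor_UM -mulrA UX -scalerAr (mulrA (U g) X) UX -scalerAl scalerA.
by rewrite mulrC -mulrA.
Qed.

Lemma smash_act g t : U g * i t = i (taft_scale (s g) t) * U g.
Proof.
case: smE => _ _ _ UH UX.
elim/taft_ind: t => [||k|y z IHy IHz|y z IHy IHz].
- by rewrite taft_scaleh UH.
- by rewrite taft_scalex linearZ UX -scalerAl.
- by rewrite !linearZ /= !rmorph1 -scalerAl -scalerAr mulr1 mul1r.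
- by rewrite !raddfD /= mulrDl mulrDr IHy IHz.
- by rewrite !rmorphM /= mulrA IHy -mulrA IHz mulrA.
Qed.

Lemma smash_mul t g t' g' : i t * U g * (i t' * U g') =
  i (t * taft_scale (s g) t') * U (g * g')%g.
Proof.
by rewrite mulrA -(mulrA (i t)) smash_act factor_UM rmorphM !mulrA.
Qed.

Lemma smash_HX k : X * H ^+ k = q ^+ k *: (H ^+ k * X).
Proof.
by rewrite -rmorphXn -!rmorphM -linearZ; congr (i _); apply: taft_xhX.
Qed.

End One.

Section Iso.
Variables (E E' : hopfAlg K) (i : {lrmorphism T -> E}) (j : {lrmorphism KG -> E}).
Variables (i' : {lrmorphism T -> E'}) (j' : {lrmorphism KG -> E'}).

(** By [smash_mul], the products [i t * U g] multiply by a rule in which only [s] occurs. Composing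
    one multiplication bijection with the inverse of the other therefore respects products, and the
    coproducts agree because the factors are embedded by coalgebra maps. *)
Lemma smash_iso s : smash i j s -> smash i' j' s -> hopf_iso E E'.
Proof.
move=> smE smE'; have [ci cj [Psi PhiK PsiK] _ _] := smE.
have [ci' cj' bij' _ _] := smE'.
pose Phi := factor_mul i j; pose Phi' := factor_mul i' j'.
have bP := bilinear_factor_mul i j; have bP' := bilinear_factor_mul i' j'.
have PhiD : {morph Phi : y z / y + z} := tens_liftD bP.
have Phi'D : {morph Phi' : y z / y + z} := tens_liftD bP'.
have PhiZ k y : Phi (k *: y) = k *: Phi y by apply: (tens_liftZ bP).
have Phi'Z k y : Phi' (k *: y) = k *: Phi' y by apply: (tens_liftZ bP').
have Phi0 : Phi 0 = 0 by apply: tens_lift0.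
have Phi'0 : Phi' 0 = 0 by apply: tens_lift0.
have PhiT t f : Phi (tens t f) = i t * j f by apply: (tens_lift_tens bP).
have Phi'T t f : Phi' (tens t f) = i' t * j' f by apply: (tens_lift_tens bP').
pose F := Phi' \o Psi.
have FPhi y : F (Phi y) = Phi' y by rewrite /F /= PhiK.
have FT t f : F (i t * j f) = i' t * j' f by rewrite -PhiT FPhi Phi'T.
have Flin : linear F.
  move=> k y z; rewrite -(PsiK y) -(PsiK z) -!/(Phi _) -PhiZ -PhiD !FPhi.
  by rewrite Phi'D Phi'Z.
have FD y z : F (y + z) = F y + F z by have := Flin 1 y z; rewrite !scale1r.
have F0 : F 0 = 0 by rewrite -Phi0 FPhi.
have FZ k y : F (k *: y) = k *: F y.
  by have := Flin k y 0; rewrite !addr0 F0 addr0.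
have Fmul : monoid_morphism F.
  split; first by have := FT 1 1; rewrite !rmorph1 !mulr1.
  move=> y z; rewrite -(PsiK y) -(PsiK z) -!/(Phi _).
  elim/tensor_ind: (Psi y) => [|t f|u v IHu IHv].
  - by rewrite Phi0 mul0r F0 mul0r.
  - elim/tensor_ind: (Psi z) => [|t' f'|u v IHu IHv].
    + by rewrite Phi0 mulr0 F0 mulr0.
    + rewrite !PhiT !FT; elim/group_alg_ind: f => [|g|f1 f2 IH1 IH2|k f IHf].
      * by rewrite !raddf0 mulr0 mul0r F0 mulr0 mul0r.
      * elim/group_alg_ind: f' => [|g'|f1 f2 IH1 IH2|k f IHf].
        - by rewrite !raddf0 !mulr0 F0.
        - by rewrite (smash_mul smE) (smash_mul smE') FT.
        - by rewrite !raddfD /= !mulrDr FD IH1 IH2.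
        - by rewrite !linearZ /= -!scalerAr FZ IHf.
      * by rewrite !raddfD /= !(mulrDr, mulrDl) FD IH1 IH2.
      * by rewrite !linearZ /= -!scalerAr -!scalerAl FZ IHf.
    + by rewrite PhiD !(mulrDr, FD) IHu IHv.
  - by rewrite PhiD !(mulrDl, FD) IHu IHv.
pose FL := lrmorphism_of Flin Fmul; exists FL; split; last first.
  by apply: bij_comp bij' _; exists Phi.
split=> y; rewrite -(PsiK y) -/(Phi _).
  elim/tensor_ind: (Psi y) => [|t f|u v IHu IHv].
  - by rewrite Phi0 !linear0 tens_map0.
  - rewrite [FL _]FPhi PhiT Phi'T !comulM ci.1 cj.1 ci'.1 cj'.1.
    have bE := @bilinear_mul K E; have bE' := @bilinear_mul K E'.
    have mapM := @tens_map_mul K E E E' E' _ _ _ _ FL FL bE bE bE' bE'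
      (rmorphM FL) (rmorphM FL).
    have Fi1 t1 : FL (i t1) = i' t1.
      by have := FT t1 1; rewrite !rmorph1 !mulr1.
    have Fj1 f1 : FL (j f1) = j' f1.
      by have := FT 1 f1; rewrite !rmorph1 !mul1r.
    have Fi u : tens_map FL FL (tens_map i i u) = tens_map i' i' u.
      elim/tensor_ind: u => [|t1 t2|u v IHu IHv].
      + by rewrite !tens_map0.
      + by rewrite !tens_mapE; congr (tens _ _); apply: Fi1.
      + by rewrite !tens_mapD IHu IHv.
    have Fj u : tens_map FL FL (tens_map j j u) = tens_map j' j' u.
      elim/tensor_ind: u => [|f1 f2|u v IHu IHv].
      + by rewrite !tens_map0.
      + by rewrite !tens_mapE; congr (tens _ _); apply: Fj1.
      + by rewrite !tens_mapD IHu IHv.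
    by rewrite [RHS]mapM Fi Fj.
  - by rewrite PhiD !linearD tens_mapD IHu IHv.
rewrite [FL _]FPhi; elim/tensor_ind: (Psi y) => [|t f|u v IHu IHv].
- by rewrite Phi0 Phi'0 !linear0.
- by rewrite PhiT Phi'T !counitM ci.2 cj.2 ci'.2 cj'.2.
- by rewrite PhiD Phi'D !linearD /= IHu IHv.
Qed.

(** Turns an isomorphism between two factorizing Hopf algebras into two factorizations of a single
    one, the setting of [smash_compare]. *)
Lemma smash_transport s (f : {lrmorphism E -> E'}) : coalg_map f -> bijective f ->
  smash i j s -> smash (f \o i) (f \o j) s.
Proof.
move=> cf bf [ci cj bij UH UX]; split; try exact: coalg_map_comp.
- suff E0 : f \o factor_mul i j =1 factor_mul (f \o i) (f \o j).
    exact: eq_bij (bij_comp bf bij) _ E0.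
  have bP := bilinear_factor_mul i j.
  have bP' := bilinear_factor_mul (f \o i) (f \o j).
  elim/tensor_ind=> [|t g|u v]; rewrite /= /factor_mul.
  + by rewrite !tens_lift0 // raddf0.
  + by rewrite !tens_lift_tens // rmorphM.
  + by rewrite !tens_liftD // raddfD /= => -> ->.
- by move=> g; rewrite /= -!rmorphM UH.
- by move=> g; rewrite /= -!rmorphM UX [LHS]linearZ.
Qed.

End Iso.

Section Compare.
Variables (E : hopfAlg K) (i i' : {lrmorphism T -> E}) (j j' : {lrmorphism KG -> E}).
Variables s s' : gT -> K.
Hypotheses (smE : smash i j s) (smE' : smash i' j' s').

(** By rigidity both factorizations have the same [H], and their [X] are proportional. Each [j g] is
    grouplike, hence of the form [H^k(g) j'(phi g)]; comparing how both sides move past [X] relates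
    [s] and [s']. *)
Lemma smash_compare : exists (phi : gT -> gT) (k : gT -> nat),
  [/\ injective phi, {morph phi : g g' / (g * g')%g} &
      forall g, s' (phi g) = s g * q ^+ k g].
Proof.
have [ci cj [Psi PhiK PsiK] UH UX] := smE.
have [ci' cj' [Psi' PhiK' PsiK'] UH' UX'] := smE'.
have [] := @factor_rigid K p q hq gT E i' j' ci' cj' Psi' PhiK' PsiK' p_gt0
  (i (taft_h hq)) (i (taft_x hq)).
- exact: factor_comulH.
- exact: factor_counitH.
- exact: factor_comulX.
- exact: factor_XH.
- exact: (@factor_X_neq K p q hq gT E i j Psi PhiK PsiK).
move=> EH [a a0 EX].
have kphi g : exists rg : 'I_m * gT,
    j (gelt K g) = i' (taft_h hq) ^+ rg.1 * j' (gelt K rg.2).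
  have [] := @factor_grouplike K p q hq gT E i' j' ci' cj' Psi' PhiK' PsiK'
    (j (gelt K g)).
  - exact: factor_comulU.
  - exact: factor_counitU.
  by move=> r [g' ->]; exists (r, g').
have [f Ef] := fin_all_exists kphi.
have HU_inj := @factor_HU_inj K p q hq gT E i' j' Psi' PhiK'.
have HUX r g : i' (taft_h hq) ^+ r * j' (gelt K g) =
    j' (gelt K g) * i' (taft_h hq) ^+ r.
  by apply/esym/commrX/UH'.
have H1 : i' (taft_h hq) ^+ m = 1.
  by rewrite -rmorphXn -(rmorph1 i'); congr (i' _); apply: taft_hmE.
exists (fun g => (f g).2), (fun g => (f g).1); split.
- move=> g g' Egg'; have := Ef (g * g'^-1)%g.
  have Eg := Ef g; have Eg' := Ef g'; rewrite Egg' in Eg.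
  (* As [p = m - 1], the power [H ^+ (p * k)] is the inverse of [H ^+ k]. If [phi g = phi g'], then
     [g g'^-1] becomes a power of [H], and is 1 by uniqueness in the first factorization. *)
  pose r := ((f g).1 + p * (f g').1)%N.
  have EU : j (gelt K (g * g'^-1)%g) = i (taft_h hq) ^+ r.
    rewrite factor_UM Eg -[RHS]mulr1 -(factor_UV j g') [RHS]mulrA; congr (_ * _).
    rewrite Eg' mulrA EH -exprD /r -addnA -mulSnr mulnC exprD.
    by rewrite mulnC [_ ^+ (m * _)]exprM H1 expr1n mulr1.
  have := @factor_HU_inj K p q hq gT E i j Psi PhiK 0 (g * g'^-1)%g r 1%g.
  rewrite expr0 mul1r factor_U1 mulr1 EU => -[//|_ /eqP].
  by rewrite -eq_mulgV1 => /eqP.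
- move=> g g' /=; have := Ef (g * g')%g; rewrite factor_UM !Ef -mulrA.
  rewrite (mulrA (j' _)) -HUX -mulrA -factor_UM mulrA -exprD.
  by case/HU_inj=> _ ->.
- move=> g; have [r gr] : {r | r = f g} by exists (f g).
  rewrite -gr; have := UX g; rewrite EX Ef -gr -scalerAr -mulrA UX' -scalerAr.
  rewrite -scalerAl !scalerA (mulrA (i' _)) (smash_HX i') -scalerAl scalerA -mulrA.
  move/(congr1 ( *%R (i' (taft_h hq) ^+ (p * r.1)))); rewrite -!scalerAr.
  rewrite !mulrA -exprD -mulSnr [_ ^+ (m * _)]exprM H1 expr1n mul1r.
  by move/(smash_XU_inj smE'); rewrite mulrAC mulrC => /(mulIf a0).
Qed.
End Compare.

End SmashFactorization.

(** * Replacing the copy of the group in a factorization *)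

Section Twist.
Variables (K : fieldType) (p : nat) (q : K).
Local Notation m := p.+1.
Variables (hq : m.-primitive_root q) (gT : finGroupType).
Local Notation T := (taft hq).
Local Notation KG := (group_hopf K gT).
Local Notation h := (taft_h hq : taft hq).

(** Describes the new multiplication map on the tensor product: it is the old one after [twist], so
    its bijectivity reduces to that of [twist]. *)
Definition twist_fun (phi : gT -> gT) (k : gT -> nat) (t : T) (f : KG) :
    tensor T KG :=
  gext (fun g => tens (t * h ^+ k g) (gelt K (phi g) : KG)) f.

Lemma bilinear_twist phi k : bilinear_map (twist_fun phi k).
Proof.
apply: bilinear_mapI => [t t' f|t f f'|a t f|a t f]; rewrite /twist_fun.
- rewrite /gext -big_split; apply: eq_bigr => g _ /=.
  by rewrite mulrDl tensDl scalerDr.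
- exact: linearD.
- rewrite /gext scaler_sumr; apply: eq_bigr => g _ /=.
  by rewrite -scalerAl tensZl !scalerA mulrC.
- exact: linearZ.
Qed.

Definition twist phi k : tensor T KG -> tensor T KG := tens_lift (twist_fun phi k).

Lemma twistE phi k t g :
  twist phi k (tens t (gelt K g : KG)) =
  tens (t * h ^+ k g) (gelt K (phi g) : KG).
Proof. by rewrite /twist (tens_lift_tens (bilinear_twist _ _)) /twist_fun gextE. Qed.

Lemma tensor_group_ind (P : tensor T KG -> Prop) :
    P 0 -> (forall t g, P (tens t (gelt K g : KG))) ->
    (forall y z, P y -> P z -> P (y + z)) ->
    (forall a y, P y -> P (a *: y)) ->
  forall y, P y.
Proof.
move=> P0 Pt PD PZ; elim/tensor_ind => // t f.
elim/group_alg_ind: f => [|g|f f' IHf IHf'|a f IHf] //.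
- by rewrite (bil0r (bilinear_tens _ _)).
- by rewrite tensDr; apply: PD.
- by rewrite tensZr; apply: PZ.
Qed.

Lemma twistK phi psi k l : cancel phi psi ->
    (forall g, h ^+ k g * h ^+ l (phi g) = 1) ->
  cancel (twist phi k) (twist psi l).
Proof.
move=> phiK kl; have b1 := bilinear_twist phi k; have b2 := bilinear_twist psi l.
elim/tensor_group_ind => [|t g|y z IHy IHz|a y IHy].
- by rewrite [twist phi k 0](tens_lift0 b1) [twist _ _ _](tens_lift0 b2).
- by rewrite !twistE -mulrA kl phiK mulr1.
- rewrite [twist phi k _](tens_liftD b1) [twist psi l _](tens_liftD b2).
  by congr (_ + _).
- rewrite [twist phi k _](tens_liftZ b1) [twist psi l _](tens_liftZ b2).
  by congr (_ *: _).
Qed.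

Variables (E : hopfAlg K) (i : {lrmorphism T -> E}) (j : {lrmorphism KG -> E}).
Variables (s s2 : gT -> K) (phi psi : gT -> gT) (k : gT -> nat).
Hypothesis smE : smash_factorization i j s.
Hypotheses (phiK : cancel phi psi) (psiK : cancel psi phi).
Hypothesis phiM : {morph phi : g g' / (g * g')%g}.
Hypothesis kM : forall g g', k (g * g')%g = (k g + k g')%N %[mod m].
Hypothesis s2E : forall g, s2 g * q ^+ k g = s (phi g).
Local Notation U g := (j (gelt K g)).
Local Notation H := (i (taft_h hq)).

(* The new copy of [gT] consists of the grouplike elements [H ^ k(g) phi(g)]:
   [k] absorbs the part of the character that conjugation by [H] realizes. *)
Lemma smash_twist : exists j2 : {lrmorphism KG -> E}, smash_factorization i j2 s2.
Proof.
have [ci cj [Psi PhiK PsiK] UH UX] := smE.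
have UHk r g : U g * H ^+ r = H ^+ r * U g by apply/commrX/UH.
pose F : KG -> E := gext (fun g => H ^+ k g * U (phi g)).
have Fg g : F (gelt K g) = H ^+ k g * U (phi g) by apply: gextE.
have F_lin : linear F by apply: gext_linear.
have FD y z : F (y + z) = F y + F z by apply: linearD.
have FZ a y : F (a *: y) = a *: F y by apply: linearZ.
have F0 : F 0 = 0 by apply: linear0.
(* [kM] at the pair [(1, 1)] gives [k 1 = 0] modulo [m]. *)
have k1 : H ^+ k 1%g = 1.
  have /eqP := kM 1 1; rewrite mulg1 -{1}[k 1%g]addn0 eqn_modDl => /eqP k1.
  by rewrite -factor_Hmod -k1 mod0n.
have phi1 : phi 1%g = 1%g by apply: (mulgI (phi 1%g)); rewrite -phiM !mulg1.
have F_mul : monoid_morphism F.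
  split; first by rewrite [LHS](Fg 1%g) k1 phi1 factor_U1 mulr1.
  move=> y z; elim/group_alg_ind: y => [|g|y y' IHy IHy'|a y IHy].
  - by rewrite mul0r F0 mul0r.
  - elim/group_alg_ind: z => [|g'|z z' IHz IHz'|a z IHz].
    + by rewrite mulr0 F0 mulr0.
    + rewrite -geltM !Fg phiM factor_UM -factor_Hmod kM factor_Hmod exprD.
      by rewrite -!mulrA; congr (_ * _); rewrite !mulrA UHk.
    + by rewrite mulrDr !FD IHz IHz' mulrDr.
    + by rewrite -scalerAr !FZ IHz scalerAr.
  - by rewrite mulrDl !FD IHy IHy' mulrDl.
  - by rewrite -scalerAl !FZ IHy scalerAl.
pose j2 := lrmorphism_of F_lin F_mul.
have j2g g : j2 (gelt K g) = H ^+ k g * U (phi g) by apply: Fg.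
have DH r : comul E (H ^+ r) = tens (H ^+ r) (H ^+ r).
  elim: r => [|r IHr]; first by rewrite comul1.
  by rewrite !exprS comulM IHr factor_comulH // tensM.
have eH r : counit E (H ^+ r) = 1.
  elim: r => [|r IHr]; first by rewrite counit1.
  by rewrite !exprS counitM IHr factor_counitH // mulr1.
exists j2; split=> //.
- split=> f; elim/group_alg_ind: f => [|g|f f' IHf IHf'|a f IHf].
  + by rewrite !linear0 tens_map0.
  + rewrite [RHS](_ : _ = tens (j2 (gelt K g)) (j2 (gelt K g))).
      by rewrite j2g comulM DH factor_comulU // tensM.
    by rewrite [comul KG _]group_comulE tens_mapE.
  + by rewrite !linearD tens_mapD IHf IHf'.
  + by rewrite !linearZ /= tens_mapZ IHf.
  + by rewrite !linear0.
  + by rewrite j2g counitM eH factor_counitU // [RHS]group_counitE mulr1.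
  + by rewrite !linearD IHf IHf'.
  + by rewrite !linearZ /= IHf.
- pose l g := (p * k (psi g))%N.
  have hpk r : h ^+ r * h ^+ (p * r) = 1.
    by rewrite -exprD -mulSn exprM [h ^+ m]taft_hmE expr1n.
  have tw : bijective (twist phi k).
    exists (twist psi l); apply: twistK => // g; first by rewrite /l phiK.
    rewrite /l -!exprD addnC exprD; exact: hpk.
  apply: (eq_bij (bij_comp (Bijective PhiK PsiK) tw)) => y /=.
  have b0 := bilinear_factor_mul i j; have b1 := bilinear_twist phi k.
  have b2 := bilinear_factor_mul i j2; rewrite /factor_mul.
  elim/tensor_group_ind: y => [|t g|y z IHy IHz|a y IHy].
  + by rewrite [twist phi k 0](tens_lift0 b1) !tens_lift0.
  + rewrite twistE [RHS](_ : _ = i t * (H ^+ k g * U (phi g))).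
      by rewrite (tens_lift_tens b0) rmorphM rmorphXn mulrA.
    by rewrite -j2g; apply: (tens_lift_tens b2).
  + by rewrite [twist phi k _](tens_liftD b1) !tens_liftD // IHy IHz.
  + by rewrite [twist phi k _](tens_liftZ b1) !tens_liftZ // IHy.
- by move=> g; rewrite j2g -mulrA UH !mulrA -exprS -exprSr.
- move=> g; rewrite j2g -mulrA UX -s2E [X in _ = _ *: X]mulrA smash_HX -scalerAr.
  by rewrite -scalerAl scalerA mulrA.
Qed.

End Twist.

(** * Skew group Hopf algebras *)

Definition hopf_action (K : fieldType) (A : hopfAlg K) (gT : finGroupType)
    (tau : gT -> {lrmorphism A -> A}) : Prop :=
  [/\ forall a, tau 1%g a = a,
      forall g g' a, tau (g * g')%g a = tau g (tau g' a) &
      forall g, coalg_map (tau g)].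

(* The proof that [tau] is an action is a parameter of the type, since the
   ring structure depends on it. *)
Definition skew_alg (K : fieldType) (A : hopfAlg K) (gT : finGroupType)
  (tau : gT -> {lrmorphism A -> A}) of hopf_action tau : Type := {ffun gT -> A}.

Section TensorMapLinear.
Variables (K : fieldType) (V W V' W' : lmodType K).
Variables (f : {linear V -> V'}) (g : {linear W -> W'}).
Fact tens_map_linear : linear (tens_map f g).
Proof. by move=> k x y; rewrite tens_mapD tens_mapZ. Qed.
HB.instance Definition _ := GRing.isLinear.Build K (tensor V W) (tensor V' W') *:%R
  (tens_map f g) tens_map_linear.
End TensorMapLinear.

Lemma tens_assoc_map (K : fieldType) (U V W U' V' W' : lmodType K)
    (f : {linear U -> U'}) (g : {linear V -> V'}) (k : {linear W -> W'}) u :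
  tens_assoc (tens_map (tens_map f g) k u) =
  tens_map f (tens_map g k) (tens_assoc u).
Proof.
elim/tensor_ind: u => [|x w|x y IHx IHy].
- by rewrite tens_map0 !tens_assoc0 tens_map0.
- rewrite tens_mapE /=; elim/tensor_ind: x => [|x y|x y IHx IHy].
  + by rewrite tens_map0 !(bil0l (bilinear_tens _ _)) !tens_assoc0 tens_map0.
  + by rewrite tens_mapE !tens_assocE tens_mapE /= tens_mapE.
  + by rewrite tens_mapD !tensDl !tens_assocD tens_mapD IHx IHy.
- by rewrite tens_mapD !tens_assocD tens_mapD IHx IHy.
Qed.

Section SkewGroupAlgebra.
Variables (K : fieldType) (A : hopfAlg K) (gT : finGroupType).
Variables (tau : gT -> {lrmorphism A -> A}) (tauP : hopf_action tau).
Local Notation S := (skew_alg tauP).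

HB.instance Definition _ := GRing.Lmodule.on S.

Let tau1 a : tau 1%g a = a. Proof. by case: tauP. Qed.
Let tauM g g' a : tau (g * g')%g a = tau g (tau g' a). Proof. by case: tauP. Qed.

(** Stands for the product [t g], with the coefficient on the left of the group element. *)
Definition sk (g : gT) (t : A) : S := [ffun x => if x == g then t else 0].

Fact sk_linear g : linear (sk g).
Proof.
move=> k t t'; apply/ffunP => x; rewrite !ffunE; case: (x == g) => //.
by rewrite scaler0 addr0.
Qed.
HB.instance Definition _ g := GRing.isLinear.Build K A S *:%R (sk g) (sk_linear g).

Lemma skewE (f : S) : f = \sum_g sk g ((f : {ffun gT -> A}) g).
Proof.
apply/ffunP => x; rewrite sum_ffunE (bigD1 x) //= ffunE eqxx big1 ?addr0 //.
by move=> g /negPf ng; rewrite ffunE eq_sym ng.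
Qed.

Lemma skew_ind (P : S -> Prop) :
    P 0 -> (forall g t, P (sk g t)) -> (forall x y, P x -> P y -> P (x + y)) ->
  forall x, P x.
Proof. by move=> P0 Pg PD x; rewrite [x]skewE; elim/big_ind: _. Qed.

Definition skew_mul (f1 f2 : {ffun gT -> A}) : S :=
  [ffun x => \sum_g f1 g * tau g (f2 (g^-1 * x)%g)].

Lemma bilinear_skew_mul : bilinear_map (skew_mul : S -> S -> S).
Proof.
apply: bilinear_mapI => [x x' y|x y y'|k x y|k x y]; apply/ffunP => u;
  rewrite !ffunE.
- by rewrite -big_split; apply: eq_bigr => g _; rewrite !ffunE mulrDl.
- by rewrite -big_split; apply: eq_bigr => g _; rewrite !ffunE raddfD mulrDr.
- by rewrite scaler_sumr; apply: eq_bigr => g _; rewrite !ffunE scalerAl.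
- by rewrite scaler_sumr; apply: eq_bigr => g _; rewrite !ffunE linearZ scalerAr.
Qed.

Let bm := bilinear_skew_mul.

Lemma skew_mulE g t g' t' :
  skew_mul (sk g t) (sk g' t') = sk (g * g')%g (t * tau g t').
Proof.
apply/ffunP => x; rewrite !ffunE (bigD1 g) //= !ffunE eqxx.
rewrite big1 => [|g1 /negPf ng]; last by rewrite ffunE ng mul0r.
rewrite addr0 -(inj_eq (mulgI g)) mulKVg; case: (x == _) => //.
by rewrite raddf0 mulr0.
Qed.

Fact skew_mulA : associative (skew_mul : S -> S -> S).
Proof.
move=> x y z; elim/skew_ind: x => [|g t|x x' IHx IHx'].
- by rewrite !(bil0l bm).
- elim/skew_ind: y => [|g' t'|y y' IHy IHy'].
  + by rewrite !(bil0l bm, bil0r bm).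
  + elim/skew_ind: z => [|g'' t''|z z' IHz IHz'].
    * by rewrite !(bil0l bm, bil0r bm).
    * by rewrite !skew_mulE mulgA rmorphM mulrA tauM.
    * by rewrite !(bilDr bm) IHz IHz'.
  + by rewrite (bilDl bm) !(bilDr bm) (bilDl bm) IHy IHy'.
- by rewrite !(bilDl bm) IHx IHx'.
Qed.
Fact skew_mul1 : left_id (sk 1%g 1) (skew_mul : S -> S -> S).
Proof.
elim/skew_ind=> [|g t|x y IHx IHy].
- by rewrite (bil0r bm).
- by rewrite skew_mulE mul1g mul1r tau1.
- by rewrite (bilDr bm) IHx IHy.
Qed.
Fact skew_mulr1 : right_id (sk 1%g 1) (skew_mul : S -> S -> S).
Proof.
elim/skew_ind=> [|g t|x y IHx IHy].
- by rewrite (bil0l bm).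
- by rewrite skew_mulE mulg1 rmorph1 mulr1.
- by rewrite (bilDl bm) IHx IHy.
Qed.
Fact skew_mulDl : left_distributive (skew_mul : S -> S -> S) +%R.
Proof. by move=> x y z; rewrite (bilDl bm). Qed.
Fact skew_mulDr : right_distributive (skew_mul : S -> S -> S) +%R.
Proof. by move=> x y z; rewrite (bilDr bm). Qed.
Fact skew_nonzero : sk 1%g 1 != 0.
Proof.
apply/eqP => /ffunP/(_ 1%g); rewrite !ffunE eqxx.
by apply/eqP; apply: oner_neq0.
Qed.

HB.instance Definition _ := GRing.Zmodule_isNzRing.Build S skew_mulA
  skew_mul1 skew_mulr1 skew_mulDl skew_mulDr skew_nonzero.

Fact skew_scaleAl (k : K) (x y : S) : k *: (x * y) = (k *: x) * y.
Proof. by symmetry; apply: bilZl bm k x y. Qed.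
HB.instance Definition _ := GRing.Lmodule_isLalgebra.Build K S skew_scaleAl.
Fact skew_scaleAr (k : K) (x y : S) : k *: (x * y) = x * (k *: y).
Proof. by symmetry; apply: bilZr bm k x y. Qed.
HB.instance Definition _ := GRing.Lalgebra_isAlgebra.Build K S skew_scaleAr.

Lemma skM g t g' t' : sk g t * sk g' t' = sk (g * g')%g (t * tau g t').
Proof. exact: skew_mulE. Qed.
Lemma sk1 : sk 1%g 1 = 1. Proof. by []. Qed.

Section Extend.
Variables (U : lmodType K) (u : gT -> {linear A -> U}).
Definition skext (f : S) : U := \sum_g u g ((f : {ffun gT -> A}) g).

Lemma skext_linear : linear skext.
Proof.
move=> k x y; rewrite scaler_sumr -big_split; apply: eq_bigr => g _ /=.
by rewrite !ffunE linearP.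
Qed.
Lemma skextE g t : skext (sk g t) = u g t.
Proof.
rewrite /skext (bigD1 g) //= ffunE eqxx big1 ?addr0 // => g' /negPf ng.
by rewrite ffunE ng raddf0.
Qed.
HB.instance Definition _ := GRing.isLinear.Build K S U *:%R skext skext_linear.
End Extend.

Definition skew_comul_at g (t : A) : tensor S S :=
  tens_map (sk g) (sk g) (comul A t).
Fact skew_comul_at_linear g : linear (skew_comul_at g).
Proof.
by move=> k t t'; rewrite /skew_comul_at linearP tens_mapD tens_mapZ.
Qed.
HB.instance Definition _ g := GRing.isLinear.Build K A (tensor S S) *:%R
  (skew_comul_at g) (skew_comul_at_linear g).

(** The antipode reverses products: [t g] goes to [g^-1 S(t)], rewritten with the coefficient on the
    left. *)
Definition skew_antipode_at g (t : A) : S := sk g^-1%g (tau g^-1%g (antipode A t)).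
Fact skew_antipode_at_linear g : linear (skew_antipode_at g).
Proof. by move=> k t t'; rewrite /skew_antipode_at !linearP. Qed.
HB.instance Definition _ g := GRing.isLinear.Build K A S *:%R
  (skew_antipode_at g) (skew_antipode_at_linear g).

Definition skew_comul : {linear S -> tensor S S} :=
  skext (fun g => skew_comul_at g).
Definition skew_counit : {linear S -> K^o} := skext (fun _ => counit A).
Definition skew_antipode : {linear S -> S} :=
  skext (fun g => skew_antipode_at g).

Local Notation D := skew_comul.
Local Notation e := skew_counit.
Local Notation a := skew_antipode.

Lemma skew_comulE g t : D (sk g t) = tens_map (sk g) (sk g) (comul A t).
Proof. exact: skextE. Qed.
Lemma skew_counitE g t : e (sk g t) = counit A t.
Proof. exact: skextE. Qed.
Lemma skew_antipodeE g t : a (sk g t) = sk g^-1%g (tau g^-1%g (antipode A t)).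
Proof. exact: skextE. Qed.

Fact skew_comulA y :
  tens_assoc (tens_map D idfun (D y)) = tens_map idfun D (D y).
Proof.
elim/skew_ind: y => [|g t|y z IHy IHz].
- by rewrite linear0 !tens_map0 tens_assoc0.
- have E1 u : tens_map D idfun (tens_map (sk g) (sk g) u) =
      tens_map (tens_map (sk g) (sk g)) (sk g) (tens_map (comul A) idfun u).
    elim/tensor_ind: u => [|t1 t2|u v IHu IHv].
    + by rewrite !tens_map0.
    + by rewrite !tens_mapE skew_comulE.
    + by rewrite !tens_mapD IHu IHv.
  have E2 u : tens_map idfun D (tens_map (sk g) (sk g) u) =
      tens_map (sk g) (tens_map (sk g) (sk g)) (tens_map idfun (comul A) u).
    elim/tensor_ind: u => [|t1 t2|u v IHu IHv].
    + by rewrite !tens_map0.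
    + by rewrite !tens_mapE skew_comulE.
    + by rewrite !tens_mapD IHu IHv.
  by rewrite skew_comulE E1 E2 tens_assoc_map comulA.
- by rewrite linearD !tens_mapD tens_assocD IHy IHz.
Qed.

Fact skew_counitl y : tens_lift (fun u v => e u *: v) (D y) = y.
Proof.
have b := bilinear_counitl e; have b' := bilinear_counitl (counit A).
elim/skew_ind: y => [|g t|y z IHy IHz].
- by rewrite linear0 tens_lift0.
- rewrite skew_comulE -{2}[t]counitl; elim/tensor_ind: (comul A t) => [|t1 t2|u v].
  + by rewrite tens_map0 !tens_lift0 // linear0.
  + by rewrite tens_mapE !tens_lift_tens // skew_counitE linearZ.
  + by rewrite tens_mapD !tens_liftD // linearD => -> ->.
- by rewrite linearD tens_liftD // IHy IHz.
Qed.
Fact skew_counitr y : tens_lift (fun u v => e v *: u) (D y) = y.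
Proof.
have b := bilinear_counitr e; have b' := bilinear_counitr (counit A).
elim/skew_ind: y => [|g t|y z IHy IHz].
- by rewrite linear0 tens_lift0.
- rewrite skew_comulE -{2}[t]counitr; elim/tensor_ind: (comul A t) => [|t1 t2|u v].
  + by rewrite tens_map0 !tens_lift0 // linear0.
  + by rewrite tens_mapE !tens_lift_tens // skew_counitE linearZ.
  + by rewrite tens_mapD !tens_liftD // linearD => -> ->.
- by rewrite linearD tens_liftD // IHy IHz.
Qed.
Fact skew_comul1 : D 1 = 1.
Proof. by rewrite -sk1 skew_comulE comul1 tens_mapE. Qed.
Fact skew_comulM : {morph D : x y / x * y}.
Proof.
move=> x y; elim/skew_ind: x => [|g t|x x' IHx IHx'].
- by rewrite mul0r linear0 mul0r.
- elim/skew_ind: y => [|g' t'|y y' IHy IHy'].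
  + by rewrite mulr0 linear0 mulr0.
  + have [_ _ /(_ g)[ctau _]] := tauP.
    rewrite skM !skew_comulE comulM ctau.
    elim/tensor_ind: (comul A t) => [|t1 t2|u v IHu IHv].
    * by rewrite mul0r !tens_map0 mul0r.
    * elim/tensor_ind: (comul A t') => [|t1' t2'|u v IHu IHv].
      - by rewrite tens_map0 mulr0 !tens_map0 mulr0.
      - by rewrite !(tens_mapE, tensM) !skM.
      - by rewrite tens_mapD mulrDr !tens_mapD mulrDr IHu IHv.
    * by rewrite mulrDl !tens_mapD mulrDl IHu IHv.
  + by rewrite mulrDr !linearD /= mulrDr IHy IHy'.
- by rewrite mulrDl !linearD /= mulrDl IHx IHx'.
Qed.
Fact skew_counit1 : e 1 = 1.
Proof. by rewrite -sk1 skew_counitE counit1. Qed.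
Fact skew_counitM : {morph e : x y / x * y}.
Proof.
move=> x y; elim/skew_ind: x => [|g t|x x' IHx IHx'].
- by rewrite mul0r linear0 mul0r.
- elim/skew_ind: y => [|g' t'|y y' IHy IHy'].
  + by rewrite mulr0 linear0 mulr0.
  + by have [_ _ /(_ g)[_ ec]] := tauP; rewrite skM !skew_counitE counitM ec.
  + by rewrite mulrDr !linearD /= mulrDr IHy IHy'.
- by rewrite mulrDl !linearD /= mulrDl IHx IHx'.
Qed.
Fact skew_antipodel y : tens_lift (fun u v => a u * v) (D y) = e y *: 1.
Proof.
have b := bilinear_antipodel a; have b' := bilinear_antipodel (antipode A).
elim/skew_ind: y => [|g t|y z IHy IHz].
- by rewrite !linear0 tens_lift0 // scale0r.
- rewrite skew_comulE skew_counitE.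
  (* The scalar is moved inside [tau g^-1], which fixes 1, so that the antipode axiom of [A] can be
     substituted for it. *)
  have -> : counit A t *: 1 = sk 1%g (tau g^-1%g (counit A t *: 1)).
    by rewrite linearZ rmorph1 linearZ /= sk1.
  rewrite -antipodel; elim/tensor_ind: (comul A t) => [|t1 t2|u v].
  + by rewrite tens_map0 !tens_lift0 // !raddf0.
  + by rewrite tens_mapE !tens_lift_tens // skew_antipodeE skM mulVg rmorphM.
  + by rewrite tens_mapD !tens_liftD // !raddfD => -> ->.
- by rewrite !linearD tens_liftD // IHy IHz scalerDl.
Qed.
Fact skew_antipoder y : tens_lift (fun u v => u * a v) (D y) = e y *: 1.
Proof.
have b := bilinear_antipoder a; have b' := bilinear_antipoder (antipode A).
elim/skew_ind: y => [|g t|y z IHy IHz].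
- by rewrite !linear0 tens_lift0 // scale0r.
- rewrite skew_comulE skew_counitE -sk1 -linearZ /= -antipoder.
  elim/tensor_ind: (comul A t) => [|t1 t2|u v].
  + by rewrite tens_map0 !tens_lift0 // !raddf0.
  + rewrite tens_mapE !tens_lift_tens // skew_antipodeE skM mulgV.
    by rewrite -tauM mulgV tau1.
  + by rewrite tens_mapD !tens_liftD // !raddfD => -> ->.
- by rewrite !linearD tens_liftD // IHy IHz scalerDl.
Qed.

Definition skew_hopf : hopfAlg K :=
  @HopfAlg K S skew_comul skew_counit skew_antipode skew_comulA
    skew_counitl skew_counitr skew_comul1 skew_comulM skew_counit1
    skew_counitM skew_antipodel skew_antipoder.

Definition skew_inl : A -> skew_hopf := sk 1%g.
Definition skew_inr : group_hopf K gT -> skew_hopf :=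
  gext (fun g => sk g 1 : skew_hopf).

Lemma skew_inr_gelt g : skew_inr (gelt K g) = sk g 1.
Proof. exact: gextE. Qed.

Fact skew_inl_linear : linear skew_inl. Proof. exact: sk_linear. Qed.
Fact skew_inl_monoid_morphism : monoid_morphism skew_inl.
Proof. by split=> // t t'; rewrite /skew_inl [RHS]skM mulg1 tau1. Qed.
HB.instance Definition _ :=
  GRing.isLinear.Build K A skew_hopf *:%R skew_inl skew_inl_linear.
HB.instance Definition _ :=
  GRing.isMonoidMorphism.Build A skew_hopf skew_inl skew_inl_monoid_morphism.

Fact skew_inr_linear : linear skew_inr. Proof. exact: gext_linear. Qed.
HB.instance Definition _ := GRing.isLinear.Build K (group_hopf K gT) skew_hopf
  *:%R skew_inr skew_inr_linear.
Fact skew_inr_monoid_morphism : monoid_morphism skew_inr.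
Proof.
split=> [|x y]; first exact: skew_inr_gelt.
elim/group_alg_ind: x => [|g|x x' IHx IHx'|k x IHx].
- by rewrite mul0r linear0 mul0r.
- elim/group_alg_ind: y => [|g'|y y' IHy IHy'|k y IHy].
  + by rewrite mulr0 linear0 mulr0.
  + by rewrite -geltM !skew_inr_gelt [RHS]skM rmorph1 mulr1.
  + by rewrite mulrDr !linearD /= mulrDr IHy IHy'.
  + by rewrite -scalerAr !linearZ /= IHy scalerAr.
- by rewrite mulrDl !linearD /= mulrDl IHx IHx'.
- by rewrite -scalerAl !linearZ /= IHx scalerAl.
Qed.
HB.instance Definition _ := GRing.isMonoidMorphism.Build (group_hopf K gT)
  skew_hopf skew_inr skew_inr_monoid_morphism.

Lemma skew_inl_coalg_map : coalg_map skew_inl.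
Proof. by split=> t; [apply: skew_comulE|apply: skew_counitE]. Qed.

Lemma skew_inr_coalg_map : coalg_map skew_inr.
Proof.
split=> f; elim/group_alg_ind: f => [|g|f f' IHf IHf'|k f IHf].
- by rewrite !linear0.
- rewrite [comul (group_hopf _ _) _]group_comulE tens_mapE /= skew_inr_gelt.
  by rewrite [LHS]skew_comulE comul1 tens_mapE.
- by rewrite !linearD ?tens_mapD IHf IHf'.
- by rewrite !linearZ /= ?tens_mapZ IHf.
- by rewrite !linear0.
- by rewrite skew_inr_gelt [LHS]skew_counitE counit1 [RHS]group_counitE.
- by rewrite !linearD IHf IHf'.
- by rewrite !linearZ /= IHf.
Qed.

Lemma skew_inl_inj : injective skew_inl.
Proof. by move=> t t' /ffunP/(_ 1%g); rewrite !ffunE eqxx. Qed.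

Lemma skew_inr_inj : injective skew_inr.
Proof.
have inrE f g : (skew_inr f : {ffun gT -> A}) g = (f : {ffun gT -> K^o}) g *: 1.
  rewrite /skew_inr /gext sum_ffunE (bigD1 g) //= !ffunE eqxx big1 ?addr0 //.
  by move=> g' /negPf ng; rewrite !ffunE eq_sym ng scaler0.
move=> f f' /ffunP Ef; apply/ffunP => g; move: (Ef g); rewrite !inrE.
by move/(congr1 (counit A)); rewrite !linearZ /= counit1 ![_ *: 1]mulr1.
Qed.

Lemma skew_act g t :
  skew_inr (gelt K g) * skew_inl t = skew_inl (tau g t) * skew_inr (gelt K g).
Proof.
by rewrite skew_inr_gelt [LHS]skM [RHS]skM mulg1 !mul1g rmorph1 mul1r mulr1.
Qed.

Lemma skew_factor_bij : bijective (factor_mul skew_inl skew_inr).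
Proof.
have b := bilinear_factor_mul skew_inl skew_inr.
pose Psi (f : skew_hopf) : tensor A (group_hopf K gT) :=
  \sum_g tens ((f : {ffun gT -> A}) g) (gelt K g).
have E1 t g : factor_mul skew_inl skew_inr (tens t (gelt K g)) = sk g t.
  have -> : factor_mul skew_inl skew_inr (tens t (gelt K g)) = sk 1%g t * sk g 1.
    by rewrite -skew_inr_gelt; apply: (tens_lift_tens b).
  by rewrite skM mul1g rmorph1 mulr1.
have PsiD x y : Psi (x + y) = Psi x + Psi y.
  by rewrite /Psi -big_split; apply: eq_bigr => g _; rewrite ffunE tensDl.
have Psi0 : Psi 0 = 0.
  by rewrite /Psi big1 // => g _; rewrite ffunE (bil0l (bilinear_tens _ _)).
have PsiZ k x : Psi (k *: x) = k *: Psi x.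
  by rewrite /Psi scaler_sumr; apply: eq_bigr => g _; rewrite ffunE tensZl.
have Psik g t : Psi (sk g t) = tens t (gelt K g).
  rewrite /Psi (bigD1 g) //= ffunE eqxx big1 ?addr0 // => g' /negPf ng.
  by rewrite ffunE ng (bil0l (bilinear_tens _ _)).
exists Psi => [u|f].
  elim/tensor_ind: u => [|t f|u v].
  - by rewrite [factor_mul _ _ _](tens_lift0 b).
  - elim/group_alg_ind: f => [|g|f f' IHf IHf'|k f IHf].
    + by rewrite (bil0r (bilinear_tens _ _)) [factor_mul _ _ _](tens_lift0 b).
    + by rewrite E1 Psik.
    + by rewrite tensDr [factor_mul _ _ _](tens_liftD b) PsiD; congr (_ + _).
    + by rewrite tensZr [factor_mul _ _ _](tens_liftZ b) PsiZ; congr (_ *: _).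
  - by move=> IHu IHv; rewrite [factor_mul _ _ _](tens_liftD b) PsiD; congr (_ + _).
elim/skew_ind: f => [|g t|x y IHx IHy]; first by rewrite Psi0 [LHS](tens_lift0 b).
  by rewrite Psik E1.
by rewrite PsiD [factor_mul _ _ _](tens_liftD b); congr (_ + _).
Qed.

End SkewGroupAlgebra.

(** * Realizing every character *)

Section SmashExists.
Variables (K : fieldType) (m : nat) (q : K) (hq : m.-primitive_root q).
Variables (gT : finGroupType) (s : gT -> K).
Hypotheses (s1 : s 1%g = 1) (sM : forall g g', s (g * g')%g = s g * s g').

Definition taft_action (g : gT) : {lrmorphism taft hq -> taft hq} :=
  taft_scale (hq := hq) (s g).

Lemma taft_actionP : hopf_action taft_action.
Proof.
split=> [t|g g' t|g].
- by rewrite /= s1 taft_scale_1.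
- by rewrite /= sM taft_scale_comp.
- by split=> t; [apply: taft_scale_comul|apply: taft_scale_counit].
Qed.

Lemma smash_exists : exists (E : hopfAlg K) (i : {lrmorphism taft hq -> E})
    (j : {lrmorphism group_hopf K gT -> E}),
  smash_factorization i j s /\ factorizes E (taft hq) (group_hopf K gT).
Proof.
pose E := skew_hopf taft_actionP.
pose i : {lrmorphism taft hq -> E} := skew_inl taft_actionP.
pose j : {lrmorphism group_hopf K gT -> E} := skew_inr taft_actionP.
have ci : coalg_map i := skew_inl_coalg_map taft_actionP.
have cj : coalg_map j := skew_inr_coalg_map taft_actionP.
have bij : bijective (factor_mul i j) := skew_factor_bij taft_actionP.
exists E, i, j; split.
  split=> // g.
    by rewrite [LHS]skew_act /= taft_scaleh.
  by rewrite [LHS]skew_act /= taft_scalex linearZ -scalerAl.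
exists i, j; split=> //.
- exact: skew_inl_inj.
- exact: skew_inr_inj.
Qed.
End SmashExists.

(** * Dihedral groups *)

Section Dihedral.
Local Open Scope group_scope.

(** The relations bound the group from above by the dihedral group; the cardinality excludes proper
    quotients. *)
Definition dihedral_gens (gT : finGroupType) (n : nat) (d c : gT) : Prop :=
  [/\ <[d]> <*> <[c]> = [set: gT], #|gT| = n.*2, d ^+ n = 1, c ^+ 2 = 1 &
      d ^ c = d^-1].

Lemma dihedral_gens_exist n : (1 < n)%N ->
  exists d c : 'D_(n.*2)%type, dihedral_gens n d c.
Proof.
move=> n1; have := homg_refl [set: 'D_(n.*2)%type]; rewrite (Grp_dihedral n1).
case/existsP=> -[d c] /=; rewrite !xpair_eqE.
case/and4P=> /eqP Edc /eqP dn /eqP c2 /eqP dc; exists d, c; split=> //.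
by rewrite -cardsT card_dihedral.
Qed.

Variables (gT : finGroupType) (n : nat) (d c : gT).
Hypotheses (n2 : (2 < n)%N) (gen : dihedral_gens n d c).

Let cycle_mulT : <[d]> * <[c]> = [set: gT].
Proof.
case: gen => <- _ _ _ dc; rewrite norm_joinEr // cycle_subG.
apply/normP; rewrite -cycleJ dc cycleV //.
Qed.

Lemma dihedral_formP g : exists (a : nat) (b : bool), g = d ^+ a * c ^+ b.
Proof.
have [_ _ _ c2 _] := gen; have : g \in <[d]> * <[c]> by rewrite cycle_mulT inE.
case/mulsgP=> _ _ /cycleP[a ->] /cycleP[b ->] ->; exists a, (odd b).
by rewrite -{1}[b]odd_double_half expgD -muln2 mulnC expgM c2 expg1n mulg1.
Qed.

Lemma dihedral_order : #[d] = n.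
Proof.
case: gen => _ cT dn c2 _; apply/eqP; rewrite eqn_leq.
rewrite dvdn_leq ?order_dvdn ?dn ?eqxx ?(ltn_trans _ n2) //=.
have := mul_cardG <[d]> <[c]>; rewrite cycle_mulT cardsT cT -!orderE => E1.
have c_le : (#[c] <= 2)%N by rewrite dvdn_leq // order_dvdn c2.
have : (n.*2 <= #[d] * 2)%N.
  apply: leq_trans (leq_mul (leqnn _) c_le); by rewrite E1 leq_pmulr.
by rewrite muln2 leq_double.
Qed.

Lemma dihedral_hom_ext (hT : finGroupType) (f f' : gT -> hT) :
    {morph f : g g' / g * g'} -> {morph f' : g g' / g * g'} ->
    f d = f' d -> f c = f' c -> f =1 f'.
Proof.
move=> fM fM' fd fc g; have [a [b ->]] := dihedral_formP g.
have f1 (F : gT -> hT) : {morph F : u v / u * v} -> F 1 = 1.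
  by move=> FM; apply: (mulgI (F 1)); rewrite -FM !mulg1.
have fX (F : gT -> hT) : {morph F : u v / u * v} -> forall u k, F (u ^+ k) = F u ^+ k.
  move=> FM u; elim=> [|k IHk]; first exact: f1.
  by rewrite !expgS FM IHk.
by rewrite fM fM' !fX // fd fc.
Qed.

(** The pairs [(d, x)] and [(c, y)] satisfy the dihedral relations, so the subgroup [P] they
    generate has at most [2n] elements. It projects onto [gT], which has exactly [2n]; hence [P] is
    the graph of the required homomorphism. *)
Lemma dihedral_hom_exists (hT : finGroupType) (x y : hT) :
    x ^+ n = 1 -> y ^+ 2 = 1 -> x ^ y = x^-1 ->
  exists f : gT -> hT, [/\ {morph f : g g' / g * g'}, f d = x & f c = y].
Proof.
move=> xn y2 xy; have [_ cT dn c2 dc] := gen.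
have n1 : (1 < n)%N := ltnW n2.
pose u := (d, x); pose v := (c, y); pose P := (<[u]> <*> <[v]>)%G.
have pX (w : gT * hT) k : w ^+ k = (w.1 ^+ k, w.2 ^+ k).
  by elim: k => [|k IHk] //; rewrite !expgS IHk.
have P_le : (#|P| <= n.*2)%N.
  rewrite dvdn_leq ?double_gt0 ?(ltnW n1) // -(card_dihedral n1) card_homg //.
  rewrite (Grp_dihedral n1); apply/existsP; exists (u, v) => /=.
  rewrite !xpair_eqE eqxx !pX /= dn xn -!expg2 c2 y2 !eqxx /=.
  by rewrite -[_ * (d * c)]/(d ^ c) dc -[_ * (x * y)]/(x ^ y) xy !eqxx.
have uP : u \in P by rewrite mem_gen // inE cycle_id.
have vP : v \in P by rewrite mem_gen // inE cycle_id orbT.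
have surj g : exists t, (g, t) \in P.
  have [a [b ->]] := dihedral_formP g; exists (x ^+ a * y ^+ b).
  have -> : (d ^+ a * c ^+ b, x ^+ a * y ^+ b) = u ^+ a * v ^+ b by rewrite !pX.
  by rewrite groupM ?groupX.
have inj : {in P &, injective fst}.
  apply/imset_injP; rewrite eqn_leq leq_imset_card /=.
  apply: leq_trans P_le _; rewrite -cT -cardsT subset_leq_card //.
  by apply/subsetP => g _; have [t tP] := surj g; apply/imsetP; exists (g, t).
have uniqP g t t' : (g, t) \in P -> (g, t') \in P -> t = t'.
  by move=> tP t'P; have [] : (g, t) = (g, t') by apply: inj.
have [f fP] := fin_all_exists surj; exists f; split.
- by move=> g g'; apply: (uniqP (g * g')) => //; apply: (groupM (fP g) (fP g')).
- exact: (uniqP d).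
- exact: (uniqP c).
Qed.

(* An injective endomorphism maps the rotation [d] to a rotation: its image has
   order [n > 2], and the elements outside [<[d]>] are involutions. *)
Lemma dihedral_rot_endo (phi : gT -> gT) :
    injective phi -> {morph phi : g g' / g * g'} -> exists a, phi d = d ^+ a.
Proof.
move=> phi_inj phiM; have [_ _ _ c2 dc] := gen.
have [a [[] Ephi]] := dihedral_formP (phi d); last first.
  by exists a; rewrite Ephi mulg1.
have phi1 : phi 1 = 1 by apply: (mulgI (phi 1)); rewrite -phiM !mulg1.
suff d2 : d ^+ 2 = 1.
  have : (#[d] %| 2)%N by rewrite order_dvdn d2.
  by rewrite dihedral_order => /dvdn_leq-/(_ isT); rewrite leqNgt n2.
apply: phi_inj; rewrite phi1 expgS expg1 phiM Ephi.
have cV : c^-1 = c by apply: (mulgI c); rewrite mulgV -expg2 c2.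
have -> : d ^+ a * c ^+ true * (d ^+ a * c ^+ true) = d ^+ a * (d ^+ a) ^ c.
  by rewrite /conjg cV expg1 !mulgA.
by rewrite conjXg dc expgVn mulgV.
Qed.

(** This automorphism changes the value of a character at [c] by its value at [d], and so fuses the
    two characters that are -1 on [d]. *)
Lemma dihedral_shear : exists phi psi : gT -> gT,
  [/\ cancel phi psi, cancel psi phi, {morph phi : g g' / g * g'},
      phi d = d & phi c = d * c].
Proof.
have [_ _ dn c2 dc] := gen.
have cV : c^-1 = c by apply: (mulgI c); rewrite mulgV -expg2 c2.
have shear e : d ^ e = d -> e ^ c = e^-1 -> exists f : gT -> gT,
    [/\ {morph f : g g' / g * g'}, f d = d & f c = e * c].
  move=> de ec; apply: dihedral_hom_exists => //; last by rewrite conjgM de dc.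
  have -> : (e * c) ^+ 2 = e * e ^ c by rewrite expg2 /conjg cV !mulgA.
  by rewrite ec mulgV.
have dd : d ^ d = d by rewrite /conjg mulKg.
have [phi [phiM phid phic]] := shear d dd dc.
have [psi [psiM psid psic]] : exists f : gT -> gT,
    [/\ {morph f : g g' / g * g'}, f d = d & f c = d^-1 * c].
  by apply: shear; [rewrite /conjg invgK mulgV mulg1|rewrite conjVg dc].
have hV (f : gT -> gT) : {morph f : g g' / g * g'} -> f d^-1 = (f d)^-1.
  move=> fM; apply: (mulgI (f d)); rewrite -fM !mulgV.
  by apply: (mulgI (f 1)); rewrite -fM !mulg1.
exists phi, psi; split=> //.
- apply: (@dihedral_hom_ext gT (psi \o phi) id) => //=.
  + by move=> g g' /=; rewrite phiM psiM.
  + by rewrite phid psid.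
  + by rewrite phic psiM psid psic mulKVg.
- apply: (@dihedral_hom_ext gT (phi \o psi) id) => //=.
  + by move=> g g' /=; rewrite psiM phiM.
  + by rewrite psid phid.
  + by rewrite psic phiM hV // phid phic mulKg.
Qed.

End Dihedral.

(** * Characters of dihedral groups *)

Definition is_char (K : fieldType) (gT : finGroupType) (s : gT -> K) : Prop :=
  s 1%g = 1 /\ forall g g', s (g * g')%g = s g * s g'.

Section DihedralChar.
Variables (K : fieldType) (gT : finGroupType) (n : nat) (d c : gT).
Hypotheses (n2 : (2 < n)%N) (gen : dihedral_gens n d c).

Lemma is_charX (s : gT -> K) g k : is_char s -> s (g ^+ k)%g = s g ^+ k.
Proof.
by move=> [s1 sM]; elim: k => [|k IHk] //; rewrite expgS sM IHk -exprS.
Qed.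

Lemma dihedral_char_ext (s s' : gT -> K) : is_char s -> is_char s' ->
  s d = s' d -> s c = s' c -> s =1 s'.
Proof.
move=> cs cs' sd sc g; have [a [b ->]] := dihedral_formP gen g.
by rewrite cs.2 cs'.2 !is_charX // sd sc.
Qed.

(** A character takes equal values on the conjugate elements [d] and [d^-1], so its value at [d]
    squares to 1. *)
Lemma dihedral_char_sqr (s : gT -> K) g : is_char s -> s g ^+ 2 = 1.
Proof.
move=> cs; have [_ _ _ c2 dc] := gen.
have sV u : s u * s u^-1%g = 1 by rewrite -cs.2 mulgV cs.1.
have sc : s c ^+ 2 = 1 by rewrite -is_charX // c2 cs.1.
have sd : s d ^+ 2 = 1.
  have sdV : s d^-1%g = s d.
    by rewrite -dc /conjg !cs.2 mulrCA (mulrC (s c^-1%g)) sV mulr1.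
  by rewrite expr2 -{2}sdV sV.
have [a [b ->]] := dihedral_formP gen g.
by rewrite cs.2 !is_charX // exprMn -!exprM mulnC (mulnC b) !exprM sd sc !expr1n mulr1.
Qed.

Lemma dihedral_char_sign (s : gT -> K) g : is_char s -> s g = 1 \/ s g = -1.
Proof.
move=> cs; have /eqP := dihedral_char_sqr g cs.
by rewrite sqrf_eq1 => /orP[] /eqP; [left|right].
Qed.

Lemma dihedral_char_odd (s : gT -> K) : odd n -> is_char s -> s d = 1.
Proof.
move=> on cs; have [_ _ dn _ _] := gen; have := is_charX d n cs.
rewrite dn cs.1 -[n]odd_double_half on exprD -muln2 mulnC exprM.
by rewrite dihedral_char_sqr // expr1n mulr1 expr1.
Qed.

(** The signs are built as a homomorphism to Z/2, realized by ['I_2], where the relation [d^n = 1]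
    is what constrains the sign at [d]. *)
Lemma dihedral_char_exists (ed ec : bool) : (ed -> ~~ odd n) ->
  exists s : gT -> K, [/\ is_char s, s d = (-1) ^+ ed & s c = (-1) ^+ ec].
Proof.
move=> ed_n; pose x (e : bool) : 'I_2 := inord e.
have xE e : (x e : nat) = e by rewrite /x inordK // ltnS leq_b1.
have x2 e : (x e ^+ 2 = 1)%g by apply: val_inj; case: e; rewrite expg2 /= !xE.
have [||y [yM yd yc]] := @dihedral_hom_exists gT n d c n2 gen _ (x ed) (x ec) _ (x2 ec).
- case: ed ed_n => [/(_ isT) en|_].
    by rewrite -[n]odd_double_half (negPf en) -muln2 mulnC expgM x2 expg1n.
  by rewrite (_ : x false = 1%g) ?expg1n //; apply: val_inj; rewrite /= xE.
- have xV e : ((x e)^-1 = x e)%g by apply: (mulgI (x e)); rewrite mulgV -expg2 x2.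
  by rewrite xV /conjg xV; apply: val_inj; case: (ed) (ec) => [] []; rewrite /= !xE.
have y1 : y 1%g = 1%g by apply: (mulgI (y 1%g)); rewrite -yM !mulg1.
exists (fun g => (-1) ^+ (y g)); split; rewrite ?yd ?yc ?xE //.
split=> [|g g']; first by rewrite y1.
by rewrite yM /= -exprD -signr_odd modn2 oddb signr_odd.
Qed.

(** The two invariants that separate orbits. Being trivial on [d] is preserved since automorphisms
    map rotations to rotations. *)
Lemma dihedral_char_rot (s s' : gT -> K) (phi : gT -> gT) :
    is_char s -> is_char s' -> injective phi ->
    {morph phi : g g' / (g * g')%g} -> (forall g, s' (phi g) = s g) ->
  (s d == 1) = (s' d == 1) /\
  ((s d == 1) && (s c == 1)) = ((s' d == 1) && (s' c == 1)).
Proof.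
move=> cs cs' phi_inj phiM sE.
have [psi phiK psiK] := injF_bij phi_inj.
have psiM : {morph psi : g g' / (g * g')%g}.
  by move=> g g'; apply: phi_inj; rewrite phiM !psiK.
have [a Ea] := dihedral_rot_endo n2 gen phi_inj phiM.
have [b Eb] := dihedral_rot_endo n2 gen (can_inj psiK) psiM.
have triv : is_char (fun _ : gT => 1 : K) by split=> // g g'; rewrite mulr1.
split; first apply/eqP/eqP => [sd|s'd].
- by rewrite -[d]psiK Eb sE is_charX // sd expr1n.
- by rewrite -sE Ea is_charX // s'd expr1n.
apply/andP/andP => -[/eqP sd /eqP sc].
  by rewrite -[d]psiK -[c]psiK !sE !(dihedral_char_ext cs triv sd sc).
by rewrite -!sE !(dihedral_char_ext cs' triv sd sc).
Qed.

End DihedralChar.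

(** * Counting *)

(** Reduces the count to choosing representatives [s k] of characters. Inequivalence is asked for
    arbitrary exponents [e], as [smash_compare] yields them; covering asks for [e] additive modulo
    [m], as [smash_twist] requires. *)
Lemma num_types_smash (K : fieldType) (p : nat) (q : K)
    (hq : p.+1.-primitive_root q) (gT : finGroupType) (N : nat)
    (s : 'I_N -> gT -> K) :
    (0 < p)%N -> (forall k, is_char (s k)) ->
    (forall k l (phi : gT -> gT) (e : gT -> nat), injective phi ->
      {morph phi : g g' / (g * g')%g} ->
      (forall g, s l (phi g) = s k g * q ^+ e g) -> k = l) ->
    (forall t, is_char t -> exists k (phi psi : gT -> gT) (e : gT -> nat),
      [/\ cancel phi psi, cancel psi phi, {morph phi : g g' / (g * g')%g},
          forall g g', e (g * g')%g = (e g + e g')%N %[mod p.+1] &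
          forall g, t g * q ^+ e g = s k (phi g)]) ->
  num_types (fun E => factorizes E (taft hq) (group_hopf K gT)) N.
Proof.
move=> p0 cs sinj scov.
have [E EP] := fin_all_exists (fun k => smash_exists hq (cs k).1 (cs k).2).
exists E; split=> [k|k l [f [cf bf]]|H fH].
- by have [i [j []]] := EP k.
- have [i [j [smk _]]] := EP k; have [i' [j' [sml _]]] := EP l.
  have [phi [e [phi_inj phiM se]]] :=
    smash_compare p0 (smash_transport cf bf smk) sml.
  exact: sinj phi_inj phiM se.
- have [i [j [t smH]]] := factorizes_smash p0 fH.
  have ct : is_char t.
    by split=> [|g g']; [exact: smash_char1 smH|exact: smash_charM smH _ _].
  have [k [phi [psi [e [phiK psiK phiM eM te]]]]] := scov t ct.
  exists k; have [i' [j' [smk _]]] := EP k.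
  have [j2 smj2] := smash_twist smk phiK psiK phiM eM te.
  exact: smash_iso smH smj2.
Qed.

Section DihedralTypes.
Variables (K : fieldType) (p n : nat) (q : K).
Local Notation m := p.+1.
Variables (hq : m.-primitive_root q) (gT : finGroupType) (d c : gT).
Hypotheses (p0 : (0 < p)%N) (n2 : (2 < n)%N) (gen : dihedral_gens n d c).
Local Notation types :=
  (num_types (fun E => factorizes E (taft hq) (group_hopf K gT))).

(** Since [q ^+ m./2 = -1], every sign character is absorbed by twisting with powers of [h], without
    moving the group. *)
Lemma num_types_dihedral_even : ~~ odd m -> types 1.
Proof.
move=> em; have c1 : is_char (fun _ : gT => 1 : K).
  by split=> // g g'; rewrite mulr1.
apply: (@num_types_smash _ _ _ _ _ 1 (fun _ _ => 1)) => // [k l|t ct].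
  by rewrite !ord1.
have qm2 : q ^+ m./2 = -1.
  have m2 : (m./2.*2 = m)%N by rewrite -[RHS]odd_double_half (negPf em).
  have /eqP : q ^+ m./2 ^+ 2 = 1 by rewrite -exprM muln2 m2 prim_expr_order.
  rewrite sqrf_eq1 => /orP[|/eqP //]; rewrite -(prim_order_dvd hq).
  move/dvdn_leq; rewrite half_gt0 ltnS p0 => /(_ isT).
  by rewrite leqNgt -{2}m2 -addnn -{1}[m./2]addn0 ltn_add2l half_gt0 ltnS p0.
have tE g : t g = (-1) ^+ (t g != 1).
  by case: eqP => //; case: (dihedral_char_sign gen g ct) => -> //.
(* The exponent is additive modulo [m] because [q ^+ e g] is the multiplicative function [t g]
   itself. *)
exists 0, id, id, (fun g => ((t g != 1%R) * m./2)%N); split=> // [g g'|g].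
  apply/eqP; rewrite -(eq_prim_root_expr hq) exprD -!(mulnC m./2) !exprM.
  by rewrite qm2 -!tE ct.2.
by rewrite mulnC exprM qm2 -tE -expr2 (dihedral_char_sqr gen).
Qed.

(** The bits [ed k] and [ec k] record the signs of the representative at [d] and [c]. The complete
    invariant is whether the character is nontrivial on [d], and whether it is nontrivial at all:
    for [ed k] true, the shear makes the sign at [c] irrelevant. *)
Lemma num_types_dihedral_odd N (ed ec : 'I_N -> bool) :
    odd m -> 2%N \notin [pchar K] -> (forall k, ed k -> ~~ odd n) ->
    injective (fun k => (ed k, ed k || ec k)) ->
    (forall b b' : bool, (b -> ~~ odd n) ->
      exists2 k, ed k = b & b || (ec k == b')) ->
  types N.
Proof.
move=> om char2 edn einj ecov.
have N1 : (-1 == 1 :> K) = false.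
  apply: contraNF char2 => /eqP N1; rewrite inE /= -[2%:R]/(1 + 1) -{1}N1.
  by rewrite addNr eqxx.
have [s sP] := fin_all_exists (fun k => dihedral_char_exists K n2 gen (ec k) (edn k)).
have cs k : is_char (s k) by case: (sP k).
have sd k : (s k d == 1) = ~~ ed k.
  by case: (sP k) => _ -> _; case: (ed k); rewrite /= ?eqxx.
have sc k : (s k c == 1) = ~~ ec k.
  by case: (sP k) => _ _ ->; case: (ec k); rewrite /= ?eqxx.
apply: (@num_types_smash _ _ _ _ _ _ s) => // [k l phi e phi_inj phiM se|t ct].
  have {}se g : s l (phi g) = s k g.
    (* Both characters square to 1, so [q ^+ (2 * e g) = 1], and 2 is invertible modulo the odd
       [m]. *)
    suff qe : q ^+ e g = 1 by rewrite se qe mulr1.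
    have := dihedral_char_sqr gen (phi g) (cs l); rewrite se exprMn.
    rewrite (dihedral_char_sqr gen) // mul1r -exprM => /eqP.
    rewrite -(prim_order_dvd hq) Gauss_dvdl ?coprimen2 //.
    by rewrite (prim_order_dvd hq) => /eqP.
  have [] := dihedral_char_rot n2 gen (cs k) (cs l) phi_inj phiM se.
  rewrite !sd !sc -!negb_or => /negb_inj Ed /negb_inj Ec.
  by apply: einj; rewrite /= Ec Ed.
have tE g : t g = (-1) ^+ (t g != 1).
  by case: eqP => //; case: (dihedral_char_sign gen g ct) => -> //.
have [|k Ed Ec] := ecov (t d != 1) (t c != 1).
  by apply: contraNN => on; rewrite (dihedral_char_odd gen on ct).
have [_ skd skc] := sP k.
(* A mismatch at [c] can only occur when [t d = -1], and is then repaired by the shear. *)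
have [Ekc|nEc] := eqVneq (ec k) (t c != 1).
  exists k, id, id, (fun=> 0%N); split=> // g; rewrite mulr1.
  by apply: (dihedral_char_ext gen ct (cs k)); rewrite ?skd ?skc tE ?Ed ?Ekc.
have [phi [psi [phiK psiK phiM phid phic]]] := dihedral_shear n2 gen.
exists k, phi, psi, (fun=> 0%N); split=> // g; rewrite mulr1.
apply: (@dihedral_char_ext _ _ _ _ _ gen t (s k \o phi)) => //=.
- have phi1 : phi 1%g = 1%g by apply: (mulgI (phi 1%g)); rewrite -phiM !mulg1.
  by split=> [|u v] /=; rewrite ?phi1 ?phiM; case: (cs k).
- by rewrite phid skd tE Ed.
- move: Ec; rewrite (negPf nEc) orbF => Ec.
  rewrite phic (cs k).2 skd skc Ed Ec mulN1r tE.
  by move: nEc; case: (ec k); case: (t c != 1); rewrite //= opprK.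
Qed.
End DihedralTypes.

Theorem theorem2p5 (K : fieldType) (m n : nat) (q : K)
    (hm : (2 <= m)%N) (hn : (3 <= n)%N) (hq : m.-primitive_root q)
    (hK : odd m -> 2%N \notin [pchar K]) :
  [/\ odd m -> odd n ->
        num_types (fun E => factorizes E (taft hq)
                              (group_hopf K 'D_(n.*2)%type)) 2,
      odd m -> ~~ odd n ->
        num_types (fun E => factorizes E (taft hq)
                              (group_hopf K 'D_(n.*2)%type)) 3 &
      ~~ odd m ->
        num_types (fun E => factorizes E (taft hq)
                              (group_hopf K 'D_(n.*2)%type)) 1].
Proof.
case: m hm hq hK => [|p] // hm hq hK.
have [d [c gen]] := dihedral_gens_exist (ltnW hn).
split=> [om on|om en|em].
- apply: (@num_types_dihedral_odd K p n q hq _ d c hm hn gen 2 (fun=> false)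
    (fun k => k == 1%N :> nat)) => //; first exact: hK.
    by case=> [[|[]]] // ? [[|[]]] // ? //= ?; apply: val_inj.
  move=> b b' bn; have -> : b = false by apply: contraTF on.
  by exists (inord b') => //=; rewrite inordK; case: b'.
(* Representatives: index 0 is the trivial character, 1 is -1 only on reflections, and 2 stands for
   both characters that are -1 on [d]. *)
- apply: (@num_types_dihedral_odd K p n q hq _ d c hm hn gen 3
    (fun k => k == 2%N :> nat) (fun k => k == 1%N :> nat)) => //; first exact: hK.
    by case=> [[|[|[]]]] // ? [[|[|[]]]] // ? //= ?; apply: val_inj.
  move=> b b' _; exists (inord (if b then 2%N else b')).
    by rewrite inordK; case: b b' => [] [].
  by rewrite inordK; case: b b' => [] [].
- exact: (@num_types_dihedral_even K p n q hq _ d c hm gen em).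
Qed.
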